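(* (a) Let $b\ge0$ be an integer and let $(M_0,k_0)\in\mathbb C^2$ be a point of the line $\{M=-b(k+2)\}$ which does not belong to any other resonance line. Then the vector-valued function $X_b(M,k-M)$ of $(M,k)$ can be analytically continued to the point $(M_0,k_0)$, and the vector $X_b(M_0,k_0-M_0)$ is a (nonzero) singular vector of $V(M_0,k_0-M_0)$. (b) Let $b>0$ be an integer and let $(M_0,k_0)\in\mathbb C^2$ be a point of the line $\{M=-2+b(k+2)\}$ which does not belong to any other resonance line. Then the vector-valued function $Y_b(M,k-M)$ of $(M,k)$ can be analytically continued to the point $(M_0,k_0)$, and the vector $Y_b(M_0,k_0-M_0)$ is a (nonzero) singular vector of $V(M_0,k_0-M_0)$.
   Context: **Affine algebra.** $e,f,h$ are the standard generators of $\mathfrak{sl}_2$: $[e,f]=h,\ [h,e]=2e,\ [h,f]=-2f$. $\widehat{\mathfrak{sl}}_2=\mathfrak{sl}_2[T,T^{-1}]\oplus\mathbb C c$ with $c$ central and $[aT^i,bT^j]=[a,b]T^{i+j}+i\,\mathrm{tr}(ab)\,\delta_{i+j,0}\,c$. Write $X/T^i$ for $XT^{-i}$. Put $f_1=f,\ e_1=e,\ h_1=h,\ f_2=eT^{-1},\ e_2=fT,\ h_2=c-h$. **Verma modules.** For $M,k\in\mathbb C$, $V=V(M,k-M)$ is the Verma module on which $c$ acts by $k$, generated by $v$ with $e_1v=e_2v=0$, $h_1v=Mv$, $h_2v=(k-M)v$. With $\hat{\mathfrak n}_-$ the Lie subalgebra generated by $f_1,f_2$, the map $U\hat{\mathfrak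 n}_-\to V$, $F\mapsto Fv$, is an isomorphism; via it the Verma modules for different $(M,k)$ are identified with one fixed vector space (so vectors in them for different $(M,k)$ can be compared). $V$ is graded by $\mathbb Z_{\ge0}^2$: $f_{i_1}\cdots f_{i_p}v$ has degree $(p_1,p_2)$, $p_i$ being the number of $i$'s in the sequence; the components $V_\gamma$ are finite-dimensional. A homogeneous vector $\omega\in V$ not proportional to $v$ is called singular if $e_1\omega=e_2\omega=0$. $V^*=\bigoplus_\gamma V_\gamma^*$. **Shapovalov form.** $S$ is the unique symmetric bilinear form on $V$ with $S(v,v)=1$, $S(f_ix,y)=S(x,e_iy)$ for $i=1,2$, $x,y\in V$; it is regarded as a map $S:V\to V^*$. **Bases.** For $\gamma=(p_1,p_2)$ with $p_1>p_2$, fix the basis of $V_\gamma$ consisting of all $\frac f{T^{i_1}}\cdots\frac f{T^{i_a}}\frac h{T^{j_1}}\cdots\frac h{T^{j_b}}\frac e{T^{l_1}}\cdots\frac e{T^{l_c}}v$ with $0\le i_a\le\dots\le i_1$, $1\le j_b\le\dots\le j_1$, $1\le l_c\le\dots\le l_1$, $\sum i_s+\sum j_s+\sum l_s+a-c=p_1$, $\sum i_s+\sum j_s+\sum l_s=p_2$. For $p_1<p_2$ fix the basis of all $\frac e{T^{l_1}}\cdots\frac e{T^{l_c}}\frac h{T^{j_1}}\cdots\frac h{T^{j_b}}\frac f{T^{i_1}}\cdots\frac f{T^{i_a}}v$ with the same index conditions. For a basis element $x$, $x^*$ denotes the corresponding element of the dual basis of $V_\gamma^*$. **Resonance lines.**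 These are the lines in the $(M,k)$-plane $M=l-1-(a-1)(k+2)$, $M=-l-1+a(k+2)$ ($l,a\in\mathbb Z_{>0}$), and $k+2=0$. For $(M,k)$ on none of them $S$ is non-degenerate. **The vectors.** For $(M,k)$ on no resonance line set $$X_b(M,k-M)=S^{-1}\Big((M+b(k+2))\Big(\frac f{T^b}v\Big)^*\Big)\ (b\ge0),\qquad Y_b(M,k-M)=S^{-1}\Big((k-M+(b-1)(k+2))\Big(\frac e{T^b}v\Big)^*\Big)\ (b\ge1),$$ elements of $V(M,k-M)$ of degrees $(b+1,b)$ and $(b-1,b)$; they are holomorphic functions of $(M,k)$ off the resonance lines. $X_b(M_0,k_0-M_0)$, $Y_b(M_0,k_0-M_0)$ denote the values of the analytic continuations. *)

(* Defs.v *)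
From HB Require Import structures.
From mathcomp Require Import all_boot all_order all_algebra.
From mathcomp Require Import complex.
From mathcomp Require Import all_classical all_reals all_analysis.

Set Implicit Arguments.
Unset Strict Implicit.
Unset Printing Implicit Defensive.

Import Order.TTheory GRing.Theory Num.Theory.
Import numFieldNormedType.Exports.

Local Open Scope classical_set_scope.
Local Open Scope ring_scope.
Local Open Scope complex_scope.

(* sl_2 is the space of traceless 2 x 2 matrices. *)
Definition sl2_e (K : pzRingType) : 'M[K]_2 := delta_mx 0 1.
Definition sl2_f (K : pzRingType) : 'M[K]_2 := delta_mx 1 0.
Definition sl2_h (K : pzRingType) : 'M[K]_2 := delta_mx 0 0 - delta_mx 1 1.

(* A module over sl_2[T, T^-1] + C c: [act a n] is the action of a T^n and
   [cen] that of c.  Since the elements a T^n (linear in a) and c span the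
   affine algebra, this is the same as a Lie algebra morphism to End(V).
   The values [act a n] for \tr a != 0 carry no meaning and are never used. *)
Record affine_module (K : fieldType) (V : lmodType K) := AffineModule {
  act : 'M[K]_2 -> int -> {linear V -> V};
  cen : {linear V -> V};
  act_linear : forall (s : K) (a b : 'M[K]_2) (n : int) (x : V),
    \tr a = 0 -> \tr b = 0 ->
    act (s *: a + b) n x = s *: act a n x + act b n x;
  act_bracket : forall (a b : 'M[K]_2) (m n : int) (x : V),
    \tr a = 0 -> \tr b = 0 ->
    act a m (act b n x) - act b n (act a m x) =
      act (a *m b - b *m a) (m + n) x
      + (if m + n == 0 then (m%:~R * \tr (a *m b)) *: cen x else 0);
  cen_central : forall (a : 'M[K]_2) (n : int) (x : V),
    \tr a = 0 -> act a n (cen x) = cen (act a n x) }.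

Definition modE (K : fieldType) (V : lmodType K) (A : affine_module V)
  (n : int) : V -> V := act A (sl2_e K) n.
Definition modF (K : fieldType) (V : lmodType K) (A : affine_module V)
  (n : int) : V -> V := act A (sl2_f K) n.
Definition modH (K : fieldType) (V : lmodType K) (A : affine_module V)
  (n : int) : V -> V := act A (sl2_h K) n.

Section Generators.
Variables (K : fieldType) (V : lmodType K) (A : affine_module V).

Definition e1 : V -> V := modE A 0.
Definition f1 : V -> V := modF A 0.
Definition h1 : V -> V := modH A 0.
Definition e2 : V -> V := modF A 1.
Definition f2 : V -> V := modE A (- 1).
Definition h2 (x : V) : V := cen A x - modH A 0 x.

End Generators.

Definition highest_weight (K : fieldType) (V : lmodType K)
    (A : affine_module V) (M k : K) (v : V) : Prop :=
  [/\ e1 A v = 0, e2 A v = 0, h1 A v = M *: v, h2 A v = (k - M) *: v &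
      forall x : V, cen A x = k *: x].

Definition generated_by (K : fieldType) (V : lmodType K)
    (A : affine_module V) (v : V) : Prop :=
  forall P : set V,
    (forall (s : K) (x y : V), P x -> P y -> P (s *: x + y)) ->
    (forall (a : 'M[K]_2) (n : int) (x : V),
       \tr a = 0 -> P x -> P (act A a n x)) ->
    (forall x : V, P x -> P (cen A x)) ->
    P v -> forall x : V, P x.

Definition affine_hom (K : fieldType) (V W : lmodType K)
    (A : affine_module V) (B : affine_module W) (g : {linear V -> W}) : Prop :=
  (forall (a : 'M[K]_2) (n : int) (x : V),
     \tr a = 0 -> g (act A a n x) = act B a n (g x)) /\
  (forall x : V, g (cen A x) = cen B (g x)).

(* The Verma module V(M, k - M): the universal module generated by a vector
   with the prescribed highest weight and central charge. *)
Definition is_verma (K : fieldType) (V : lmodType K)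
    (A : affine_module V) (M k : K) (v : V) : Prop :=
  [/\ highest_weight A M k v, generated_by A v &
      forall (W : lmodType K) (B : affine_module W) (w : W),
        highest_weight B M k w ->
        exists g : {linear V -> W}, affine_hom A B g /\ g v = w].

(* The Verma modules for all p = (M, k), realized on one vector space V with a
   common generator v.  Requiring f_1 and f_2 to act independently of p is the
   identification of all of them through F |-> F v, F in U n_-. *)
Definition verma_family (K : fieldType) (V : lmodType K)
    (A : K * K -> affine_module V) (v : V) : Prop :=
  (forall p : K * K, is_verma (A p) p.1 p.2 v) /\
  (forall (p q : K * K) (x : V),
     f1 (A p) x = f1 (A q) x /\ f2 (A p) x = f2 (A q) x).

Section Grading.
Variables (K : fieldType) (V : lmodType K) (A : affine_module V) (v : V).

(* f_{i_1} ... f_{i_p} v, where [true] stands for the index 1 and [false] for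
   the index 2. *)
Definition fword (w : seq bool) : V :=
  foldr (fun (i : bool) (x : V) => if i then f1 A x else f2 A x) v w.

(* The component V_g, g = (p_1, p_2), of V. *)
Definition component (g : nat * nat) : set V :=
  [set x | exists (n : nat) (c : 'I_n -> K) (w : 'I_n -> seq bool),
     (forall i, count_mem true (w i) = g.1 /\ count_mem false (w i) = g.2) /\
     x = \sum_i c i *: fword (w i)].

Definition singular (x : V) : Prop :=
  [/\ exists g : nat * nat, component g x,
      ~ (exists s : K, x = s *: v), e1 A x = 0 & e2 A x = 0].

Definition is_shapovalov (S : V -> V -> K) : Prop :=
  [/\ forall x y, S x y = S y x,
      forall s x y z, S (s *: x + y) z = s * S x z + S y z,
      S v v = 1,
      forall x y, S (f1 A x) y = S x (e1 A y) &
      forall x y, S (f2 A x) y = S x (e2 A y)].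

(* A triple (sF, sH, sE) lists the exponents i, j, l of the factors f/T^i, h/T^j,
   e/T^l, each in non-increasing order. *)
Definition pbw_triple : Type := (seq nat * seq nat * seq nat)%type.

Definition pbw_index (g : nat * nat) (t : pbw_triple) : bool :=
  let: (sF, sH, sE) := t in
  [&& sorted geq sF, sorted geq sH && all (leq 1) sH,
      sorted geq sE && all (leq 1) sE,
      sumn sF + sumn sH + sumn sE + size sF == g.1 + size sE &
      sumn sF + sumn sH + sumn sE == g.2]%N.

Definition divF (s : seq nat) (x : V) : V :=
  foldr (fun i : nat => modF A (- i%:Z)) x s.
Definition divH (s : seq nat) (x : V) : V :=
  foldr (fun j : nat => modH A (- j%:Z)) x s.
Definition divE (s : seq nat) (x : V) : V :=
  foldr (fun l : nat => modE A (- l%:Z)) x s.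

(* The basis is only meant for p_1 != p_2. *)
Definition pbw_vec (g : nat * nat) (t : pbw_triple) : V :=
  let: (sF, sH, sE) := t in
  if (g.2 < g.1)%N then divF sF (divH sH (divE sE v))
  else divE sE (divH sH (divF sF v)).

(* The element x^* of V_g^* dual to the basis vector x of index t.  An element
   of V_g^* is viewed in V^* as a linear form on V vanishing on the other
   components. *)
Definition is_dual_vec (g : nat * nat) (t : pbw_triple) (phi : V -> K) : Prop :=
  [/\ forall s x y, phi (s *: x + y) = s * phi x + phi y,
      forall t', pbw_index g t' -> phi (pbw_vec g t') = (t' == t)%:R &
      forall g' x, g' != g -> component g' x -> phi x = 0].

Definition dual_vec (g : nat * nat) (t : pbw_triple) : V -> K :=
  xget (fun=> 0) [set phi | is_dual_vec g t phi].

End Grading.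

(* S^-1 phi for S : V -> V^*, x |-> S(x, .); it only has a meaning when phi has
   exactly one preimage. *)
Definition form_inv (K : fieldType) (V : lmodType K) (S : V -> V -> K)
    (phi : V -> K) : V :=
  xget 0 [set x | forall y, S x y = phi y].

Section Vectors.
Variables (K : fieldType) (V : lmodType K).
Variables (A : K * K -> affine_module V) (v : V) (S : K * K -> V -> V -> K).

Definition Xvec (b : nat) (p : K * K) : V :=
  form_inv (S p) (fun y => (p.1 + b%:R * (p.2 + 2)) *
    dual_vec (A p) v (b.+1, b) ([:: b], [::], [::]) y).

Definition Yvec (b : nat) (p : K * K) : V :=
  form_inv (S p) (fun y => (p.2 - p.1 + (b%:R - 1) * (p.2 + 2)) *
    dual_vec (A p) v (b.-1, b) ([::], [::], [:: b]) y).

End Vectors.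

Section Resonance.
Variable K : fieldType.

Definition lineF (l a : nat) : set (K * K) :=
  [set p | p.1 = l%:R - 1 - (a%:R - 1) * (p.2 + 2)].
Definition lineE (l a : nat) : set (K * K) :=
  [set p | p.1 = - l%:R - 1 + a%:R * (p.2 + 2)].
Definition critical_line : set (K * K) := [set p | p.2 + 2 = 0].

Definition resonance_lines : set (set (K * K)) :=
  [set L | (exists l a : nat, [/\ (0 < l)%N, (0 < a)%N &
                                  L = lineF l a \/ L = lineE l a])
           \/ L = critical_line].

Definition nonresonant : set (K * K) :=
  [set p | forall L, resonance_lines L -> ~ L p].

Definition on_line_only (L : set (K * K)) (p : K * K) : Prop :=
  L p /\ forall L', resonance_lines L' -> L' p -> L' = L.

End Resonance.

(* Holomorphy near p_0 of a function on C^2 with values in a vector space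
   without topology: the values lie in the span of finitely many fixed vectors,
   with complex-differentiable coefficients. *)
Definition holomorphic_near (R : realType) (V : lmodType R[i])
    (G : R[i] * R[i] -> V) (p0 : (R[i]^o * R[i]^o)%type) : Prop :=
  exists (n : nat) (u : 'I_n -> V) (c : 'I_n -> R[i]^o * R[i]^o -> R[i]^o),
    \forall p \near p0,
      (forall i, differentiable (c i) p) /\ G p = \sum_i c i p *: u i.

(* G is an analytic continuation to p_0 of F, which is defined on D. *)
Definition continuation_at (R : realType) (V : lmodType R[i])
    (D : set (R[i] * R[i])) (F G : R[i] * R[i] -> V)
    (p0 : (R[i]^o * R[i]^o)%type) : Prop :=
  holomorphic_near G p0 /\ \forall p \near p0, D p -> G p = F p.

(* Main.v *)
Require Import Defs.
From HB Require Import structures.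
From mathcomp Require Import all_boot all_order perm all_algebra.
From mathcomp Require Import ring lra zify.
From mathcomp Require Import complex.
From mathcomp Require Import all_classical all_reals all_analysis.
Set Implicit Arguments.
Unset Strict Implicit.
Unset Printing Implicit Defensive.
Import Order.TTheory GRing.Theory Num.Theory.
Import numFieldNormedType.Exports.
Local Open Scope ring_scope.

(** Write E_n, F_n, H_n for the actions of e T^n, f T^n, h T^n, and L for
    M + b (k + 2). Let phi be the dual basis vector of F_{-b} v. Since the
    basis of degree (b+1, b) puts the factors f/T^i on the left,
    phi (F_{-i} y) is S(v, y) for i = b and zero for i <> b.

    The Casimir operator acts by a scalar on every component of the Verma
    module ([casimirE]). Applying phi to this identity in degree (b+1, b) gives
      L phi(z) = S(F_{-b} v, z)
        + sum_{n=1}^b (1/2 phi(H_{-n} H_n z) + phi(E_{-n} F_n z)).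
    The functionals phi o H_{-n} and phi o E_{-n} live in lower degrees. Where
    the form is nondegenerate in these degrees they are S(x_n, .) and S(y_n, .)
    with x_n, y_n rational in (M, k) (Cramer's rule), and so
      X = F_{-b} v + sum_{n=1}^b (1/2 H_{-n} x_n + E_{-n} y_n)
    satisfies S(X, .) = L phi ([X_family]). Off the resonance lines X is
    S^-1 (L phi); but the formula has no pole on the line L = 0, and this is
    the analytic continuation. The vector X never vanishes: in the basis with
    the factors e, then h, then f, its coefficient at F_{-b} v is 1
    ([functional_EH]). At a point with L = 0 the vector X lies in the kernel of
    S, and e_1 X, e_2 X lie in the kernel in lower degrees, hence are zero
    ([kernel_positive], [singular_family]).

    What remains is to see where the form degenerates. Its Gram determinant in
    a fixed degree is a polynomial in (M, k). If it vanishes at a point, a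
    kernel vector of least degree is killed by all raising operators, and the
    Casimir scalar puts the point on one of finitely many lines
    n (M + 1) + p2 (k + 2) = n^2 ([kernel_casimir]). A bivariate polynomial all
    of whose zeros lie on finitely many graphs vanishes identically on a graph
    through each zero ([zero_on_graph]). But the leading form of the
    determinant is a product of the linear forms M + i k, 2 j k, l k - M, so
    the determinant does not vanish on a line of the above kind unless p2 / n
    is an integer ([gram_det_line]). Hence the form degenerates on resonance
    lines only, and only in degrees at least as high as the one that gives the
    line ([degenerate_resonant]). The same leading form shows that ordered words
    are linearly independent, for any choice of the order ([basis_free]).

    The two statements are exchanged by the diagram automorphism
    e T^n -> f T^{n+1}, f T^n -> e T^{n-1}, h T^n -> delta_{n0} c - h T^n, which
    replaces M by k - M ([swapped]). The algebra is therefore developed for an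
    abstract family of modules that covers both cases ([verma_data]). *)

(** * Linear identities in a module *)

Section LinearExpressions.
Variables (K : pzRingType) (V : lmodType K).

Inductive lin_expr :=
  | LAtom of nat | LZero | LAdd of lin_expr & lin_expr
  | LOpp of lin_expr | LScale of K & lin_expr.

Fixpoint lin_eval (env : seq V) (e : lin_expr) : V :=
  match e with
  | LAtom i => nth 0 env i
  | LZero => 0
  | LAdd a b => lin_eval env a + lin_eval env b
  | LOpp a => - lin_eval env a
  | LScale c a => c *: lin_eval env a
  end.

Fixpoint lin_coef (i : nat) (e : lin_expr) : K :=
  match e with
  | LAtom j => if eqn i j then 1 else 0
  | LZero => 0
  | LAdd a b => lin_coef i a + lin_coef i b
  | LOpp a => - lin_coef i a
  | LScale c a => c * lin_coef i a
  end.

Fixpoint same_coefs (n : nat) (a b : lin_expr) : Prop :=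
  if n is n'.+1 then lin_coef n' a = lin_coef n' b /\ same_coefs n' a b
  else True.

Lemma lin_evalE env e :
  lin_eval env e = \sum_(i < size env) lin_coef i e *: env`_i.
Proof.
elim: e => [j||a IHa b IHb|a IHa|c a IHa] /=.
- case: (ltnP j (size env)) => hj.
    rewrite (bigD1 (Ordinal hj)) //= eqnE eqxx scale1r big1 ?addr0 // => i.
    rewrite -val_eqE /= => /negPf nij; by rewrite nij scale0r.
  rewrite nth_default // big1 // => i _; rewrite eqnE.
  by case: eqP => [e|_]; rewrite ?scale0r //; have := ltn_ord i; rewrite e ltnNge hj.
- by rewrite big1 // => i _; rewrite scale0r.
- by rewrite IHa IHb -big_split; apply: eq_bigr => i _; rewrite scalerDl.
- by rewrite IHa -sumrN; apply: eq_bigr => i _; rewrite scaleNr.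
- by rewrite IHa scaler_sumr; apply: eq_bigr => i _; rewrite scalerA.
Qed.

Lemma lin_eval_eq env a b :
  same_coefs (size env) a b -> lin_eval env a = lin_eval env b.
Proof.
rewrite !lin_evalE => h; apply: eq_bigr => i _; congr (_ *: _).
elim: (size env) h (i : nat) (ltn_ord i) => //= n IH [e h] j.
by rewrite ltnS leq_eqVlt => /orP[/eqP ->|/IH]; last exact.
Qed.
End LinearExpressions.

(** Atoms are compared up to conversion, because equal ones may be presented
    through different paths of the structure hierarchy. *)
Ltac lin_insert t env :=
  match env with
  | nil => constr:(cons t nil)
  | cons ?x ?r =>
    match constr:(tt) with
    | _ => let _ := constr:(@erefl _ x : x = t) in env
    | _ => let r' := lin_insert t r in constr:(cons x r')
    end
  end.
Ltac lin_atoms t env :=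
  match t with
  | (?a + ?b)%R => let env := lin_atoms a env in lin_atoms b env
  | (- ?a)%R => lin_atoms a env
  | (_ *: ?a)%R => lin_atoms a env
  | (0)%R => env
  | _ => lin_insert t env
  end.
Ltac lin_index t env :=
  match env with
  | cons ?x ?r =>
    match constr:(tt) with
    | _ => let _ := constr:(@erefl _ x : x = t) in constr:(0%nat)
    | _ => let i := lin_index t r in constr:(S i)
    end
  end.
Ltac lin_reify K t env :=
  match t with
  | (?a + ?b)%R => let a' := lin_reify K a env in
    let b' := lin_reify K b env in constr:(@LAdd K a' b')
  | (- ?a)%R => let a' := lin_reify K a env in constr:(@LOpp K a')
  | (?c *: ?a)%R => let a' := lin_reify K a env in constr:(@LScale K c a')
  | (0)%R => constr:(@LZero K)
  | _ => let i := lin_index t env in constr:(@LAtom K i)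
  end.

(** Proves that two linear combinations of the same vectors are equal by
    comparing coefficients with [ring]; it plays for modules the part that
    [ring] plays for rings. *)
Ltac lin_solve K V :=
  match goal with |- @eq _ ?x ?y =>
    let env := lin_atoms x (@nil V) in let env := lin_atoms y env in
    let a := lin_reify K x env in let b := lin_reify K y env in
    refine (@lin_eval_eq K V env a b _);
    cbn [same_coefs lin_coef size eqn]; repeat split; try ring
  end.

(** * Zeros of bivariate polynomials *)

Section Purity.
Variable K : numClosedFieldType.

Lemma poly_nonroot (p : {poly K}) : p != 0 -> exists x, p.[x] != 0.
Proof.
by move/(elimT (closed_nonrootP p)) => -[x]; exists x.
Qed.

Lemma horner2_map (q : {poly {poly K}}) x y :
  q.[x, y] = (map_poly (horner_eval y) q).[x].
Proof.
rewrite -[LHS]/(horner_eval y q.[x%:P]) -horner_map; congr (_.[_]).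
exact: hornerC.
Qed.

Lemma horner_line (q : {poly {poly K}}) (l : {poly K}) s :
  q.[l].[s] = q.[l.[s], s].
Proof. by rewrite horner2_map -[LHS]/(horner_eval s q.[l]) -horner_map. Qed.

(** The zero set of a polynomial in two variables has no isolated points.
    Dividing [D] by the factors [x - l(y)] that it has, one reduces to the case
    where [D] vanishes on no graph; then each graph carries finitely many zeros,
    whereas over an algebraically closed field a nonconstant polynomial has
    zeros over almost every [y]. *)
Lemma zero_on_graph (D : {poly {poly K}}) (u : K) (ls : seq {poly K}) :
  (forall x y, y != u -> D.[x, y] = 0 -> exists2 l, l \in ls & x = l.[y]) ->
  forall x0 y0, y0 != u -> D.[x0, y0] = 0 ->
  exists l, [/\ l \in ls, x0 = l.[y0] & D.[l] = 0].
Proof.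
elim/ltn_ind: (size D) {-2}D (erefl (size D)) => n IH {}D sD hD x0 y0 hy0 h0.
have D0 : D != 0.
  apply/eqP => eD; have := hD _ y0 hy0.
  have /poly_nonroot[x hx] : \prod_(l <- ls) ('X - l.[y0]%:P) != 0.
    by rewrite prodf_seq_neq0; apply/allP => l _; rewrite polyXsubC_eq0.
  move=> /(_ x); rewrite eD !hornerE => /(_ erefl)[l hl el].
  by move/negP: hx; apply; rewrite horner_prod prodf_seq_eq0; apply/hasP; exists l;
     rewrite // !hornerE el subrr.
case: (pselect (exists2 l, l \in ls & D.[l] = 0)) => [[l hl Dl]|nl].
  case: (eqVneq x0 l.[y0]) => [e|ne]; first by exists l.
  have /factor_theorem[D' eD] : root D l by apply/eqP.
  have D'0 : D' != 0 by apply: contraNneq D0 => e; rewrite eD e mul0r.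
  have ev x y : D.[x, y] = D'.[x, y] * (x - l.[y]).
    by rewrite eD hornerM hornerM !hornerE.
  have sD' : (size D' < n)%N.
    by rewrite -sD eD size_Mmonic ?monicXsubC // size_XsubC addn2 /=.
  have [||l' [h1 h2 h3]] := IH _ sD' D' erefl _ x0 y0 hy0.
  - by move=> x y hy e; apply: (hD x y hy); rewrite ev e mul0r.
  - by move/eqP: h0; rewrite ev mulf_eq0 subr_eq0 (negPf ne) orbF => /eqP.
  by exists l'; rewrite eD hornerM h3 mul0r.
(* In the first case D does not involve x, so all of the line y = y0 consists of zeros. *)
case: (leqP (size D) 1) => sz.
  have eD := size1_polyC sz.
  have : exists x, \prod_(l <- ls) (x - l.[y0]) != 0.
    have /poly_nonroot[x hx] : \prod_(l <- ls) ('X - l.[y0]%:P) != 0.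
      by rewrite prodf_seq_neq0; apply/allP => l _; rewrite polyXsubC_eq0.
    by exists x; move: hx; rewrite horner_prod; under eq_bigr do rewrite !hornerE.
  case=> x; rewrite prodf_seq_neq0 => /allP hx.
  have [|l hl e] := hD x y0 hy0.
    by move: h0; rewrite eD !hornerC.
  by have := hx _ hl; rewrite e subrr eqxx.
(* A zero of P.[y] is to be avoided: elsewhere D has a zero over y, and it is on no graph. *)
pose P := \prod_(l <- ls) D.[l] * lead_coef D * ('X - u%:P).
have /poly_nonroot[y] : P != 0.
  rewrite !mulf_neq0 ?lead_coef_eq0 ?polyXsubC_eq0 // prodf_seq_neq0.
  by apply/allP => l hl; apply/eqP => e; apply: nl; exists l.
rewrite !hornerM !hornerE !mulf_eq0 !negb_or subr_eq0 => /andP[/andP[hp hlc] hyu].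
have : size (map_poly (horner_eval y) D) != 1%N.
  by rewrite size_map_poly_id0 // neq_ltn sz orbT.
move/(elimT (closed_rootP (map_poly (horner_eval y) D))) => [x hx].
have Dxy : D.[x, y] = 0.
  by move: hx; rewrite rootE -horner2_map => /eqP.
have [l hl e] := hD x y hyu Dxy.
move: hp; rewrite horner_prod prodf_seq_neq0 => /allP/(_ _ hl).
by rewrite /= horner_line -e Dxy eqxx.
Qed.
End Purity.

(** * Words in the lowering operators *)

(** The letters e, h, f; with [option bool] they inherit decidable equality. A
    letter [(a, n)] stands for a T^n. *)
Notation gen := (option bool).
Notation ge := (Some true).
Notation gf := (Some false).
Notation gh := None.
Notation letter := (option bool * int)%type.
Notation word := (seq (option bool * int)).

Section Letters.
Implicit Types (a b : gen) (x y : letter) (w : word).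

(** Half the eigenvalue of ad h. *)
Definition hweight a : int := match a with ge => 1 | gf => -1 | gh => 0 end.
Definition dual_gen a : gen := match a with ge => gf | gf => ge | gh => gh end.
Definition br_gen a b : gen :=
  match a, b with gh, b => b | a, gh => a | _, _ => gh end.
Definition br_coef a b : int :=
  match a, b with
  | gh, b => 2 * hweight b
  | a, gh => - 2 * hweight a
  | ge, gf => 1
  | gf, ge => -1
  | _, _ => 0
  end.
Definition trace_form a b : int :=
  match a, b with ge, gf | gf, ge => 1 | gh, gh => 2 | _, _ => 0 end.

(** The letters of the Lie algebra generated by f and e/T. Their transposes are
    the raising letters; besides these there is only h T^0. *)
Definition lowering x : bool := (x.2 < 0) || ((x.1 == gf) && (x.2 == 0)).
Definition transpose x : letter := (dual_gen x.1, - x.2).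
(** The degree that a letter adds, over the integers so that raising letters
    have one too. *)
Definition lweight x : int * int := (- x.2 - hweight x.1, - x.2).
Definition wweight w : int * int := \sum_(x <- w) lweight x.

Lemma transposeK x : transpose (transpose x) = x.
Proof. by case: x => [[[]|] n]; rewrite /transpose /= opprK. Qed.

Lemma wweight_cons x w : wweight (x :: w) = lweight x + wweight w.
Proof. by rewrite /wweight big_cons. Qed.

Lemma wweight_perm w w' : perm_eq w w' -> wweight w = wweight w'.
Proof. by move=> h; apply: perm_big. Qed.

Lemma lweight_transpose x : lweight (transpose x) = - lweight x.
Proof. case: x => [[[]|] n]; apply/eqP; rewrite xpair_eqE /=; lia. Qed.

Lemma letter_cases x : [\/ lowering x, lowering (transpose x) | x = (gh, 0)].
Proof.
case: x => a n; rewrite /lowering /transpose /=.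
have [h|h|h] := ltgtP n 0; first by constructor 1.
  by constructor 2; apply/orP; left; lia.
rewrite h; case: a => [[]|]; by [constructor 2|constructor 1|constructor 3].
Qed.

(** All results of deleting one occurrence of [x], with repetitions: a
    transposed letter meets its partners in a word one at a time. *)
Fixpoint deletions x w : seq word :=
  if w is y :: w' then
    (if y == x then [:: w'] else [::]) ++ map (cons y) (deletions x w')
  else [::].

Lemma deletions_perm x w u : u \in deletions x w -> perm_eq w (x :: u).
Proof.
elim: w u => //= y w IH u; rewrite mem_cat => /orP[].
  by case: eqP => // ->; rewrite inE => /eqP ->.
case/mapP => t /IH h ->.
rewrite (@perm_trans _ (y :: x :: t)) ?perm_cons //.
by rewrite -[y :: x :: t]/([:: y] ++ ([:: x] ++ t)) perm_catCA.
Qed.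

Lemma deletions_nil x w : (deletions x w != [::]) = (x \in w).
Proof.
elim: w => //= y w IH; rewrite inE [x == y]eq_sym; case: (y =P x) => //= _.
by rewrite -IH; case: (deletions x w).
Qed.

(** The number of perfect matchings of equal letters. It is the numerical
    factor of the leading form of the pairing of two words. *)
Fixpoint matchings (u w : word) : nat :=
  if u is x :: u' then \sum_(t <- deletions x w) matchings u' t else nilp w.

Lemma matchings_gt0 u w : (0 < matchings u w)%N = perm_eq u w.
Proof.
elim: u w => [|x u IH] w /=.
  by case: w => //= y w; apply/esym/negP => /perm_size.
apply/idP/idP => [|h].
  rewrite lt0n sum_nat_seq_neq0 => /hasP[t ht]; rewrite -lt0n IH => h.
  by rewrite perm_sym (perm_trans (deletions_perm ht)) // perm_cons perm_sym.
have xw : x \in w by rewrite -(perm_mem h) mem_head.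
have : deletions x w != [::] by rewrite deletions_nil.
case E : (deletions x w) => [|t s] // _; rewrite big_cons ltn_addr // IH.
have ht : t \in deletions x w by rewrite E mem_head.
by rewrite -(perm_cons x) (perm_trans h) // deletions_perm.
Qed.

Lemma br_lweight x y : br_coef x.1 y.1 != 0 ->
  lweight (br_gen x.1 y.1, x.2 + y.2) = lweight x + lweight y.
Proof.
by case: x y => [[[]|] n] [[[]|] m] //= _; apply/eqP; rewrite xpair_eqE /=; lia.
Qed.

Lemma br_lowering x y : lowering x -> lowering y -> br_coef x.1 y.1 != 0 ->
  lowering (br_gen x.1 y.1, x.2 + y.2).
Proof.
by case: x y => [[[]|] n] [[[]|] m]; rewrite /lowering //=; lia.
Qed.

Lemma lowering_central x y : lowering x -> lowering y ->
  x.2 + y.2 = 0 -> x.1 = gf /\ y.1 = gf.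
Proof.
by case: x y => [[[]|] n] [[[]|] m]; rewrite /lowering //=; lia.
Qed.

Lemma trace_form_dual x y : y != x -> - x.2 + y.2 = 0 -> trace_form (dual_gen x.1) y.1 = 0.
Proof.
case: x y => [a n] [b m] /= h e; have {}e : m = n by lia.
by move: h; rewrite e; case: a b => [[]|] [[]|]; rewrite ?eqxx.
Qed.

Lemma br_coef_dual x y : y != x -> (br_gen (dual_gen x.1) y.1, - x.2 + y.2) = (gh, 0) ->
  br_coef (dual_gen x.1) y.1 = 0.
Proof.
case: x y => [a n] [b m] /= h [+ e]; have {}e : m = n by lia.
by move: h; rewrite e; case: a b => [[]|] [[]|]; rewrite ?eqxx.
Qed.

End Letters.

(** * Straightening *)

(** The common structure of the Verma modules V(M, k - M), p = (M, k), on one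
    space: operators a T^n at level k, a highest weight vector, a contravariant
    form. It is stable under the diagram automorphism, unlike the notion of an
    affine module with its fixed roles of e and f. *)
Record verma_data (K : fieldType) (V : lmodType K) := VermaData {
  vop : K * K -> gen -> int -> V -> V;
  vac : V;
  vform : K * K -> V -> V -> K;
  vop_lin : forall p a n s x y,
    vop p a n (s *: x + y) = s *: vop p a n x + vop p a n y;
  vop_comm : forall p a b m n x,
    vop p a m (vop p b n x) = vop p b n (vop p a m x) +
      (br_coef a b)%:~R *: vop p (br_gen a b) (m + n) x +
      (if m + n == 0 then m%:~R * (trace_form a b)%:~R * p.2 else 0) *: x;
  vop_pos : forall p a n, lowering (transpose (a, n)) -> vop p a n vac = 0;
  vop_h0 : forall p, vop p gh 0 vac = p.1 *: vac;
  vop_indep : forall p q a n x, lowering (a, n) -> vop p a n x = vop q a n x;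
  vop_gen : forall P : V -> Prop,
    (forall s x y, P x -> P y -> P (s *: x + y)) ->
    (forall a n x, P x -> P (vop 0 a n x)) ->
    P vac -> forall x, P x;
  vform_sym : forall p x y, vform p x y = vform p y x;
  vform_lin : forall p s x y z,
    vform p (s *: x + y) z = s * vform p x z + vform p y z;
  vform_vac : forall p, vform p vac vac = 1;
  vform_adj : forall p a n x y, lowering (a, n) ->
    vform p (vop p a n x) y = vform p x (vop p (dual_gen a) (- n) y) }.

Section Straightening.
Variables (K : numClosedFieldType) (V : lmodType K) (D : verma_data V).
Implicit Types (p : K * K) (x y : letter) (w ys : word) (u : V).

Definition op p x u := vop D p x.1 x.2 u.
Definition wvec w : V := foldr (op 0) (vac D) w.

Lemma op_linear p x s u v : op p x (s *: u + v) = s *: op p x u + op p x v.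
Proof. exact: vop_lin. Qed.
Lemma op0 p x : op p x 0 = 0.
Proof. by have := op_linear p x (-1) 0 0; rewrite scaler0 addr0 scaleN1r addNr. Qed.
Lemma opD p x u v : op p x (u + v) = op p x u + op p x v.
Proof. by have := op_linear p x 1 u v; rewrite !scale1r. Qed.
Lemma opZ p x s u : op p x (s *: u) = s *: op p x u.
Proof. by have := op_linear p x s u 0; rewrite op0 !addr0. Qed.
Lemma opN p x u : op p x (- u) = - op p x u.
Proof. by rewrite -scaleN1r opZ scaleN1r. Qed.
Lemma op_sum p x I (r : seq I) (F : I -> V) :
  op p x (\sum_(i <- r) F i) = \sum_(i <- r) op p x (F i).
Proof. exact: (big_morph _ (opD p x) (op0 p x)). Qed.
Lemma op_indep p x u : lowering x -> op p x u = op 0 x u.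
Proof. by case: x => a n; apply: vop_indep. Qed.

Arguments op_indep : clear implicits.

Lemma op_comm p x y u : op p x (op p y u) =
  op p y (op p x u) + (br_coef x.1 y.1)%:~R *: op p (br_gen x.1 y.1, x.2 + y.2) u +
  (if x.2 + y.2 == 0 then (x.2)%:~R * (trace_form x.1 y.1)%:~R * p.2 else 0) *: u.
Proof. exact: vop_comm. Qed.

(** One transposed letter produces coefficients of degree at most one in (M, k).
    They are kept as triples, so that the degree can be read off. *)
Definition aval (c : K * K * K) p : K := c.1.1 + c.1.2 * p.1 + c.2 * p.2.

(** Families of vectors that are combinations of words with affine
    coefficients, the predicate restricting which coefficient may stand at which
    word. *)
Inductive affine_span (P : K * K * K -> word -> Prop) : (K * K -> V) -> Prop :=
  | AffineSpan0 G of (forall p, G p = 0) : affine_span P G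
  | AffineSpanD G G' c w of P c w & affine_span P G &
      (forall p, G' p = aval c p *: wvec w + G p) : affine_span P G'.

Lemma affine_span_ext P G G' : affine_span P G -> (forall p, G' p = G p) -> affine_span P G'.
Proof.
case=> [{}G h e|{}G H c w Pw sG h e]; first by apply: AffineSpan0 => p; rewrite e.
by apply: (@AffineSpanD P _ _ _ _ Pw sG) => p; rewrite e.
Qed.

Lemma affine_span_add P G G' : affine_span P G -> affine_span P G' -> affine_span P (fun p => G p + G' p).
Proof.
move=> h h'; elim: h => {G} [G h|G H c w Pw _ IH h].
  by apply: (@affine_span_ext _ _ _ h') => p; rewrite h add0r.
by apply: (@AffineSpanD P _ _ _ _ Pw IH) => p; rewrite h addrA.
Qed.

Lemma affine_span_scale P (s : K) G :
  (forall c w, P c w -> P (s * c.1.1, s * c.1.2, s * c.2) w) ->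
  affine_span P G -> affine_span P (fun p => s *: G p).
Proof.
move=> hP; elim=> {G} [G h|G H c w Pw _ IH h].
  by apply: AffineSpan0 => p; rewrite h scaler0.
apply: (@AffineSpanD P _ _ _ _ (hP _ _ Pw) IH) => p; rewrite h scalerDr scalerA.
by congr (_ *: _ + _); rewrite /aval /= !mulrDr !mulrA.
Qed.

Lemma affine_span_op P P' y G : lowering y -> (forall c w, P c w -> P' c (y :: w)) ->
  affine_span P G -> affine_span P' (fun p => op 0 y (G p)).
Proof.
move=> ny hP; elim=> {G} [G h|G H c w Pw _ IH h].
  by apply: AffineSpan0 => p; rewrite h op0.
by apply: (@AffineSpanD P' _ _ _ _ (hP _ _ Pw) IH) => p; rewrite h op_linear.
Qed.

Lemma affine_span_sub (P P' : K * K * K -> word -> Prop) G :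
  (forall c w, P c w -> P' c w) -> affine_span P G -> affine_span P' G.
Proof.
move=> hP; elim=> {G} [G h|G H c w Pw _ IH h]; first exact: AffineSpan0.
exact: (@AffineSpanD P' _ _ _ _ (hP _ _ Pw) IH).
Qed.

Lemma affine_span1 (P : K * K * K -> word -> Prop) c w G :
  P c w -> (forall p, G p = aval c p *: wvec w) -> affine_span P G.
Proof.
move=> Pw h; apply: (@AffineSpanD P (fun=> 0) _ c w Pw); first exact: AffineSpan0.
by move=> p; rewrite addr0.
Qed.

Lemma affine_span_sum P (s : seq word) c G :
  (forall w, w \in s -> P c w) ->
  (forall p, G p = \sum_(w <- s) aval c p *: wvec w) -> affine_span P G.
Proof.
elim: s G => [|w s IH] G hP h; first by apply: AffineSpan0 => p; rewrite h big_nil.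
apply: (@AffineSpanD P (fun p => \sum_(w <- s) aval c p *: wvec w) _ c w).
- by apply: hP; rewrite mem_head.
- by apply: IH => // t ht; apply: hP; rewrite inE ht orbT.
- by move=> p; rewrite h big_cons.
Qed.

(** The linear form M + i k, 2 j k or l k - M that arises when f/T^i, h/T^j or
    e/T^l meets its transpose. *)
Definition pair_coef x : K * K * K :=
  (0, (- hweight x.1)%:~R, (- x.2 * trace_form (dual_gen x.1) x.1)%:~R).

(** Terms that cannot contribute to the leading form of a pairing: a constant
    coefficient, or a loss of at least two letters. *)
Definition lower_terms (N : nat) (g : int * int) (c : K * K * K) w : Prop :=
  [/\ all lowering w, wweight w = g & c.1.2 = 0 /\ c.2 = 0 \/ (size w + 2 <= N)%N].

Lemma h0_wvec p w : all lowering w -> op p (gh, 0) (wvec w) =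
  (p.1 - (2 * ((wweight w).1 - (wweight w).2))%:~R) *: wvec w.
Proof.
elim: w => [|y w IH] /=.
  by rewrite /wweight big_nil mulr0 subr0 => _; apply: vop_h0.
move=> /andP[ny nw]; rewrite -!(op_indep p y) // op_comm /= IH // opZ add0r.
have -> : (y.1, y.2) = y by case: (y).
rewrite mul0r mul0r if_same scale0r addr0 -scalerDl; congr (_ *: _).
have -> : 2 * ((wweight (y :: w)).1 - (wweight (y :: w)).2) =
    2 * ((wweight w).1 - (wweight w).2) - 2 * hweight y.1.
  by rewrite wweight_cons /lweight /=; lia.
by rewrite rmorphB /=; ring.
Qed.

(** Moving a raising letter to the right, a commutator is a scalar (at an equal
    letter), a lowering letter (constant coefficient, no letter gained), or
    again a raising letter, which has used up one letter and will use up another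
    one before it produces a scalar. *)
Lemma straighten w : all lowering w -> forall x, lowering x ->
  affine_span (lower_terms (size w) (wweight w - lweight x))
    (fun p => op p (transpose x) (wvec w) - \sum_(u <- deletions x w) aval (pair_coef x) p *: wvec u).
Proof.
elim: w => [|y w IH] /=.
  move=> _ x nx; apply: AffineSpan0 => p; rewrite big_nil subr0.
  by apply: vop_pos; rewrite -[(dual_gen _, _)]/(transpose x) transposeK.
move=> /andP[ny nw] x nx.
pose z := (br_gen (dual_gen x.1) y.1, - x.2 + y.2).
have dz : br_coef (dual_gen x.1) y.1 != 0 -> lweight z + wweight w = wweight (y :: w) - lweight x.
  move=> h; have := @br_lweight (transpose x) y h; rewrite -[(_, _)]/z => ->.
  by rewrite lweight_transpose wweight_cons [RHS]addrC addrA.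
apply: (@affine_span_ext _ (fun p =>
  op 0 y (op p (transpose x) (wvec w) - \sum_(u <- deletions x w) aval (pair_coef x) p *: wvec u) +
  ((br_coef (dual_gen x.1) y.1)%:~R *: op p z (wvec w) +
   (if - x.2 + y.2 == 0 then (- x.2)%:~R * (trace_form (dual_gen x.1) y.1)%:~R * p.2
    else 0) *: wvec w - (if y == x then aval (pair_coef x) p *: wvec w else 0)))); last first.
  move=> p; rewrite -!(op_indep p y) // op_comm /= big_cat big_map /=.
  have -> : \sum_(i <- (if y == x then [:: w] else [::])) aval (pair_coef x) p *: wvec i =
      if y == x then aval (pair_coef x) p *: wvec w else 0.
    by case: ifP; rewrite ?big_seq1 ?big_nil.
  under eq_bigr => u _ do rewrite -(op_indep p y) // -opZ.
  rewrite -op_sum.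
  set s := \sum_(u <- deletions x w) aval (pair_coef x) p *: wvec u.
  rewrite opD opN -/z.
  set k := (if _ == 0 then _ else _); set d := (if y == x then _ else _).
  lin_solve K V.
refine (affine_span_add _ _).
  apply: (@affine_span_op _ _ y _ ny _ (IH nw x nx)) => c u [nu du hu]; split => /=.
  - by rewrite ny.
  - by rewrite !wweight_cons du addrA.
  - by case: hu => hu; [left|right; rewrite ltnS].
have [eyx|nyx] := eqVneq y x.
  set c : K := - (2 * ((wweight w).1 - (wweight w).2))%:~R.
  apply: (@affine_span1 _ ((br_coef (dual_gen x.1) x.1)%:~R * c, 0, 0) w).
    split => //; last by left.
    by rewrite eyx wweight_cons addrAC subrr add0r.
  move=> p; rewrite eyx addNr eqxx.
  have -> : z = (gh, 0) by rewrite /z eyx addNr; case: (x.1) => [[]|].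
  rewrite h0_wvec // -/c.
  rewrite !scalerA -!scalerDl -scalerBl; congr (_ *: _); rewrite /aval /pair_coef /=.
  by case: (x.1) => [[]|] /=; ring.
have c0 := trace_form_dual nyx; have b0 := br_coef_dual nyx; rewrite -/z in b0.
apply: (@affine_span_ext _ (fun p => (br_coef (dual_gen x.1) y.1)%:~R *: op p z (wvec w))); last first.
  move=> p; rewrite subr0; case: eqP => [/c0 ->|_]; last by rewrite scale0r addr0.
  by rewrite mulr0 mul0r scale0r addr0.
have [e|nb] := eqVneq (br_coef (dual_gen x.1) y.1) 0.
  by apply: AffineSpan0 => p; rewrite e scale0r.
case: (letter_cases z) => [nz|nz|/b0 e]; last by rewrite e eqxx in nb.
  apply: (@affine_span1 _ ((br_coef (dual_gen x.1) y.1)%:~R, 0, 0) (z :: w)).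
    by split; [rewrite /= nz | rewrite -dz ?wweight_cons | left].
  by move=> p; rewrite /= op_indep // /aval /= !mul0r !addr0.
apply: affine_span_scale.
  move=> c u [nu du hu]; split=> //=.
  by case: hu => [[-> ->]|hu]; [left; rewrite mulr0|right].
have dz' : wweight w - lweight (transpose z) = wweight (y :: w) - lweight x.
  by rewrite lweight_transpose opprK addrC dz.
apply: (@affine_span_ext _ (fun p => (op p (transpose (transpose z)) (wvec w) -
   \sum_(u <- deletions (transpose z) w) aval (pair_coef (transpose z)) p *: wvec u) +
   \sum_(u <- deletions (transpose z) w) aval (pair_coef (transpose z)) p *: wvec u)); last first.
  by move=> p; rewrite subrK transposeK.
refine (affine_span_add _ _).
  apply: (affine_span_sub _ (IH nw (transpose z) nz)) => c u [nu du hu].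
  split=> //; first by rewrite du dz'.
  by case: hu => hu; [left|right; rewrite leqW].
apply: (@affine_span_sum _ (deletions (transpose z) w) (pair_coef (transpose z))) => // u /deletions_perm h; split.
- by move: nw; rewrite (perm_all _ h) => /andP[].
- by rewrite -dz' (wweight_perm h) wweight_cons addrAC subrr add0r.
- by right; rewrite (perm_size h) addn2.
Qed.
End Straightening.

(** * Leading coefficients of determinants *)

Section DeterminantDegree.
Variable K : idomainType.

Lemma coef_prod_top (I : Type) (r : seq I) (F : I -> {poly K}) (a : I -> nat) :
  (forall i, size (F i) <= (a i).+1)%N ->
  (\prod_(i <- r) F i)`_(\sum_(i <- r) a i)%N = \prod_(i <- r) (F i)`_(a i).
Proof.
move=> hF; suff [] : (size (\prod_(i <- r) F i)%R <= (\sum_(i <- r) a i).+1)%N /\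
  (\prod_(i <- r) F i)`_(\sum_(i <- r) a i)%N = \prod_(i <- r) (F i)`_(a i) by [].
elim: r => [|i r [IHs IHc]].
  by rewrite !big_nil size_poly1 coefC.
rewrite !big_cons; split.
  apply: leq_trans (size_polyMleq _ _) _.
  by rewrite -ltnS -addSn; have := hF i; lia.
rewrite coefM (bigD1 (Ordinal (leq_addr (\sum_(i <- r) a i) (a i) : a i < (a i + \sum_(i <- r) a i).+1)%N)) //=.
rewrite addKn IHc [X in _ + X]big1 ?addr0 // => -[j hj]; rewrite -val_eqE /= => nj.
case: (ltngtP j (a i)) nj => // h _.
  rewrite [X in _ * X]nth_default ?mulr0 //.
  by apply: leq_trans IHs _; lia.
by rewrite nth_default ?mul0r // (leq_trans (hF i)).
Qed.

(** Row and column i carry the same weight [a i], so every term of the Leibniz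
    formula has the same degree bound. *)
Lemma det_top m (M : 'M[{poly K}]_m) (a : 'I_m -> nat) :
  (forall i j, size (M i j) <= (a i + a j).+1)%N ->
  (\det M)`_(\sum_i a i + \sum_i a i)%N = \det (\matrix_(i, j) (M i j)`_(a i + a j)%N).
Proof.
move=> h; rewrite /determinant coef_sum; apply: eq_bigr => s _.
have es : (\sum_i a i + \sum_i a i = \sum_i (a i + a (s i)))%N.
  by rewrite big_split /= [X in (_ + X)%N](reindex_inj (@perm_inj _ s)).
have -> : (-1) ^+ s = ((-1) ^+ s)%:P :> {poly K} by rewrite rmorphXn rmorphN1.
rewrite coefCM es coef_prod_top //; congr (_ * _).
by apply: eq_bigr => i _; rewrite mxE.
Qed.
End DeterminantDegree.

(** * Gram matrices as polynomials in the weight *)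

Section GramPolynomials.
Variables (K : numClosedFieldType) (V : lmodType K) (D : verma_data V).
Implicit Types (p : K * K) (x y : letter) (w xs ys : word) (u : V) (l : {poly K}).
Notation op := (op D).
Notation wvec := (wvec D).
Definition form p u v := vform D p u v.

Inductive in_span (P : word -> Prop) : V -> Prop :=
  | in_span0 : in_span P 0
  | in_spanD c w u of P w & in_span P u : in_span P (c *: wvec w + u).

Lemma in_span_add P u v : in_span P u -> in_span P v -> in_span P (u + v).
Proof.
by move=> hu hv; elim: hu => [|c w t Pw _ IH]; rewrite ?add0r // -addrA; exact: in_spanD.
Qed.
Lemma in_span_scale P s u : in_span P u -> in_span P (s *: u).
Proof.
elim=> [|c w t Pw _ IH]; first by rewrite scaler0; exact: in_span0.
by rewrite scalerDr scalerA; exact: in_spanD.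
Qed.
Lemma in_span_sub (P P' : word -> Prop) u : (forall w, P w -> P' w) -> in_span P u -> in_span P' u.
Proof. by move=> h; elim=> [|c w t /h Pw _ IH]; [exact: in_span0|exact: in_spanD]. Qed.
Lemma in_span_wvec (P : word -> Prop) w : P w -> in_span P (wvec w).
Proof. by move=> h; rewrite -[wvec w]addr0 -[wvec w]scale1r; apply: in_spanD => //; exact: in_span0. Qed.
Lemma in_span_rect (P : word -> Prop) (Q : V -> Prop) : Q 0 ->
  (forall s u v, Q u -> Q v -> Q (s *: u + v)) -> (forall w, P w -> Q (wvec w)) ->
  forall u, in_span P u -> Q u.
Proof. by move=> q0 qa qw u; elim=> // c w t /qw h _ IH; exact: qa. Qed.
Lemma in_span_lin (P : word -> Prop) s u v : in_span P u -> in_span P v -> in_span P (s *: u + v).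
Proof. by move=> hu hv; apply: in_span_add => //; exact: in_span_scale. Qed.
Lemma in_span_op (P P' : word -> Prop) p y u : lowering y -> (forall w, P w -> P' (y :: w)) ->
  in_span P u -> in_span P' (op p y u).
Proof.
move=> ny h; elim=> [|c w t Pw _ IH]; first by rewrite op0; exact: in_span0.
by rewrite op_linear op_indep //; apply: (in_spanD _ (h _ Pw)).
Qed.
Lemma affine_span_in_span (P : K * K * K -> word -> Prop) (P' : word -> Prop) G p :
  (forall c w, P c w -> P' w) -> affine_span D P G -> in_span P' (G p).
Proof.
move=> h; elim=> {G} [G ->|G H c w /h Pw _ IH ->]; first exact: in_span0.
exact: in_spanD.
Qed.

Definition wspace (g : int * int) : V -> Prop := in_span (fun w => all lowering w /\ wweight w = g).

Lemma wspace_wvec w : all lowering w -> wspace (wweight w) (wvec w).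
Proof. by move=> h; apply: in_span_wvec. Qed.

Lemma wspace_vac : wspace 0 (vac D).
Proof. by have := @wspace_wvec [::] isT; rewrite /wweight big_nil. Qed.

Lemma op_wspace p x g u : wspace g u -> wspace (g + lweight x) (op p x u).
Proof.
move=> h; elim/in_span_rect: h => [|s t v|w [nw <-]].
- by rewrite op0; exact: in_span0.
- by rewrite op_linear; exact: in_span_lin.
case: (letter_cases x) => [nx|nx|->].
- rewrite op_indep //; have := @wspace_wvec (x :: w).
  by rewrite wweight_cons addrC /= nx nw => /(_ isT).
- rewrite -[x]transposeK -[op _ _ _](subrK (\sum_(u <- deletions (transpose x) w) aval (pair_coef K (transpose x)) p *: wvec u)).
  apply: in_span_add.
    apply: (affine_span_in_span (P := lower_terms (size w) (wweight w - lweight (transpose x))) (G := fun p =>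
     op p (transpose (transpose x)) (wvec w) - \sum_(u <- deletions (transpose x) w) aval (pair_coef K (transpose x)) p *: wvec u)).
      by move=> c t [nt dt _]; rewrite transposeK dt lweight_transpose opprK.
    exact: straighten.
  have : forall t, t \in deletions (transpose x) w -> all lowering t /\ wweight t = wweight w + lweight x.
    move=> t /deletions_perm h; split.
      by move: nw; rewrite (perm_all _ h) => /andP[].
    by rewrite (wweight_perm h) wweight_cons lweight_transpose addrAC addNr add0r.
  rewrite transposeK; elim: (deletions _ _) => [|t s IH] hs; first by rewrite big_nil; exact: in_span0.
  rewrite big_cons; apply: in_spanD; first by apply: hs; rewrite mem_head.
  by apply: IH => r hr; apply: hs; rewrite inE hr orbT.
rewrite h0_wvec // -[lweight _]/(0, 0) addr0.
by apply: in_span_scale; exact: wspace_wvec.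
Qed.

Lemma in_span_all u : in_span (all lowering) u.
Proof.
apply: (vop_gen (v := D)) => [s x y||]; first exact: in_span_lin.
  move=> a n x h; elim/in_span_rect: h => [|s t v ht hv|w nw].
  - by rewrite -/(op 0 (a, n) 0) op0; exact: in_span0.
  - by rewrite vop_lin; exact: in_span_lin.
  have := @op_wspace 0 (a, n) _ _ (wspace_wvec nw).
  by apply: in_span_sub => t [].
exact: (@in_span_wvec _ [::]).
Qed.

Lemma form_sym p u v : form p u v = form p v u. Proof. exact: vform_sym. Qed.
Lemma form_linear p s u v t : form p (s *: u + v) t = s * form p u t + form p v t.
Proof. exact: vform_lin. Qed.
Lemma form0l p t : form p 0 t = 0.
Proof. by have := form_linear p (-1) 0 0 t; rewrite scaler0 addr0 mulN1r addNr. Qed.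
Lemma formDl p u v t : form p (u + v) t = form p u t + form p v t.
Proof. by have := form_linear p 1 u v t; rewrite scale1r mul1r. Qed.
Lemma formZl p s u t : form p (s *: u) t = s * form p u t.
Proof. by have := form_linear p s u 0 t; rewrite form0l !addr0. Qed.
Lemma form_linear_r p s u v t : form p t (s *: u + v) = s * form p t u + form p t v.
Proof. by rewrite !(form_sym p t) form_linear. Qed.
Lemma form_adj p x u v : lowering x -> form p (op p x u) v = form p u (op p (transpose x) v).
Proof. by case: x => a n nx; apply: vform_adj. Qed.
Lemma form_adjV p x u v : lowering (transpose x) -> form p (op p x u) v = form p u (op p (transpose x) v).
Proof. by move=> nx; rewrite form_sym -{1}[x]transposeK -form_adj // form_sym. Qed.

Lemma form_wvec_cons p x xs u : lowering x ->
  form p (wvec (x :: xs)) u = form p (wvec xs) (op p (transpose x) u).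
Proof. by move=> nx /=; rewrite -(op_indep D p) // form_adj. Qed.

Lemma form_vac p : form p (vac D) (vac D) = 1. Proof. exact: vform_vac. Qed.

Lemma form_vac_wvec p w : all lowering w -> form p (vac D) (wvec w) = (nilp w)%:R.
Proof.
case: w => [|y w] /=; first by rewrite /form vform_vac.
case/andP=> ny nw; rewrite form_sym (form_wvec_cons p w _ ny) form_sym.
by rewrite /op vop_pos ?form0l // -[(_, _)]surjective_pairing transposeK.
Qed.

(** Components of different degrees are orthogonal because a transposed letter
    lowers the degree by the degree of the letter. *)
Lemma form_orth p g g' u u' : wspace g u -> wspace g' u' -> g != g' -> form p u u' = 0.
Proof.
move=> hu hu' gg'; elim/in_span_rect: hu => [|s t v ht hv|w [nw dw]].
- exact: form0l.
- by rewrite form_linear ht hv mulr0 addr0.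
elim: w g g' u' gg' hu' nw dw => [|x w IH] g g' u' gg' hu'.
  move=> _ eg; elim/in_span_rect: hu' => [|s t v ht hv|w [nw dw]].
  - by rewrite form_sym form0l.
  - by rewrite form_linear_r ht hv mulr0 addr0.
  rewrite form_vac_wvec //; case: w nw dw => //= nw dw.
  by rewrite -eg -dw eqxx in gg'.
move=> /= /andP[nx nw] dw; rewrite form_wvec_cons //.
apply: (IH _ (g' + lweight (transpose x)) _ _ _ nw erefl); last exact: op_wspace.
apply: contraNneq gg' => e; rewrite -dw wweight_cons e lweight_transpose addrC subrK //.
Qed.

(** [g] is polynomial on the plane; its degree and leading form are seen through
    the restrictions to the lines M = l(k), where they become the degree and the
    coefficient [t l]. *)
Definition line_poly (m : nat) (g : K * K -> K) (t : {poly K} -> K) : Prop :=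
  exists q : {poly {poly K}}, (forall p, q.[p.1, p.2] = g p) /\
    forall l, (size l <= 2)%N -> (size q.[l] <= m.+1)%N /\ (q.[l])`_m = t l.

(** Coefficient of the running variable of an affine function on the line
    M = l(k). *)
Definition slope (c : K * K * K) l : K := c.1.2 * l`_1 + c.2.

Lemma line_poly_ext m g g' t : line_poly m g t -> (forall p, g p = g' p) -> line_poly m g' t.
Proof. by case=> q [hq ht] e; exists q; split=> // p; rewrite hq. Qed.

Lemma line_poly_add m g g' t t' : line_poly m g t -> line_poly m g' t' ->
  line_poly m (fun p => g p + g' p) (fun l => t l + t' l).
Proof.
move=> [q [hq hl]] [q' [hq' hl']]; exists (q + q'); split => [p|l sl].
  by rewrite !hornerE hq hq'.
have [s1 <-] := hl l sl; have [s2 <-] := hl' l sl.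
by rewrite hornerD coefD (leq_trans (size_polyD _ _)) // geq_max s1.
Qed.

Lemma line_poly_const m g t (c : K) : line_poly m g t ->
  line_poly m (fun p => c * g p) (fun l => c * t l).
Proof.
move=> [q [hq hl]]; exists (c%:P%:P * q); split => [p|l sl].
  by rewrite !hornerE hq.
have [s1 <-] := hl l sl; rewrite hornerM hornerC coefCM; split => //.
by apply: leq_trans s1; rewrite mul_polyC size_scale_leq.
Qed.

Lemma line_poly_lift m n g t : line_poly m g t -> (m < n)%N -> line_poly n g (fun=> 0).
Proof.
move=> [q [hq hl]] mn; exists q; split => // l sl; have [s1 _] := hl l sl.
split; first by rewrite (leq_trans s1) // ltnS ltnW.
by rewrite nth_default // (leq_trans s1).
Qed.

Lemma line_poly_zero m : line_poly m (fun=> 0) (fun=> 0).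
Proof.
exists 0; split => [p|l _]; first by rewrite !horner0.
by rewrite horner0 size_poly0 coef0.
Qed.

Lemma line_poly_cf m g t c : line_poly m g t ->
  line_poly m.+1 (fun p => aval c p * g p) (fun l => slope c l * t l).
Proof.
move=> [q [hq hl]].
exists ((c.1.1%:P%:P + c.1.2%:P%:P * 'X + (c.2%:P * 'X)%:P) * q); split => [p|l sl].
  by rewrite !hornerE hq /aval.
have [s1 <-] := hl l sl; rewrite hornerM !hornerE.
set a := c.1.1%:P + _ + _.
have sa : (size a <= 2)%N.
  apply/leq_sizeP => -[|[|j]] // _; rewrite /a !coefD !coefCM coefC coefX /=.
  by rewrite nth_default ?mulr0 ?addr0 // (leq_trans sl).
split.
  apply: leq_trans (size_polyMleq _ _) _.
  by rewrite -subn1 leq_subLR; exact: leq_add sa s1.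
rewrite coefM (bigD1 (Ordinal (isT : (1 < m.+2)%N))) //= subn1 /= big1 ?addr0.
  by congr (_ * _); rewrite /a !coefD !coefCM coefC coefX /= add0r mulr1.
move=> [[|[|j]] hj] //= _; first by rewrite subn0 [X in _ * X]nth_default ?mulr0.
by rewrite nth_default ?mul0r // (leq_trans sa).
Qed.

Lemma line_poly_ext2 m g g' t t' : line_poly m g t -> (forall p, g p = g' p) ->
  (forall l, t l = t' l) -> line_poly m g' t'.
Proof.
by move=> [q [hq hl]] e e'; exists q; split=> [p|l]; rewrite -?e -?e'; last exact: hl.
Qed.

Lemma line_poly_sum (s : seq word) m (g : word -> K * K -> K) (t : word -> {poly K} -> K) :
  (forall w, w \in s -> line_poly m (g w) (t w)) ->
  line_poly m (fun p => \sum_(w <- s) g w p) (fun l => \sum_(w <- s) t w l).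
Proof.
elim: s => [|w s IH] h.
  by apply: (line_poly_ext2 (line_poly_zero m)) => ?; rewrite big_nil.
have hw : line_poly m (g w) (t w) by apply: h; rewrite mem_head.
have hs : line_poly m (fun p => \sum_(w <- s) g w p) (fun l => \sum_(w <- s) t w l).
  by apply: IH => r hr; apply: h; rewrite inE hr orbT.
by apply: (line_poly_ext2 (line_poly_add hw hs)) => ?; rewrite big_cons.
Qed.

Lemma line_poly_affine_span m P G u : affine_span D P G ->
  (forall c w, P c w -> line_poly m (fun p => aval c p * form p u (wvec w)) (fun=> 0)) ->
  line_poly m (fun p => form p u (G p)) (fun=> 0).
Proof.
move=> h hP; elim: h => {G} [G hG|G H c w Pw _ IH hG].
  by apply: (line_poly_ext (line_poly_zero m)) => p; rewrite hG form_sym form0l.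
apply: (line_poly_ext2 (line_poly_add (hP _ _ Pw) IH)) => [p|l]; last exact: addr0.
by rewrite hG form_linear_r.
Qed.

Lemma form_cons_split p x xs ys : lowering x ->
  form p (wvec (x :: xs)) (wvec ys) =
  \sum_(w <- deletions x ys) aval (pair_coef K x) p * form p (wvec xs) (wvec w) +
  form p (wvec xs) (op p (transpose x) (wvec ys) - \sum_(w <- deletions x ys) aval (pair_coef K x) p *: wvec w).
Proof.
move=> nx; rewrite form_wvec_cons // -[in LHS](subrK (\sum_(w <- deletions x ys) aval (pair_coef K x) p *: wvec w) (op _ _ _)).
rewrite [LHS]form_sym formDl [LHS]addrC; congr (_ + _); last by rewrite form_sym.
elim: (deletions x ys) => [|w s IH]; first by rewrite !big_nil form0l.
by rewrite !big_cons form_linear IH form_sym.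
Qed.

(** Each letter of [xs] contributes at most one factor of degree one. *)
Lemma gram_bound xs ys : all lowering xs -> all lowering ys ->
  line_poly (size xs).+1 (fun p => form p (wvec xs) (wvec ys)) (fun=> 0).
Proof.
elim: xs ys => [|x xs IH] ys /=.
  move=> _ ny; exists ((nilp ys)%:R%:P%:P); split => [p|l _].
    by rewrite !hornerC form_vac_wvec.
  by rewrite !hornerC coefC /=; split=> //; exact: leq_trans (size_polyC_leq1 _) _.
move=> /andP[nx nxs] nys.
apply: (line_poly_ext2 (line_poly_add
   (line_poly_sum (s := deletions x ys) (t := fun=> fun=> 0) _)
   (line_poly_affine_span (u := wvec xs) (straighten D nys nx) _))).
- move=> w /deletions_perm h.
  have nw : all lowering w by move: nys; rewrite (perm_all _ h) => /andP[].
  apply: (line_poly_ext2 (line_poly_cf (pair_coef K x) (IH w nxs nw))) => // l.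
  by rewrite mulr0.
- move=> c w [nw _ _]; apply: (line_poly_ext2 (line_poly_cf c (IH w nxs nw))) => // l.
  by rewrite mulr0.
- by move=> p; rewrite form_cons_split.
- by move=> l; rewrite big1 ?addr0.
Qed.

(** To reach degree [size xs] every letter must meet an equal letter, so the
    leading form counts matchings. *)
Lemma gram_top xs ys : all lowering xs -> all lowering ys -> size xs = size ys ->
  line_poly (size xs) (fun p => form p (wvec xs) (wvec ys))
    (fun l => (matchings xs ys)%:R * \prod_(x <- xs) slope (pair_coef K x) l).
Proof.
elim: xs ys => [|x xs IH] ys /=.
  move=> _ ny _; exists ((nilp ys)%:R%:P%:P); split => [p|l _].
    by rewrite !hornerC form_vac_wvec.
  by rewrite !hornerC coefC /= big_nil mulr1; split=> //; exact: size_polyC_leq1.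
move=> /andP[nx nxs] nys sz.
have hw w : w \in deletions x ys -> all lowering w /\ size xs = size w.
  move=> /deletions_perm h; split; first by move: nys; rewrite (perm_all _ h) => /andP[].
  by have := perm_size h; rewrite -sz => -[].
apply: (line_poly_ext2 (line_poly_add
   (line_poly_sum (s := deletions x ys) (fun w hw' =>
      line_poly_cf (pair_coef K x) (IH w nxs (hw w hw').1 (hw w hw').2)))
   (line_poly_affine_span (u := wvec xs) (straighten D nys nx) _))).
- move=> c w [nw _ [[c1 c2]|]].
    apply: (line_poly_ext2 (line_poly_const c.1.1 (gram_bound nxs nw))) => [p|l].
      by rewrite /aval c1 c2 !mul0r !addr0.
    exact: mulr0.
  rewrite -sz addn2 !ltnS => hw'.
  have h := line_poly_cf c (gram_bound nw nxs).
  have {}h : line_poly (size w).+2 (fun p => aval c p * form p (wvec xs) (wvec w)) (fun=> 0).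
    by apply: (line_poly_ext2 h) => [p|l]; rewrite ?mulr0 // form_sym.
  move: hw'; rewrite leq_eqVlt => /orP[/eqP <-//|hw'].
  by apply: (line_poly_lift h); rewrite ltnS.
- by move=> p; rewrite form_cons_split.
- move=> l; rewrite addr0 big_cons natr_sum !mulr_suml; apply: eq_bigr => w _.
  by rewrite mulrCA.
Qed.

Lemma gram_ex xs ys : exists q : {poly {poly K}}, all lowering xs -> all lowering ys ->
  (forall p, q.[p.1, p.2] = form p (wvec xs) (wvec ys)) /\
  forall l, (size l <= 2)%N -> (size q.[l] <= (minn (size xs) (size ys)).+1)%N /\
    (size xs = size ys -> (q.[l])`_(size xs) =
       (matchings xs ys)%:R * \prod_(x <- xs) slope (pair_coef K x) l).
Proof.
have [nxs|] := boolP (all lowering xs); last by exists 0.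
have [nys|] := boolP (all lowering ys); last by exists 0.
have hb us vs : all lowering us -> all lowering vs -> exists q : {poly {poly K}},
    (forall p, q.[p.1, p.2] = form p (wvec us) (wvec vs)) /\
    forall l, (size l <= 2)%N -> (size q.[l] <= (size us).+1)%N.
  move=> nu nv; have [q [hq hl]] := gram_bound nu nv; exists q; split=> // l sl.
  have [s1 s2] := hl l sl; apply/leq_sizeP => j; rewrite leq_eqVlt.
  case/orP => [/eqP <- //|hj]; by rewrite nth_default // (leq_trans s1).
have [e|e|e] := ltngtP (size xs) (size ys).
- have [q [hq hl]] := hb _ _ nxs nys; exists q => _ _; split => // l sl.
  by rewrite hl //; split => // e'; rewrite e' ltnn in e.
- have [q [hq hl]] := hb _ _ nys nxs; exists q => _ _; split => [p|l sl].
    by rewrite hq form_sym.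
  by rewrite hl //; split => // e'; rewrite e' ltnn in e.
have [q [hq hl]] := gram_top nxs nys e; exists q => _ _; split => // l sl.
by have [s1 s2] := hl l sl; rewrite s1; split.
Qed.

Definition gram_poly xs ys : {poly {poly K}} := projT1 (cid (gram_ex xs ys)).

Lemma gram_poly_form xs ys p : all lowering xs -> all lowering ys ->
  (gram_poly xs ys).[p.1, p.2] = form p (wvec xs) (wvec ys).
Proof. by rewrite /gram_poly; case: cid => q /= h nx ny; have [] := h nx ny. Qed.

Lemma gram_poly_line xs ys l : all lowering xs -> all lowering ys -> (size l <= 2)%N ->
  (size (gram_poly xs ys).[l] <= (minn (size xs) (size ys)).+1)%N /\
    (size xs = size ys -> ((gram_poly xs ys).[l])`_(size xs) =
       (matchings xs ys)%:R * \prod_(x <- xs) slope (pair_coef K x) l).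
Proof. by rewrite /gram_poly; case: cid => q /= h nx ny; have [_] := h nx ny; apply. Qed.

Definition gram_poly_mx m (t : 'I_m -> word) : 'M[{poly {poly K}}]_m :=
  \matrix_(i, j) gram_poly (t i) (t j).

Definition gram_mx m (t : 'I_m -> word) p : 'M[K]_m :=
  \matrix_(i, j) form p (wvec (t i)) (wvec (t j)).

Lemma gram_poly_mx_map m (t : 'I_m -> word) p : (forall i, all lowering (t i)) ->
  map_mx (fun q : {poly {poly K}} => q.[p.1, p.2]) (gram_poly_mx t) = gram_mx t p.
Proof. by move=> nt; apply/matrixP => i j; rewrite !mxE gram_poly_form. Qed.

Lemma gram_det_eval m (t : 'I_m -> word) p : (forall i, all lowering (t i)) ->
  (\det (gram_poly_mx t)).[p.1, p.2] = \det (gram_mx t p).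
Proof.
move=> nt; rewrite -gram_poly_mx_map //.
rewrite -[LHS]/(horner_eval p.2 (horner_eval p.1%:P (\det (gram_poly_mx t)))) -!det_map_mx.
by congr (\det _); apply/matrixP => i j; rewrite !mxE.
Qed.

(** Scaling the entry (i, j) by the lengths of the words i and j turns the
    leading part of the Gram matrix into a diagonal matrix: by [gram_bound] only
    pairs of equal length contribute, and by [gram_top] only words that are
    permutations of each other. Substituting the square of the variable keeps
    the half-integral exponents integral. *)
Lemma gram_det_line m (t : 'I_m -> word) l : (forall i, all lowering (t i)) ->
  (forall i j, perm_eq (t i) (t j) -> i = j) -> (size l <= 2)%N ->
  (forall x, lowering x -> slope (pair_coef K x) l != 0) -> (\det (gram_poly_mx t)).[l] != 0.
Proof.
move=> nt ht sl hl.
have : horner_eval l (\det (gram_poly_mx t)) \Po 'X^2 != 0.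
  rewrite -det_map_mx -[_ \Po _]/(comp_poly 'X^2 _) -det_map_mx.
  set M := map_mx _ _.
  have hM i j : (size (M i j) <= (size (t i) + size (t j)).+1)%N /\
     (M i j)`_(size (t i) + size (t j))%N =
     (if size (t i) == size (t j) then (matchings (t i) (t j))%:R *
        \prod_(x <- t i) slope (pair_coef K x) l else 0).
    have [s1 s2] := gram_poly_line (nt i) (nt j) sl.
    rewrite !mxE; set q := (gram_poly _ _).[l] in s1 s2; rewrite /= -[horner_eval _ _]/q.
    have c2 k : (q \Po 'X^2)`_k = if (2 %| k)%N then q`_(k %/ 2) else 0.
      by rewrite coef_comp_poly_Xn.
    split.
      apply/leq_sizeP => k hk; rewrite c2; case: ifP => // /dvdnP[r er].
      rewrite er mulnK // nth_default // (leq_trans s1) //.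
      by move: hk; rewrite er; lia.
    rewrite c2; case: eqP => [e|ne].
      by rewrite -s2 // -e addnn -muln2 dvdn_mull // mulnK.
    case: ifP => // /dvdnP[r er]; rewrite er mulnK // nth_default // (leq_trans s1) //.
    by move: er ne; lia.
  have := @det_top _ _ M (fun i => size (t i)) (fun i j => (hM i j).1).
  have -> : \matrix_(i, j) (M i j)`_(size (t i) + size (t j))%N =
    diag_mx (\row_i ((matchings (t i) (t i))%:R * \prod_(x <- t i) slope (pair_coef K x) l)).
    apply/matrixP => i j; rewrite mxE (hM i j).2 !mxE.
    have [->|nij] := eqVneq i j; first by rewrite eqxx.
    case: ifP => // _; have : ~~ (0 < matchings (t i) (t j))%N.
      by rewrite matchings_gt0; apply: contra nij => /ht ->.
    by rewrite -eqn0Ngt => /eqP ->; rewrite mul0r.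
  rewrite det_diag => e; apply/eqP => d0; move/eqP: e; rewrite d0 coef0 eq_sym.
  apply/negP/prodf_neq0 => i _; rewrite mxE mulf_neq0 //.
    by rewrite pnatr_eq0 -lt0n matchings_gt0.
  rewrite prodf_seq_neq0; apply/allP => x hx; rewrite hl //.
  by move/allP: (nt i); apply.
by apply: contraNneq; rewrite -[(\det _).[l]]/(horner_eval l (\det (gram_poly_mx t))) => ->; rewrite comp_poly0.
Qed.
End GramPolynomials.

(** * Finiteness of the set of words of a given degree *)

Section Words.
Implicit Types (x y : letter) (w : word).

(** The lowering letters are generated by f and e/T under brackets: h/T is
    [e/T, f], and bracketing with h/T and e/T produces the rest. *)
Lemma lowering_ind (Q : letter -> Prop) : Q (gf, 0) -> Q (ge, -1) ->
  (forall x y, lowering x -> lowering y -> br_coef x.1 y.1 != 0 -> Q x -> Q y ->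
     Q (br_gen x.1 y.1, x.2 + y.2)) ->
  forall x, lowering x -> Q x.
Proof.
move=> qf qe qb.
have qh1 : Q (gh, -1) by have := qb (ge, -1) (gf, 0) isT isT isT qe qf.
have qF n : Q (gf, - n%:Z).
  elim: n => [|n IH]; first by rewrite oppr0.
  have hn : lowering (gf, - n%:Z) by rewrite /lowering /=; lia.
  have := qb (gh, -1) _ isT hn isT qh1 IH.
  by rewrite /= -[-1 - _]opprD -PoszD add1n.
have qE n : Q (ge, - n.+1%:Z).
  elim: n => [|n IH] //.
  have := qb (gh, -1) (ge, - n.+1%:Z) isT isT isT qh1 IH.
  by rewrite /= -[-1 - _]opprD -PoszD add1n.
case=> [[[]|] n] hn.
- have [m ->] : exists m : nat, n = - m.+1%:Z.
    by exists `|n|.-1%N; move: hn; rewrite /lowering /=; lia.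
  exact: qE.
- have [m ->] : exists m : nat, n = - m%:Z.
    by exists `|n|%N; move: hn; rewrite /lowering /=; lia.
  exact: qF.
have [m ->] : exists m : nat, n = - m.+1%:Z.
  by exists `|n|.-1%N; move: hn; rewrite /lowering /=; lia.
have hm : lowering (gf, - m%:Z) by rewrite /lowering /=; lia.
have := qb (ge, -1) _ isT hm isT qe (qF m).
by rewrite /= -[-1 - _]opprD -PoszD add1n.
Qed.

Lemma wweight_bounds w : all lowering w ->
  [/\ 0 <= (wweight w).2, (size w)%:Z <= (wweight w).1 + (wweight w).2 &
      forall x, x \in w -> - x.2 <= (wweight w).2].
Proof.
elim: w => [|y w IH]; first by rewrite /wweight big_nil.
move=> /= /andP[ny /IH[h1 h2 h3]]; rewrite wweight_cons.
have hy : [/\ 0 <= - y.2 & 1 <= (lweight y).1 + (lweight y).2].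
  by case: (y) ny => [[[]|] n]; rewrite /lowering /= => hn; split; lia.
case: hy => hy1 hy2; have e2 : (lweight y).2 = - y.2 by [].
have s1 : (lweight y + wweight w).1 = (lweight y).1 + (wweight w).1 by [].
have s2 : (lweight y + wweight w).2 = (lweight y).2 + (wweight w).2 by [].
rewrite s1 s2; split => [||x]; [lia|rewrite -addn1 PoszD; lia|].
rewrite inE => /orP[/eqP ->|/h3 hx]; lia.
Qed.

Fixpoint words_upto (A : seq letter) n : seq word :=
  if n is n'.+1 then [::] :: [seq x :: w | x <- A, w <- words_upto A n']
  else [:: [::]].

Lemma mem_words_upto A n w :
  (size w <= n)%N -> {subset w <= A} -> w \in words_upto A n.
Proof.
elim: n w => [|n IH] [|x w] //= sw hA; rewrite in_cons orFb.
apply/allpairsP; exists (x, w); split => //=; first by apply: hA; rewrite mem_head.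
by apply: IH => // y hy; apply: hA; rewrite in_cons hy orbT.
Qed.

Lemma finite_words g : exists W : seq word, forall w, all lowering w -> wweight w = g -> w \in W.
Proof.
pose A : seq letter := [seq (a, - i%:Z) | a <- [:: ge; gf; gh], i <- iota 0 `|g.2|.+1].
exists (words_upto A (absz (g.1 + g.2))) => w nw dw; have [h1 h2 h3] := wweight_bounds nw.
rewrite dw in h1 h2 h3; apply: mem_words_upto; first by lia.
move=> x hx; have := h3 x hx; move/allP: nw => /(_ x hx).
case: x hx => a n hx nx; rewrite /= => hn.
have -> : n = - `|n|%N%:Z by move: nx; rewrite /lowering /=; lia.
apply: (@allpairs_f _ _ _ (fun a (i : nat) => (a, - i%:Z))).
  by case: (a) => [[]|]; rewrite !inE.
by rewrite mem_iota /= add0n ltnS; move: nx; rewrite /lowering /=; lia.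
Qed.

(** A normal form for words up to permutation of the letters, such as sorting
    for some order of the letters. *)
Definition is_rep (rep : word -> word) : Prop :=
  (forall w, perm_eq (rep w) w) /\
  (forall w w', perm_eq w w' -> rep w = rep w').

Lemma rep_family rep g : is_rep rep -> exists m (t : 'I_m -> word),
  [/\ forall i, all lowering (t i) /\ wweight (t i) = g,
      forall i j, perm_eq (t i) (t j) -> i = j,
      forall w, all lowering w -> wweight w = g -> exists i, t i = rep w &
      forall i, rep (t i) = t i].
Proof.
move=> [r1 r2]; have [W hW] := finite_words g.
pose T := undup [seq rep w | w <- W & all lowering w && (wweight w == g)].
have hT t : t \in T -> exists w, [/\ all lowering w, wweight w = g & t = rep w].
  rewrite mem_undup => /mapP[w]; rewrite mem_filter => /andP[/andP[nw /eqP dw] _] ->.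
  by exists w.
have rr w : rep (rep w) = rep w by exact: r2.
have hr (i : 'I_(size T)) : rep (nth [::] T i) = nth [::] T i.
  by have [w [_ _ ->]] := hT _ (mem_nth [::] (ltn_ord i)).
exists (size T), (fun i => nth [::] T i); split => //.
- move=> i; have [w [nw dw ->]] := hT _ (mem_nth [::] (ltn_ord i)).
  by rewrite (perm_all _ (r1 w)) (wweight_perm (r1 w)).
- move=> i j /r2; rewrite !hr => /eqP.
  by rewrite nth_uniq ?undup_uniq // => /eqP /val_inj.
- move=> w nw dw; have h : rep w \in T.
    by rewrite mem_undup map_f // mem_filter nw dw eqxx hW.
  have hi : (index (rep w) T < size T)%N by rewrite index_mem.
  by exists (Ordinal hi); rewrite /= nth_index.
Qed.
End Words.

(** * Spanning by ordered words *)

Section Spanning.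
Variables (K : numClosedFieldType) (V : lmodType K) (D : verma_data V).
Implicit Types (p : K * K) (x y : letter) (w : word) (u : V) (g : int * int).
Notation op := (op D).
Notation wvec := (wvec D).
Notation form := (form D).
Notation in_span := (in_span D).
Notation wspace := (wspace D).

Lemma op_lowering_comm p x y u : lowering x -> lowering y ->
  op p x (op p y u) = op p y (op p x u) +
    (br_coef x.1 y.1)%:~R *: op p (br_gen x.1 y.1, x.2 + y.2) u.
Proof.
move=> nx ny; rewrite op_comm; case: eqP => [h|_]; last by rewrite scale0r addr0.
have [-> ->] := lowering_central nx ny h.
by rewrite /= !mulr0z mulr0 mul0r !scale0r !addr0.
Qed.

Definition shorter N g w : Prop := [/\ all lowering w, wweight w = g & (size w < N)%N].

Lemma in_span_opp (P : word -> Prop) u v : in_span P u -> in_span P v -> in_span P (u - v).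
Proof. by move=> hu hv; rewrite -scaleN1r addrC; exact: in_span_lin. Qed.

Lemma wvec_move x w w' : lowering x -> all lowering (w ++ w') ->
  in_span (shorter (size (x :: w ++ w')) (wweight (x :: w ++ w')))
     (wvec (w ++ x :: w') - wvec (x :: w ++ w')).
Proof.
move=> nx; elim: w => [|y w IH] /=; first by rewrite subrr => _; exact: in_span0.
move=> /andP[ny nw].
have e := op_lowering_comm 0 (wvec (w ++ w')) nx ny.
have -> : op 0 y (wvec (w ++ x :: w')) - op 0 x (op 0 y (wvec (w ++ w'))) =
  op 0 y (wvec (w ++ x :: w') - wvec (x :: w ++ w')) +
  (- (br_coef x.1 y.1)%:~R) *: op 0 (br_gen x.1 y.1, x.2 + y.2) (wvec (w ++ w')).
  by rewrite e opD opN /=; lin_solve K V.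
apply: in_span_add.
  apply: (in_span_op _ ny _ (IH nw)) => u [nu du su]; split => /=.
  - by rewrite ny.
  - by rewrite !wweight_cons du wweight_cons addrCA.
  - by rewrite ltnS.
have [->|nb] := eqVneq (br_coef x.1 y.1) 0; first by rewrite oppr0 scale0r; exact: in_span0.
apply: in_span_scale; apply: (@in_span_wvec _ _ _ _ ((br_gen x.1 y.1, x.2 + y.2) :: w ++ w')); split => //.
- by rewrite /= br_lowering.
- by rewrite !wweight_cons br_lweight // addrA.
Qed.

(** Commuting two letters costs a word with one letter less. *)
Lemma perm_wvec w w' : perm_eq w w' -> all lowering w ->
  in_span (shorter (size w) (wweight w)) (wvec w - wvec w').
Proof.
elim: w w' => [|x w IH] w' h.
  by have := perm_size h; case: w' h => //= _ _ _; rewrite subrr; exact: in_span0.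
move=> /= /andP[nx nw].
have xw : x \in w' by rewrite -(perm_mem h) mem_head.
case/splitPr: xw h => a b h.
have hab : perm_eq w (a ++ b).
  by rewrite -(perm_cons x) (perm_trans h) // -cat1s perm_catCA.
have nab : all lowering (a ++ b) by rewrite -(perm_all _ hab).
have -> : op 0 x (wvec w) - wvec (a ++ x :: b) =
  op 0 x (wvec w - wvec (a ++ b)) + (-1) *: (wvec (a ++ x :: b) - wvec (x :: a ++ b)).
  by rewrite opD opN /=; lin_solve K V.
apply: in_span_add.
  apply: (in_span_op _ nx _ (IH _ hab nw)) => u [nu du su]; split => /=.
  - by rewrite nx.
  - by rewrite !wweight_cons du.
  - by rewrite ltnS.
apply: in_span_scale; have := wvec_move nx nab.
by rewrite /= (perm_size hab) !wweight_cons (wweight_perm hab).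
Qed.

(** Up to shorter words a word equals its normal form. *)
Lemma wspace_reps rep g u : is_rep rep -> wspace g u ->
  in_span (fun t => exists w, [/\ all lowering w, wweight w = g & t = rep w]) u.
Proof.
move=> [r1 r2] hu; elim/in_span_rect: hu => [|s a b ha hb|w].
- exact: in_span0.
- exact: in_span_lin.
elim/ltn_ind: (size w) {-2}w (erefl (size w)) => n IH {}w sw [nw dw].
rewrite -(subrK (wvec (rep w)) (wvec w)); apply: in_span_add; last first.
  by apply: in_span_wvec; exists w.
have h := r1 w; rewrite perm_sym in h.
elim/in_span_rect: (perm_wvec h nw) => [|s a b ha hb|t [nt dt st]].
- exact: in_span0.
- exact: in_span_lin.
by apply: (IH (size t)); rewrite -?sw // dt dw.
Qed.

Lemma wspace_coords m (t : 'I_m -> word) rep g u : is_rep rep ->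
  (forall w, all lowering w -> wweight w = g -> exists i, t i = rep w) ->
  wspace g u -> exists c : 'rV[K]_m, u = \sum_i c 0 i *: wvec (t i).
Proof.
move=> hr ht /(wspace_reps hr); elim/in_span_rect => [|s a b [c ->] [d ->]|_ [w [nw dw ->]]].
- by exists 0; rewrite big1 // => i _; rewrite mxE scale0r.
- exists (s *: c + d); rewrite scaler_sumr -big_split; apply: eq_bigr => i _.
  by rewrite !mxE scalerDl scalerA.
have [i hi] := ht _ nw dw; exists (\row_j (j == i)%:R).
rewrite (bigD1 i) //= mxE eqxx scale1r hi big1 ?addr0 // => j /negPf nj.
by rewrite mxE nj scale0r.
Qed.

Lemma wspace_neg g u : wspace g u -> g.2 < 0 -> u = 0.
Proof.
move=> h g0; elim: h => // c w t [nw dw] _ _.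
by have [h _ _] := wweight_bounds nw; rewrite dw leNgt g0 in h.
Qed.

Lemma wspace_size0 g u : wspace g u -> g.1 + g.2 <= 0 -> g != 0 -> u = 0.
Proof.
move=> h g0 gn; elim: h => // c w t [nw dw] _ _.
have [_ h _] := wweight_bounds nw; rewrite dw in h.
case: w {nw} dw h => [|x w] dw h; last by move: h => /=; lia.
by rewrite -dw /wweight big_nil eqxx in gn.
Qed.

Lemma wspace0 u : wspace 0 u -> exists s, u = s *: vac D.
Proof.
elim=> [|c w t [nw dw] _ [s ->]]; first by exists 0; rewrite scale0r.
exists (c + s); rewrite scalerDl; congr (_ *: _ + _).
by have [_ h _] := wweight_bounds nw; rewrite dw in h; case: w h {nw dw}.
Qed.

Lemma h0_wspace p g u : wspace g u ->
  op p (gh, 0) u = (p.1 - (2 * (g.1 - g.2))%:~R) *: u.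
Proof.
elim/in_span_rect => [|s a b ha hb|w [nw <-]]; last exact: h0_wvec.
- by rewrite op0 scaler0.
- by rewrite op_linear ha hb scalerDr !scalerA [_ * s]mulrC.
Qed.

Definition simple_letter : pred letter := fun x => (x == (gf, 0)) || (x == (ge, -1)).
Definition wspace12 g : V -> Prop := in_span (fun w => all simple_letter w /\ wweight w = g).

Lemma op_wspace12 y : lowering y -> forall g u, wspace12 g u -> wspace12 (g + lweight y) (op 0 y u).
Proof.
have h1 y' : lowering y' -> simple_letter y' -> forall g u, wspace12 g u -> wspace12 (g + lweight y') (op 0 y' u).
  move=> ny gy g u h; apply: (in_span_op 0 ny _ h) => w [nw dw].
  by rewrite /= gy nw wweight_cons dw addrC.
move: y; apply: lowering_ind => [||x y nx ny nb qx qy g u hu]; try exact: h1.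
have -> : op 0 (br_gen x.1 y.1, x.2 + y.2) u =
    ((br_coef x.1 y.1)%:~R)^-1 *: (op 0 x (op 0 y u) - op 0 y (op 0 x u)).
  by rewrite op_lowering_comm // addrAC subrr add0r scalerA mulVf ?scale1r // intr_eq0.
apply: in_span_scale; apply: in_span_opp; rewrite br_lweight //.
  by rewrite [lweight x + _]addrC addrA; apply: qx; exact: qy.
by rewrite addrA; apply: qy; exact: qx.
Qed.

(** f_1 and f_2 generate the lowering operators ([lowering_ind]). *)
Lemma wspace_simple g u : wspace g u -> wspace12 g u.
Proof.
elim/in_span_rect => [|s a b|w [nw <-]]; [exact: in_span0|exact: in_span_lin|].
elim: w nw => [|x w IH] /=; first by move=> _; apply: (@in_span_wvec _ _ _ _ [::]).
by move=> /andP[nx nw]; rewrite wweight_cons addrC; apply: op_wspace12 => //; exact: IH.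
Qed.

(** * The Casimir operator *)

Notation E p n := (op p (ge, n)).
Notation F p n := (op p (gf, n)).
Notation H p n := (op p (gh, n)).

(** Twice the Casimir operator of the affine algebra without its Cartan part. On
    a vector of degree (p1, p2) the terms with index beyond p2 vanish, so that a
    finite sum suffices. *)
Definition casimir p N u : V :=
  \sum_(i < N) (2 *: F p (- i.+1%:Z) (E p i.+1%:Z u) +
     2 *: E p (- i.+1%:Z) (F p i.+1%:Z u) + H p (- i.+1%:Z) (H p i.+1%:Z u)) +
  2 *: F p 0 (E p 0 u).

Definition casimir_value p g : K := let n := (g.1 - g.2)%:~R in
  2 * (n * (p.1 + 1) + (g.2)%:~R * (p.2 + 2) - n ^+ 2).

Lemma casimir_lin p N s u v :
  casimir p N (s *: u + v) = s *: casimir p N u + casimir p N v.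
Proof.
rewrite /casimir [in RHS]scalerDr scaler_sumr addrACA -big_split /=; congr (_ + _).
  by apply: eq_bigr => i _; rewrite !op_linear; lin_solve K V.
by rewrite !op_linear; lin_solve K V.
Qed.

Lemma op_EE p m n u : E p m (E p n u) = E p n (E p m u).
Proof. by rewrite op_comm /= !mulr0z mulr0 mul0r if_same !scale0r !addr0. Qed.
Lemma op_FF p m n u : F p m (F p n u) = F p n (F p m u).
Proof. by rewrite op_comm /= !mulr0z mulr0 mul0r if_same !scale0r !addr0. Qed.
Lemma op_EF p m n u : E p m (F p n u) = F p n (E p m u) + H p (m + n) u +
  (if m + n == 0 then m%:~R * p.2 else 0) *: u.
Proof. by rewrite op_comm /= scale1r mulr1. Qed.
Lemma op_HE p m n u : H p m (E p n u) = E p n (H p m u) + 2 *: E p (m + n) u.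
Proof. by rewrite op_comm /= !mulr0z mulr0 mul0r if_same !scale0r !addr0. Qed.
Lemma op_HF p m n u : H p m (F p n u) = F p n (H p m u) - 2 *: F p (m + n) u.
Proof. by rewrite op_comm /= !mulr0z mulr0 mul0r if_same !scale0r !addr0 mulrN1 rmorphN /= scaleNr. Qed.

Lemma op_EF0 p m u : E p m (F p 0 u) = F p 0 (E p m u) + H p m u.
Proof.
rewrite op_EF addr0; case: eqP => [->|_]; last by rewrite scale0r addr0.
by rewrite mulr0z mul0r scale0r addr0.
Qed.
Lemma op_HF0 p m u : H p m (F p 0 u) = F p 0 (H p m u) - 2 *: F p m u.
Proof. by rewrite op_HF addr0. Qed.

Lemma casimir_F p N u :
  casimir p N (F p 0 u) = F p 0 (casimir p N u) + 2 *: F p 0 (H p 0 u).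
Proof.
rewrite /casimir opD op_sum -addrA; congr (_ + _).
  apply: eq_bigr => i _; set n := i.+1%:Z.
  have a1 : F p (- n) (E p n (F p 0 u)) =
      F p 0 (F p (- n) (E p n u)) + F p (- n) (H p n u) by rewrite op_EF0 opD op_FF.
  have a2 : E p (- n) (F p n (F p 0 u)) =
      F p 0 (E p (- n) (F p n u)) + H p (- n) (F p n u) by rewrite op_FF op_EF0.
  have a3 : H p (- n) (H p n (F p 0 u)) = F p 0 (H p (- n) (H p n u)) -
      2 *: F p (- n) (H p n u) - 2 *: H p (- n) (F p n u).
    by rewrite op_HF0 opD opN opZ op_HF0.
  by rewrite a1 a2 a3 !opD !opZ; lin_solve K V.
by rewrite op_EF0 opD !opZ; lin_solve K V.
Qed.

(** The commutators telescope, since e/T shifts the loop degree by one; the last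
    term is the remainder of the truncation. *)
Lemma casimir_E p N u : casimir p N.+1 (E p (-1) u) = E p (-1) (casimir p N.+1 u) +
  (2 * p.2) *: E p (-1) u - 2 *: E p (-1) (H p 0 u) -
  2 *: (H p (- N.+2%:Z) (E p N.+1%:Z u) - E p (- N.+2%:Z) (H p N.+1%:Z u)).
Proof.
pose U (j : nat) := H p (- j.+1%:Z) (E p j%:Z u) - E p (- j.+1%:Z) (H p j%:Z u).
have hi (i : nat) : 2 *: F p (- i.+1%:Z) (E p i.+1%:Z (E p (-1) u)) +
     2 *: E p (- i.+1%:Z) (F p i.+1%:Z (E p (-1) u)) +
     H p (- i.+1%:Z) (H p i.+1%:Z (E p (-1) u)) =
   E p (-1) (2 *: F p (- i.+1%:Z) (E p i.+1%:Z u) +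
     2 *: E p (- i.+1%:Z) (F p i.+1%:Z u) + H p (- i.+1%:Z) (H p i.+1%:Z u)) +
   2 *: (U i - U i.+1) + (if i == 0 then 2 * p.2 else 0) *: E p (-1) u.
  set n := i.+1%:Z.
  have en : -1 + n = i%:Z by rewrite /n; lia.
  have en' : -1 - n = - i.+2%:Z by rewrite /n; lia.
  have a1 : F p (- n) (E p n (E p (-1) u)) =
      E p (-1) (F p (- n) (E p n u)) - H p (- i.+2%:Z) (E p n u).
    rewrite op_EE (op_EF _ (-1)) en'; case: eqP => [|_]; first by lia.
    by lin_solve K V.
  have a2 : E p (- n) (F p n (E p (-1) u)) = E p (-1) (E p (- n) (F p n u)) -
      E p (- n) (H p i%:Z u) + (if i == 0 then p.2 else 0) *: E p (- n) u.
    have -> : F p n (E p (-1) u) = E p (-1) (F p n u) - H p i%:Z u +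
        (if i == 0 then p.2 else 0) *: u.
      rewrite op_EF en; have -> : (i%:Z == 0) = (i == 0) by lia.
      by case: ifP => _; lin_solve K V.
    by rewrite !opD opN opZ (op_EE _ (- n)).
  have a3 : H p (- n) (H p n (E p (-1) u)) = E p (-1) (H p (- n) (H p n u)) +
      2 *: E p (- i.+2%:Z) (H p n u) + 2 *: H p (- n) (E p i%:Z u).
    rewrite op_HE [n - 1]addrC en opD opZ op_HE; have -> : - n - 1 = - i.+2%:Z by rewrite /n; lia.
    by [].
  rewrite a1 a2 a3 !opD !opZ /U -/n.
  case: eqP => [e|_]; last by lin_solve K V.
  have -> : E p (- n) u = E p (-1) u by rewrite /n e.
  by lin_solve K V.
have telescope : \sum_(i < N.+1) (U i - U i.+1) = U 0 - U N.+1.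
  elim: (N.+1) => [|m IH]; first by rewrite big_ord0 subrr.
  by rewrite big_ord_recr /= IH; lin_solve K V.
rewrite /casimir; under eq_bigr => i _ do rewrite hi.
rewrite !big_split /= -op_sum -scaler_sumr telescope.
have -> : \sum_(i < N.+1) (if i == 0 :> nat then 2 * p.2 else 0) *: E p (-1) u =
    (2 * p.2) *: E p (-1) u.
  by rewrite big_ord_recl /= big1 ?addr0 // => i _; rewrite scale0r.
have -> : F p 0 (E p 0 (E p (-1) u)) = E p (-1) (F p 0 (E p 0 u)) - H p (-1) (E p 0 u).
  by rewrite op_EE (op_EF _ (-1)) addr0 /=; lin_solve K V.
rewrite opD opZ /U !big_split /=; lin_solve K V.
Qed.

Lemma vac_pos p x : lowering (transpose x) -> op p x (vac D) = 0.
Proof. by case: x => a n; apply: vop_pos. Qed.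

(** It suffices to see how [casimir] commutes with f_1 = f and f_2 = e/T: it moves
    the value by the amount that the Cartan part of the Casimir operator
    dictates. *)
Theorem casimirE p N g u : wspace g u -> g.2 <= N%:Z ->
  casimir p N u = casimir_value p g *: u.
Proof.
move/wspace_simple; elim/in_span_rect => [|s a b ha hb hN|w [nw <-]].
- by move=> _; have := casimir_lin p N (-1) 0 0; rewrite scaler0 addr0 !scaleN1r addNr scaler0.
- by rewrite casimir_lin ha // hb // scalerDr !scalerA [s * _]mulrC.
elim: w nw => [|x w IH] /=.
  move=> _ _; rewrite /casimir vac_pos // op0 scaler0 addr0 big1.
    have -> : casimir_value p (wweight [::]) = 0.
      by rewrite /casimir_value /wweight big_nil -[(0 : int * int)]/(0, 0) /=; ring.
    by rewrite scale0r.
  by move=> i _; rewrite !vac_pos // !op0 !scaler0 !addr0.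
move=> /andP[gx gw] hN.
have nw : all lowering w by apply/allP => y /(allP gw) /orP[] /eqP ->.
have hw := wspace_wvec D nw.
case/orP: gx hN => /eqP -> hN; rewrite -(op_indep D p) //.
  have hN' : (wweight w).2 <= N%:Z by move: hN; rewrite wweight_cons /=; lia.
  rewrite casimir_F (h0_wspace p hw) IH // !opZ !scalerA -scalerDl; congr (_ *: _).
  rewrite /casimir_value wweight_cons /=; set a := (wweight w).1; set b := (wweight w).2.
  by rewrite -!/a -!/b; rewrite !(rmorphD, rmorphB, rmorphN, rmorphM) /=; ring.
have e2 : (wweight ((ge, -1) :: w)).2 = (wweight w).2 + 1 by rewrite wweight_cons /= addrC.
have e1 : (wweight ((ge, -1) :: w)).1 = (wweight w).1 by rewrite wweight_cons /= add0r.
have [d0 _ _] := wweight_bounds nw.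
case: N hN IH => [|N] hN IH; first by move: hN; rewrite e2; lia.
rewrite casimir_E (h0_wspace p hw) (IH gw); last by move: hN; rewrite e2; lia.
have -> : E p N.+1%:Z (wvec w) = 0.
  by apply: (wspace_neg (op_wspace p (ge, N.+1%:Z) hw)); move: hN; rewrite e2 /=; lia.
have -> : H p N.+1%:Z (wvec w) = 0.
  by apply: (wspace_neg (op_wspace p (gh, N.+1%:Z) hw)); move: hN; rewrite e2 /=; lia.
rewrite !op0 !opZ !scalerA subrr scaler0 subr0 -scalerDl -scalerBl; congr (_ *: _).
rewrite /casimir_value e1 e2; set a := (wweight w).1; set b := (wweight w).2.
by rewrite !(rmorphD, rmorphB, rmorphN, rmorphM) /=; ring.
Qed.

Lemma wspace_bounds g u : wspace g u -> u != 0 -> 0 <= g.2 /\ 0 <= g.1 + g.2.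
Proof.
move=> h u0; split; rewrite leNgt; apply: contra_neqN u0 => hg.
  exact: (wspace_neg h hg).
by apply: (wspace_size0 h); [lia | apply: contraTneq hg => -> ].
Qed.

(** The kernel of the form is a submodule. Raise a kernel vector as long as the
    result is nonzero; the last vector is killed by all raising operators, and
    there the Casimir scalar must vanish. The vacuum is not in the kernel. *)
Lemma kernel_casimir p g u : wspace g u -> u != 0 -> (forall u', form p u u' = 0) ->
  exists g', [/\ 0 <= g'.2 <= g.2, 0 <= g'.1 + g'.2 <= g.1 + g.2, g' != 0 &
    casimir_value p g' = 0].
Proof.
move en: (absz (g.1 + g.2)) => n; elim/ltn_ind: n g u en => n IH g u en hu u0 ku.
have [h2 h1] := wspace_bounds hu u0.
have [g0|g0] := eqVneq g 0.
  rewrite g0 in hu; have [s es] := wspace0 hu.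
  by have := ku (vac D); rewrite es formZl form_vac mulr1 => s0; rewrite es s0 scale0r eqxx in u0.
case: (pselect (exists2 x, lowering (transpose x) & op p x u != 0)) => [[x nx hx]|hn].
  have hxu := op_wspace p x hu.
  have [x2 x1] : (lweight x).2 <= 0 /\ (lweight x).1 + (lweight x).2 < 0.
    by case: (x) nx => [[[]|] k]; rewrite /lowering /=; lia.
  have d2 : (g + lweight x).2 = g.2 + (lweight x).2 by [].
  have d1 : (g + lweight x).1 = g.1 + (lweight x).1 by [].
  have [k2 k1] := wspace_bounds hxu hx; rewrite d1 d2 in k1 k2.
  have [|u'|g' [b2 b1 gn v]] := IH _ _ _ _ erefl hxu hx.
  - by rewrite -en d1 d2; lia.
  - by rewrite form_adjV.
  by exists g'; split => //; rewrite d2 ?d1 in b1 b2; lia.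
have kill x : lowering (transpose x) -> op p x u = 0.
  by move=> nx; apply/eqP; apply: contrapT => hx; apply: hn; exists x => //; apply/negP.
exists g; split => //; try lia.
have hN : g.2 <= `|g.2|%N%:Z by lia.
have := casimirE p hu hN; rewrite /casimir kill // op0 scaler0 addr0 big1.
  by move/esym/eqP; rewrite scaler_eq0 (negPf u0) orbF => /eqP.
by move=> i _; rewrite !kill // !op0 !scaler0 !addr0.
Qed.
End Spanning.

(** * Ordered words *)

Section Sorting.
Implicit Types (a b c : gen) (w : word).

(** Only the order of the types of letters matters; letters of one type commute
    and are sorted by their exponent. *)
Definition sort_gen a w : word :=
  [seq (a, n) | n <- sort <=%O [seq x.2 | x <- w & x.1 == a]].
Definition sorted_word a b c w : word := sort_gen a w ++ sort_gen b w ++ sort_gen c w.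

Lemma sort_gen_perm a w : perm_eq (sort_gen a w) [seq x <- w | x.1 == a].
Proof.
apply: (perm_trans (perm_map _ (permEl (perm_sort _ _)))).
rewrite -map_comp map_id_in // => -[a' n] /=.
by rewrite mem_filter => /andP[/eqP /= ->].
Qed.

Lemma sort_gen_eq a w w' : perm_eq w w' -> sort_gen a w = sort_gen a w'.
Proof.
by move=> h; congr map; apply/perm_sort_leP; apply: perm_map; apply: perm_filter.
Qed.

Lemma sorted_word_is_rep a b c : perm_eq [:: a; b; c] [:: ge; gf; gh] -> is_rep (sorted_word a b c).
Proof.
move=> h; split=> [w|w w' hw]; last by rewrite /sorted_word !(sort_gen_eq _ hw).
have : perm_eq (sorted_word a b c w) ([seq x <- w | x.1 == a] ++ [seq x <- w | x.1 == b] ++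
    [seq x <- w | x.1 == c]) by rewrite !perm_cat // sort_gen_perm.
move/perm_trans; apply; apply/seq.permP => P; rewrite !count_cat !count_filter.
elim: w => //= x w IH.
have : [&& a != b, b != c, a != c & x.1 \in [:: a; b; c]].
  rewrite (perm_mem h); move: (perm_uniq h); rewrite /= !inE.
  by case: (a) (b) (c) (x.1) => [[]|] [[]|] [[]|] [[]|].
rewrite !inE; case: (P x) => //=.
case: (x.1) (a) (b) (c) IH => [[]|] [[]|] [[]|] [[]|] //= <- _; lia.
Qed.

Lemma sort_gen_cons_other a x w : x.1 != a -> sort_gen a (x :: w) = sort_gen a w.
Proof. by move=> h; rewrite /sort_gen /= (negPf h). Qed.

End Sorting.

(** * Degeneracy of the form *)

Section Resonance.
Variables (K : numClosedFieldType) (V : lmodType K) (D : verma_data V).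
Implicit Types (p : K * K) (x y : letter) (w : word) (u : V) (g : int * int).
Notation op := (op D).
Notation wvec := (wvec D).
Notation form := (form D).
Notation in_span := (in_span D).
Notation wspace := (wspace D).

Definition weight_basis g m (t : 'I_m -> word) : Prop :=
  [/\ forall i, all lowering (t i) /\ wweight (t i) = g,
      forall i j, perm_eq (t i) (t j) -> i = j &
      forall u, wspace g u -> exists c : 'rV[K]_m, u = \sum_i c 0 i *: wvec (t i)].

Lemma FHE_rep : is_rep (sorted_word gf gh ge). Proof. exact: sorted_word_is_rep. Qed.
Lemma EHF_rep : is_rep (sorted_word ge gh gf). Proof. exact: sorted_word_is_rep. Qed.

Lemma weight_basis_ex g : exists m (t : 'I_m -> word), weight_basis g t.
Proof.
have [m [t [h1 h2 h3 h4]]] := rep_family g FHE_rep; exists m, t; split => // u.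
exact: wspace_coords FHE_rep h3.
Qed.

Lemma slope_line x (m r : K) : slope (pair_coef K x) (m%:P + r *: 'X) =
  (- hweight x.1)%:~R * r + (- x.2 * trace_form (dual_gen x.1) x.1)%:~R.
Proof. by rewrite /slope /pair_coef /= coefD coefC coefZ coefX /= add0r mulr1. Qed.

(** The linear forms M + i k, 2 j k, l k - M are nonconstant on a line whose
    slope is not an integer. *)
Lemma slope_ne0 (m r : K) : (forall z : int, r != z%:~R) ->
  forall x, lowering x -> slope (pair_coef K x) (m%:P + r *: 'X) != 0.
Proof.
move=> hr [a n] hn; rewrite slope_line /=; case: a hn => [[]|] /= hn.
- apply: contraNneq (hr (- n)) => h; rewrite -subr_eq0 -[0]oppr0 -h.
  by apply/eqP; ring.
- by apply: contraNneq (hr n) => h; rewrite -subr_eq0 -h; apply/eqP; ring.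
- by rewrite mul0r add0r intr_eq0 mulf_neq0 // oppr_eq0; move: hn; rewrite /lowering /=; lia.
Qed.

Lemma size_line (m r : K) : (size (m%:P + r *: 'X)%R <= 2)%N.
Proof.
rewrite (leq_trans (size_polyD _ _)) // geq_max (leq_trans (size_polyC_leq1 _)) //=.
by rewrite (leq_trans (size_scale_leq _ _)) // size_polyX.
Qed.

Section Basis.
Variables (g : int * int) (m : nat) (t : 'I_m -> word).
Hypothesis ht : weight_basis g t.

Lemma basis_lowering i : all lowering (t i). Proof. by case: ht => h _ _; case: (h i). Qed.
Lemma basis_wspace i : wspace g (wvec (t i)).
Proof. by case: ht => h _ _; case: (h i) => h1 <-; exact: wspace_wvec. Qed.

Lemma det_line_ne0 (m0 r : K) : (forall z : int, r != z%:~R) ->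
  (\det (gram_poly_mx D t)).[m0%:P + r *: 'X] != 0.
Proof.
case: ht => h1 h2 _ hr; apply: gram_det_line => //.
- exact: basis_lowering.
- exact: size_line.
- exact: slope_ne0.
Qed.

(** Any line of nonintegral slope contains such a point; the slope 1/2 is used. *)
Lemma generic_point : exists q, \det (gram_mx D t q) != 0.
Proof.
have hr : forall z : int, (2^-1 : K) != z%:~R.
  move=> z; apply/negP => /eqP h; have : (1 : K) = (z * 2)%:~R.
    by rewrite rmorphM /= -h mulVf // pnatr_eq0.
  by rewrite -[1]/(1%:~R) => /intr_inj; lia.
have /poly_nonroot[s] := det_line_ne0 0 hr.
rewrite horner_line => h; exists ((0%:P + 2^-1 *: 'X : {poly K}).[s], s).
by rewrite -gram_det_eval //; exact: basis_lowering.
Qed.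

Lemma form_comb p (c : 'rV[K]_m) j :
  form p (\sum_i c 0 i *: wvec (t i)) (wvec (t j)) = (c *m gram_mx D t p) 0 j.
Proof.
rewrite mxE; elim: (index_enum _) => [|i r IH]; first by rewrite !big_nil form0l.
by rewrite !big_cons form_linear IH mxE.
Qed.

Lemma form_basis0 p u : (forall j, form p u (wvec (t j)) = 0) ->
  forall u', wspace g u' -> form p u u' = 0.
Proof.
move=> h u' hu'; case: ht => _ _ /(_ _ hu')[c ->].
rewrite form_sym; elim: (index_enum _) => [|i r IH]; first by rewrite !big_nil form0l.
by rewrite !big_cons form_linear IH form_sym h mulr0 addr0.
Qed.

Lemma comb_eq0 p (c : 'rV[K]_m) : \det (gram_mx D t p) != 0 -> c *m gram_mx D t p = 0 -> c = 0.
Proof.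
move=> hd hc; have hu : gram_mx D t p \in unitmx by rewrite unitmxE unitfE.
by rewrite -[c](mulmxK hu) hc mul0mx.
Qed.

(** Linear independence does not involve (M, k), and at a generic point the Gram
    determinant is nonzero. *)
Lemma basis_free (c : 'rV[K]_m) : \sum_i c 0 i *: wvec (t i) = 0 -> c = 0.
Proof.
move=> h; have [q hq] := generic_point; apply: (comb_eq0 hq).
by apply/rowP => j; rewrite -form_comb h form0l mxE.
Qed.

Lemma basis_nondeg p u : \det (gram_mx D t p) != 0 -> wspace g u ->
  (forall u', wspace g u' -> form p u u' = 0) -> u = 0.
Proof.
move=> hd hu h; case: (ht) => _ _ /(_ _ hu)[c e].
suff c0 : c = 0 by rewrite e c0 big1 // => i _; rewrite mxE scale0r.
apply: (comb_eq0 hd); apply/rowP => j; rewrite -form_comb -e h ?mxE //; exact: basis_wspace.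
Qed.

Lemma orth_ext p u : wspace g u -> (forall u', wspace g u' -> form p u u' = 0) ->
  forall u', form p u u' = 0.
Proof.
move=> hu h u'; elim/in_span_rect: (in_span_all D u') => [|s a b ha hb|w nw].
- by rewrite form_sym form0l.
- by rewrite form_linear_r ha hb mulr0 addr0.
have [e|ne] := eqVneq g (wweight w); first by apply: h; rewrite e; exact: wspace_wvec.
exact: form_orth hu (wspace_wvec D nw) ne.
Qed.

Lemma degenerate_kernel p : \det (gram_mx D t p) = 0 ->
  exists u, [/\ wspace g u, u != 0 & forall u', form p u u' = 0].
Proof.
move/eqP/det0P => [c c0 hc]; exists (\sum_i c 0 i *: wvec (t i)).
have hu : wspace g (\sum_i c 0 i *: wvec (t i)).
  elim: (index_enum _) => [|i r IH]; first by rewrite big_nil; exact: in_span0.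
  by rewrite big_cons; apply: in_span_lin => //; exact: basis_wspace.
split => //; first by apply: contraNneq c0 => /basis_free ->.
apply: orth_ext hu _; apply: form_basis0 => j.
by rewrite form_comb hc mxE.
Qed.

(** The determinant vanishes on a Casimir line n (M + 1) + p2 (k + 2) = n^2 through
    the point, so p2 / n is an integer by [det_line_ne0]; with p2 = - n z this is
    the stated equation. The inequalities say that p2 is nonnegative and that
    the height p1 + p2 = n + 2 p2 lies between 0 and that of [g]. *)
Lemma degenerate_resonant p : p.2 + 2 != 0 -> \det (gram_mx D t p) = 0 ->
  exists n z : int, [/\ n != 0, 0 <= - n * z, 0 <= n - 2 * n * z <= g.1 + g.2 &
    p.1 + 1 = n%:~R + z%:~R * (p.2 + 2)].
Proof.
move=> hp hdet.
pose line (n j : int) : {poly K} :=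
  (n%:~R - 1 - j%:~R / n%:~R * 2)%:P + (- (j%:~R / n%:~R)) *: 'X.
have [g2 g1] : 0 <= g.2 /\ 0 <= g.1 + g.2.
  by have [u [hu u0 _]] := degenerate_kernel hdet; exact: wspace_bounds hu u0.
(* The degrees (p1, p2) with p2 and p1 + p2 bounded by those of g, as pairs (p1 - p2, p2). *)
pose pts := [seq (s%:Z - 2 * j%:Z, j%:Z) | s <- iota 0 (absz (g.1 + g.2)).+1,
   j <- iota 0 (absz g.2).+1].
pose P := [seq q <- pts | q.1 != 0].
have [] := @zero_on_graph K (\det (gram_poly_mx D t)) (-2) [seq line q.1 q.2 | q <- P] _ p.1 p.2.
- move=> x y hy; rewrite -[y]/(x, y).2 -[x]/(x, y).1 gram_det_eval; last exact: basis_lowering.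
  case/degenerate_kernel => u [hu u0 ku].
  have [g' [b2 b1 gn v]] := kernel_casimir hu u0 ku.
  pose n := g'.1 - g'.2.
  have n0 : n != 0.
    apply: contraNneq gn => n0; move: v; rewrite /casimir_value -/n n0 mulr0z.
    rewrite mul0r add0r expr0n /= subr0 => /eqP.
    rewrite !mulf_eq0 pnatr_eq0 /= intr_eq0 addr_eq0 (negPf hy) orbF => /eqP e.
    by move: n0; rewrite /n e subr0; case: (g') e => /= a b -> ->.
  exists (line n g'.2).
    apply/mapP; exists (n, g'.2) => //; rewrite mem_filter n0 /=.
    apply/allpairsP; exists (absz (g'.1 + g'.2), absz g'.2); split.
    - by rewrite mem_iota add0n ltnS /=; lia.
    - by rewrite mem_iota add0n ltnS /=; lia.
    - by congr (_, _) => /=; rewrite /n; lia.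
  have nK : n%:~R != 0 :> K by rewrite intr_eq0.
  move: v; rewrite /casimir_value -/n /= => /eqP.
  rewrite mulf_eq0 pnatr_eq0 /= => /eqP v.
  have e : n%:~R * (x + 1) = n%:~R ^+ 2 - (g'.2)%:~R * (y + 2).
    by apply/eqP; rewrite -subr_eq0 -v; apply/eqP; ring.
  rewrite /line !hornerE; apply: (mulfI nK).
  have -> : n%:~R * x = n%:~R * (x + 1) - n%:~R by ring.
  by rewrite e; field.
- by apply: contraNneq hp => ->; rewrite addNr.
- by rewrite gram_det_eval //; exact: basis_lowering.
move=> l [/mapP[[n j]]]; rewrite mem_filter => /andP[/= n0 hnj] -> hM hD.
have [r0 hr0] : exists z : int, - (j%:~R / n%:~R) = z%:~R :> K.
  apply: contrapT => hz; have := @det_line_ne0 (n%:~R - 1 - j%:~R / n%:~R * 2) (- (j%:~R / n%:~R)).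
  rewrite -/(line n j) hD eqxx => h; suff : false by [].
  by apply: h => z; apply/eqP => e; apply: hz; exists z.
have nK : n%:~R != 0 :> K by rewrite intr_eq0.
have ej : j = - n * r0.
  apply: (@intr_inj K); rewrite rmorphM rmorphN /= -hr0; by field.
exists n, r0; split => //.
- rewrite -ej; case/allpairsP: hnj => -[s i] [_ _ [_ ->]] /=; lia.
- case/allpairsP: hnj => -[s i] [hs hi [en eji]].
  move: hs en eji; rewrite mem_iota add0n ltnS => /= hs en eji.
  have -> : n - 2 * n * r0 = n + 2 * j by rewrite ej; ring.
  by rewrite en eji; lia.
by rewrite hM /line hornerD hornerC hornerZ hornerX -hr0; ring.
Qed.
End Basis.
End Resonance.

(** * Solving equations with the form *)

Section SingularVector.
Variables (K : numClosedFieldType) (V : lmodType K) (D : verma_data V).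
Implicit Types (p : K * K) (x y : letter) (w : word) (u : V) (g : int * int).
Notation op := (op D).
Notation wvec := (wvec D).
Notation form := (form D).
Notation in_span := (in_span D).
Notation wspace := (wspace D).
Notation weight_basis := (weight_basis D).

(** No line n (M + 1) + p2 (k + 2) = n^2 with p2 = - n z that comes from a degree
    with p1 + p2 < B passes through p. *)
Definition nonres_below (B : int) p : Prop := p.2 + 2 != 0 /\
  forall n z : int, n != 0 -> 0 <= - n * z -> 0 <= n - 2 * n * z < B ->
    p.1 + 1 != n%:~R + z%:~R * (p.2 + 2).

Lemma gram_det_ne0 B p g m (t : 'I_m -> word) : weight_basis g t ->
  nonres_below B p -> g.1 + g.2 < B -> \det (gram_mx D t p) != 0.
Proof.
move=> ht [hk hl] hg; apply/negP => /eqP /(degenerate_resonant ht hk).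
case=> n [z [n0 h2 /andP[h1 h3] e]].
have : p.1 + 1 != n%:~R + z%:~R * (p.2 + 2).
  by apply: hl => //; rewrite h1 (le_lt_trans h3).
by rewrite e eqxx.
Qed.

Lemma kernel_low B p g u : nonres_below B p -> g.1 + g.2 < B -> wspace g u ->
  (forall u', form p u u' = 0) -> u = 0.
Proof.
move=> hp hg hu ku; have [m [t ht]] := weight_basis_ex D g.
exact: (basis_nondeg ht (gram_det_ne0 ht hp hg) hu).
Qed.

Lemma homogeneous_split u : exists (gs : seq (int * int)) (us : int * int -> V),
  [/\ uniq gs, forall g, wspace g (us g) & u = \sum_(g <- gs) us g].
Proof.
elim: (in_span_all D u) => [|c w t nw _ [gs [us [hgs hus ->]]]].
  by exists [::], (fun=> 0); split => // [g|]; [exact: in_span0 | rewrite big_nil].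
exists (undup (wweight w :: gs)).
exists (fun g => (if g == wweight w then c *: wvec w else 0) + (if g \in gs then us g else 0)).
split; first exact: undup_uniq.
  move=> g; apply: in_span_add.
    by case: eqP => [->|_]; [apply: in_span_scale; exact: wspace_wvec | exact: in_span0].
  by case: ifP => _; [exact: hus | exact: in_span0].
rewrite big_split /=; congr (_ + _).
  have hm : wweight w \in undup (wweight w :: gs) by rewrite mem_undup mem_head.
  rewrite (bigD1_seq (wweight w) hm (undup_uniq _)) eqxx.
  by rewrite big1 /= ?addr0 // => g /negPf ->.
have -> : \sum_(g <- undup (wweight w :: gs)) (if g \in gs then us g else 0) =
    \sum_(g <- [seq g <- undup (wweight w :: gs) | g \in gs]) us g.
  by rewrite big_filter [RHS]big_mkcond.
apply: perm_big; apply: uniq_perm => //.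
  by rewrite filter_uniq ?undup_uniq.
by move=> g; rewrite mem_filter mem_undup in_cons; case: (g \in gs); rewrite ?orbT.
Qed.

Lemma nondegenerate p u : (forall B, nonres_below B p) ->
  (forall u', form p u u' = 0) -> u = 0.
Proof.
move=> hp ku; have [gs [us [hgs hus eu]]] := homogeneous_split u.
rewrite eu big_seq big1 // => g hg.
apply: (kernel_low (hp (g.1 + g.2 + 1)) _ (hus g)); first by rewrite ltrDl.
have [m [t ht]] := weight_basis_ex D g.
apply: (orth_ext (hus g)) => u' hu'; rewrite -(ku u') eu.
have h : forall r : seq (int * int), form p (\sum_(h <- r) us h) u' = \sum_(h <- r) form p (us h) u'.
  elim=> [|h r IH]; first by rewrite !big_nil form0l.
  by rewrite !big_cons formDl IH.
rewrite h (bigD1_seq g) //= big1 ?addr0 // => h' nh.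
exact: form_orth (hus h') hu' nh.
Qed.

(** Rational families of vectors that are regular at [p0]. *)
Definition ratvec p0 (X : K * K -> V) : Prop :=
  exists (n : nat) (u : 'I_n -> V) (N Q : 'I_n -> {poly {poly K}}),
    (forall i, (Q i).[p0.1, p0.2] != 0) /\
    forall p, X p = \sum_i ((N i).[p.1, p.2] / (Q i).[p.1, p.2]) *: u i.

Lemma ratvec_cst p0 u : ratvec p0 (fun=> u).
Proof.
exists 1%N, (fun=> u), (fun=> 1), (fun=> 1); split => [i|p].
  by rewrite !hornerC oner_neq0.
by rewrite big_ord1 !hornerC divr1 scale1r.
Qed.

Lemma ratvec_add p0 X Y : ratvec p0 X -> ratvec p0 Y -> ratvec p0 (fun p => X p + Y p).
Proof.
move=> [n [u [N [Q [hQ hX]]]]] [n' [u' [N' [Q' [hQ' hY]]]]].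
pose c (T : Type) (f : 'I_n -> T) (f' : 'I_n' -> T) (i : 'I_(n + n')) : T :=
  match fintype.split i with inl j => f j | inr j => f' j end.
exists (n + n')%N, (c _ u u'), (c _ N N'), (c _ Q Q'); split => [i|p].
  by rewrite /c; case: fintype.split.
rewrite hX hY big_split_ord /=; congr (_ + _); apply: eq_bigr => i _; rewrite /c.
  by rewrite -[lshift _ _]/(unsplit (inl i)) unsplitK.
by rewrite -[rshift _ _]/(unsplit (inr i)) unsplitK.
Qed.

Lemma ratvec_lin p0 X (f : V -> V) : (forall s a b, f (s *: a + b) = s *: f a + f b) ->
  ratvec p0 X -> ratvec p0 (fun p => f (X p)).
Proof.
move=> hf [n [u [N [Q [hQ hX]]]]]; exists n, (fun i => f (u i)), N, Q; split=> // p.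
have f0 : f 0 = 0 by have := hf (-1) 0 0; rewrite scaler0 addr0 scaleN1r addNr.
rewrite hX; elim: (index_enum _) => [|i r IH]; first by rewrite !big_nil.
by rewrite !big_cons hf IH.
Qed.

Lemma ratvec_sum p0 n (X : 'I_n -> K * K -> V) : (forall i, ratvec p0 (X i)) ->
  ratvec p0 (fun p => \sum_i X i p).
Proof.
move=> hX; elim: (index_enum _) => [|i r IH].
  have := ratvec_cst p0 0; congr ratvec; apply/funext => p; by rewrite big_nil.
have := ratvec_add (hX i) IH; congr ratvec; apply/funext => p; by rewrite big_cons.
Qed.

Section Solve.
Variables (g : int * int) (m : nat) (t : 'I_m -> word) (psi : V -> K).
Hypothesis ht : weight_basis g t.
Hypothesis psi_lin : forall s a b, psi (s *: a + b) = s * psi a + psi b.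

(** Cramer's rule for the preimage of [psi] under the form. The adjugate and the
    determinant of the Gram matrix are polynomials in p. *)
Definition solve p : V := \sum_i
  (((\row_j psi (wvec (t j))) *m \adj (gram_mx D t p)) 0 i / \det (gram_mx D t p)) *: wvec (t i).

Lemma solve_wspace p : wspace g (solve p).
Proof.
rewrite /solve; elim: (index_enum _) => [|i r IH]; first by rewrite big_nil; exact: in_span0.
by rewrite big_cons; apply: in_span_lin => //; exact: (basis_wspace ht).
Qed.

Lemma solveE p z : \det (gram_mx D t p) != 0 -> wspace g z -> form p (solve p) z = psi z.
Proof.
move=> hd hz; set r := \row_j psi (wvec (t j)).
have hb j : form p (solve p) (wvec (t j)) = psi (wvec (t j)).
  have -> : solve p = \sum_i ((\det (gram_mx D t p))^-1 *: (r *m \adj (gram_mx D t p))) 0 i *: wvec (t i).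
    by apply: eq_bigr => i _; rewrite [in RHS]mxE mulrC.
  rewrite form_comb -scalemxAl -mulmxA mul_adj_mx mul_mx_scalar scalerA mulVf // scale1r.
  by rewrite mxE.
have psi0 : psi 0 = 0 by have := psi_lin (-1) 0 0; rewrite scaler0 addr0 mulN1r addNr.
have [_ _ /(_ z hz) [c ->]] := ht.
rewrite form_sym; elim: (index_enum _) => [|i s IH]; first by rewrite !big_nil form0l psi0.
by rewrite !big_cons form_linear psi_lin IH form_sym hb.
Qed.

Lemma solve_rat p0 : \det (gram_mx D t p0) != 0 -> ratvec p0 solve.
Proof.
move=> hd; have nt := basis_lowering ht.
exists m, (fun i => wvec (t i)).
exists (fun i => \sum_j (psi (wvec (t j)))%:P%:P * (\adj (gram_poly_mx D t)) j i).
exists (fun=> \det (gram_poly_mx D t)); split => [i|p]; first by rewrite gram_det_eval.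
apply: eq_bigr => i _; rewrite gram_det_eval // mxE; congr (_ / _ *: _).
rewrite !horner_sum; apply: eq_bigr => j _; rewrite !hornerM !hornerC mxE.
congr (_ * _); rewrite -(gram_poly_mx_map D p nt).
have -> : map_mx (fun q : {poly {poly K}} => q.[p.1, p.2]) (gram_poly_mx D t) =
  map_mx (horner_eval p.2 \o horner_eval p.1%:P) (gram_poly_mx D t) by [].
by rewrite -map_mx_adj mxE.
Qed.
End Solve.

(** Ordered words are independent, and a dual basis vector is represented by
    the form at a generic point, which makes it vanish on the other
    components. *)
Lemma dual_functional rep w0 : is_rep rep -> all lowering w0 ->
  exists phi : V -> K, [/\ forall s a b, phi (s *: a + b) = s * phi a + phi b,
    forall g u, wspace g u -> g != wweight w0 -> phi u = 0 &
    forall w, all lowering w -> wweight w = wweight w0 -> phi (wvec (rep w)) = (perm_eq w w0)%:R].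
Proof.
move=> hr nw0; have [m [t [h1 h2 h3 h4]]] := rep_family (wweight w0) hr.
have ht : weight_basis (wweight w0) t by split => // u; exact: wspace_coords hr h3.
have [q hq] := generic_point ht.
have [i0 hi0] := h3 _ nw0 erefl.
pose r : 'rV[K]_m := \row_j (j == i0)%:R.
pose c := r *m invmx (gram_mx D t q).
exists (fun u => form q (\sum_i c 0 i *: wvec (t i)) u); split.
- by move=> s a b; rewrite form_linear_r.
- move=> g u hu hg; rewrite form_sym; apply: (form_orth _ hu _ hg).
  elim: (index_enum _) => [|i s IH]; first by rewrite big_nil; exact: in_span0.
  by rewrite big_cons; apply: in_span_lin => //; exact: (basis_wspace ht).
move=> w nw dw; have [i hi] := h3 _ nw dw; rewrite -hi form_comb /c mulmxKV; last first.
  by rewrite unitmxE unitfE.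
rewrite mxE; congr ((nat_of_bool _)%:R); case: hr => r1 r2.
have -> : perm_eq w w0 = perm_eq (t i) (t i0).
  by rewrite hi hi0 (permPl (r1 w)) (permPr (r1 w0)).
by apply/eqP/idP => [-> //|/h2].
Qed.
End SingularVector.

(** * The family X *)

Section MainVector.
Variables (K : numClosedFieldType) (V : lmodType K) (D : verma_data V).
Implicit Types (p : K * K) (x y : letter) (w : word) (u : V) (g : int * int).
Notation op := (op D).
Notation wvec := (wvec D).
Notation form := (form D).
Notation in_span := (in_span D).
Notation wspace := (wspace D).

Lemma wvec_block a w w' r : perm_eq w w' ->
  all (fun x => lowering x && (x.1 == a)) w -> wvec (w ++ r) = wvec (w' ++ r).
Proof.
have hc x y u : lowering x && (x.1 == a) -> lowering y && (y.1 == a) ->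
    op 0 x (op 0 y u) = op 0 y (op 0 x u).
  move=> /andP[nx /eqP ex] /andP[ny /eqP ey].
  rewrite op_lowering_comm // ex ey (_ : br_coef a a = 0) ?scale0r ?addr0 //.
  by case: (a) => [[]|].
elim: w w' => [|x w IH] w' h.
  by have := perm_size h; case: w' h.
move=> /= /andP[hx hw].
have xw : x \in w' by rewrite -(perm_mem h) mem_head.
case/splitPr: xw h => c d h.
have hcd : perm_eq w (c ++ d).
  by rewrite -(perm_cons x) (perm_trans h) // -cat1s perm_catCA.
rewrite (IH _ hcd hw) -!catA /=.
have : all (fun x => lowering x && (x.1 == a)) c.
  by move: hw; rewrite (perm_all _ hcd) all_cat => /andP[].
elim: c {h hcd} => [|y c IHc] //= /andP[hy /IHc <-]; exact: hc.
Qed.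

Lemma sort_gen_lowering a w : all lowering w -> all (fun x => lowering x && (x.1 == a)) (sort_gen a w).
Proof.
move=> nw; rewrite (perm_all _ (sort_gen_perm a w)); apply/allP => x.
by rewrite mem_filter => /andP[-> /(allP nw) ->].
Qed.

Lemma wvec_rep_cons a b c x w : b != a -> c != a -> x.1 = a -> lowering x -> all lowering w ->
  wvec (x :: sorted_word a b c w) = wvec (sorted_word a b c (x :: w)).
Proof.
move=> ba ca xa nx nw; rewrite /sorted_word (@sort_gen_cons_other b) ?xa 1?eq_sym // (@sort_gen_cons_other c) ?xa 1?eq_sym //.
rewrite -cat_cons; apply: (@wvec_block a); last by rewrite /= nx xa eqxx sort_gen_lowering.
rewrite perm_sym (perm_trans (sort_gen_perm _ _)) //= xa eqxx perm_cons perm_sym.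
exact: sort_gen_perm.
Qed.

Section FirstLetter.
Variables (a b c : gen) (w0 : word) (phi : V -> K).
Hypotheses (ba : b != a) (ca : c != a) (nw0 : all lowering w0).
Hypothesis hr : is_rep (sorted_word a b c).
Hypothesis phi_lin : forall s u v, phi (s *: u + v) = s * phi u + phi v.
Hypothesis phi_wt : forall g u, wspace g u -> g != wweight w0 -> phi u = 0.
Hypothesis phi_rep : forall w, all lowering w -> wweight w = wweight w0 ->
  phi (wvec (sorted_word a b c w)) = (perm_eq w w0)%:R.

Lemma functional0 : phi 0 = 0.
Proof. by have := phi_lin (-1) 0 0; rewrite scaler0 addr0 mulN1r addNr. Qed.

Lemma functional_sorted_word w : all lowering w -> phi (wvec (sorted_word a b c w)) = (perm_eq w w0)%:R.
Proof.
move=> nw; have [e|ne] := eqVneq (wweight w) (wweight w0); first exact: phi_rep.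
have r1 := hr.1 w; rewrite (@phi_wt (wweight (sorted_word a b c w))).
- case E : (perm_eq w w0) => //; by rewrite (wweight_perm E) eqxx in ne.
- by apply: wspace_wvec; rewrite (perm_all _ r1).
- by rewrite (wweight_perm r1).
Qed.

(** Putting a letter of the leftmost type in front of an ordered word gives an
    ordered word. *)
Lemma functional_first_letter x g u : x.1 = a -> lowering x -> x \notin w0 -> wspace g u ->
  phi (op 0 x u) = 0.
Proof.
move=> xa nx xw0 /(wspace_reps hr); elim/in_span_rect => [|s y z hy hz|_ [w [nw _ ->]]].
- by rewrite op0 functional0.
- by rewrite op_linear phi_lin hy hz mulr0 addr0.
rewrite -[op 0 x _]/(wvec (x :: sorted_word a b c w)) wvec_rep_cons // functional_sorted_word /= ?nx //.
case E : perm_eq => //; move: xw0; rewrite -(perm_mem E) mem_head //.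
Qed.
End FirstLetter.

Lemma wweightF (b : nat) : wweight [:: (gf, - b%:Z)] = (b.+1%:Z, b%:Z).
Proof. by rewrite /wweight big_seq1; apply/eqP; rewrite xpair_eqE /=; lia. Qed.

(** The dual basis vector for the order f, h, e of the factors. *)
Lemma functional_F (b : nat) : exists phi : V -> K,
  [/\ forall s u v, phi (s *: u + v) = s * phi u + phi v,
      forall g u, wspace g u -> g != (b.+1%:Z, b%:Z) -> phi u = 0,
      forall (j : nat) g u, wspace g u -> j != b -> phi (op 0 (gf, - j%:Z) u) = 0 &
      phi (op 0 (gf, - b%:Z) (vac D)) = 1].
Proof.
pose w0 : word := [:: (gf, - b%:Z)].
have nw0 : all lowering w0 by rewrite /= /lowering /=; lia.
have [phi [h1 h2 h3]] := dual_functional D FHE_rep nw0.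
exists phi; split => //; first by rewrite -wweightF.
  move=> j g u hu jb; apply: (functional_first_letter (a := gf) _ _ FHE_rep h1 h2 h3 _ _ _ hu) => //.
    by rewrite /lowering /=; lia.
  by rewrite inE xpair_eqE /=; lia.
have := functional_sorted_word FHE_rep h2 h3 nw0; rewrite perm_refl => h.
by rewrite -[RHS]h /sorted_word /sort_gen /=.
Qed.

(** The dual basis vector for the order e, h, f: it kills the images of e/T^n and
    h/T^n. An h/T^n in front of an ordered word either meets no e, or can be
    exchanged with the first e at the cost of another e. *)
Lemma functional_EH (b : nat) : exists phi : V -> K,
  [/\ forall s u v, phi (s *: u + v) = s * phi u + phi v,
      forall (j : nat) g u, wspace g u -> phi (op 0 (ge, - j.+1%:Z) u) = 0,
      forall (j : nat) g u, wspace g u -> phi (op 0 (gh, - j.+1%:Z) u) = 0 &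
      phi (op 0 (gf, - b%:Z) (vac D)) = 1].
Proof.
pose w0 : word := [:: (gf, - b%:Z)].
have nw0 : all lowering w0 by rewrite /= /lowering /=; lia.
have [phi [h1 h2 h3]] := dual_functional D EHF_rep nw0.
have hE x g u : x.1 = ge -> lowering x -> wspace g u -> phi (op 0 x u) = 0.
  move=> xe nx hu; apply: (functional_first_letter (a := ge) _ _ EHF_rep h1 h2 h3 _ _ _ hu) => //.
  by rewrite inE [x]surjective_pairing xpair_eqE xe.
exists phi; split => //.
- by move=> j g u; apply: hE.
- move=> j g u /(wspace_reps EHF_rep); elim/in_span_rect => [|s y z hy hz|_ [w [nw _ ->]]].
  + by rewrite op0 (functional0 h1).
  + by rewrite op_linear h1 hy hz mulr0 addr0.
  set x := (gh, _); have nx : lowering x by [].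
  case E : (sort_gen ge w) => [|y r].
    have -> : op 0 x (wvec (sorted_word ge gh gf w)) = wvec (sorted_word ge gh gf (x :: w)).
      rewrite /sorted_word E (@sort_gen_cons_other ge) // E (@sort_gen_cons_other gf) // cat0s.
      rewrite -[LHS]/(wvec ((x :: sort_gen gh w) ++ sort_gen gf w)).
      apply: (@wvec_block gh); last by rewrite /= sort_gen_lowering.
      rewrite perm_sym (perm_trans (sort_gen_perm _ _)) //= perm_cons perm_sym.
      exact: sort_gen_perm.
    rewrite (functional_sorted_word EHF_rep h2 h3) /= ?nw //.
    case P : perm_eq => //; have := perm_mem P x; by rewrite mem_head inE xpair_eqE.
  have := sort_gen_lowering ge nw; rewrite E /= => /andP[/andP[ny /eqP ey] nr].
  have -> : wvec (sorted_word ge gh gf w) = op 0 y (wvec (r ++ sort_gen gh w ++ sort_gen gf w)).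
    by rewrite /sorted_word E.
  have nr' : all lowering (r ++ sort_gen gh w ++ sort_gen gf w).
    by have := perm_all lowering (EHF_rep.1 w); rewrite nw /sorted_word E /= => /andP[].
  rewrite op_lowering_comm // addrC h1 ey /= (hE (ge, _) _ _ _ _ (wspace_wvec D nr')) //; last first.
    by move: ny; rewrite [y]surjective_pairing ey /lowering /=; lia.
  by rewrite mulr0 add0r (hE _ _ _ ey ny (op_wspace 0 x (wspace_wvec D nr'))).
have := functional_sorted_word EHF_rep h2 h3 nw0; rewrite perm_refl => h.
by rewrite -[RHS]h /sorted_word /sort_gen /=.
Qed.

Lemma solution_family g (psi : V -> K) :
  (forall s u v, psi (s *: u + v) = s * psi u + psi v) ->
  exists x : K * K -> V, (forall p, wspace g (x p)) /\
    forall B p, nonres_below B p -> g.1 + g.2 < B ->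
      ratvec p x /\ forall z, wspace g z -> form p (x p) z = psi z.
Proof.
move=> hpsi; have [m [t ht]] := weight_basis_ex D g.
exists (solve D t psi); split; first exact: solve_wspace.
move=> B p hp hg; have hd := gram_det_ne0 ht hp hg; split; first exact: (solve_rat psi ht hd).
by move=> z hz; exact: (solveE ht hpsi hd hz).
Qed.

(** The identity of the introductory comment, with [xH] and [xE] for x_n and y_n. Only
    degrees of height less than 2 b + 1, the height of (b+1, b), enter. *)
Theorem X_family (b : nat) : exists (phi : V -> K) (X : K * K -> V),
  [/\ forall s u v, phi (s *: u + v) = s * phi u + phi v,
      forall g u, wspace g u -> g != (b.+1%:Z, b%:Z) -> phi u = 0,
      forall (j : nat) g u, wspace g u -> j != b -> phi (op 0 (gf, - j%:Z) u) = 0,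
      phi (op 0 (gf, - b%:Z) (vac D)) = 1 &
      forall p, nonres_below (2 * b%:Z + 1) p ->
       [/\ ratvec p X, wspace (b.+1%:Z, b%:Z) (X p), X p != 0 &
           forall z, form p (X p) z = (p.1 + b%:R * (p.2 + 2)) * phi z]].
Proof.
have [phi [h1 h2 h3 h4]] := functional_F b.
pose gb := (b.+1%:Z, b%:Z).
have phi_ap x s u v : phi (op 0 x (s *: u + v)) = s * phi (op 0 x u) + phi (op 0 x v).
  by rewrite op_linear h1.
pose lH (i : nat) : letter := (gh, - i.+1%:Z).
pose lE (i : nat) : letter := (ge, - i.+1%:Z).
have [xH hH] := choice (fun i : 'I_b => solution_family (gb - lweight (lH i)) (phi_ap (lH i))).
have [xE hE] := choice (fun i : 'I_b => solution_family (gb - lweight (lE i)) (phi_ap (lE i))).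
pose X p := op 0 (gf, - b%:Z) (vac D) +
  \sum_(i < b) (2^-1 *: op 0 (lH i) (xH i p) + op 0 (lE i) (xE i p)).
have wH (i : 'I_b) p : wspace gb (op 0 (lH i) (xH i p)).
  by have := op_wspace 0 (lH i) ((hH i).1 p); rewrite subrK.
have wE (i : 'I_b) p : wspace gb (op 0 (lE i) (xE i p)).
  by have := op_wspace 0 (lE i) ((hE i).1 p); rewrite subrK.
have wF : wspace gb (op 0 (gf, - b%:Z) (vac D)).
  rewrite /gb -wweightF; apply: (@wspace_wvec _ _ D [:: (gf, - b%:Z)]).
  by rewrite /= /lowering /=; lia.
have wX p : wspace gb (X p).
  apply: in_span_add => //; elim: (index_enum _) => [|i r IH]; first by rewrite big_nil; exact: in_span0.
  by rewrite big_cons; apply: in_span_add IH; exact: in_span_lin (wH i p) (wE i p).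
exists phi, X; split => // p hp.
have he (y : int * int) : (gb - y).1 + (gb - y).2 = 2 * b%:Z + 1 - (y.1 + y.2).
  rewrite -[(gb - y).1]/(b.+1%:Z - y.1) -[(gb - y).2]/(b%:Z - y.2); lia.
have gH (i : 'I_b) : (gb - lweight (lH i)).1 + (gb - lweight (lH i)).2 < 2 * b%:Z + 1.
  by rewrite he /lH /lweight /=; lia.
have gE (i : 'I_b) : (gb - lweight (lE i)).1 + (gb - lweight (lE i)).2 < 2 * b%:Z + 1.
  by rewrite he /lE /lweight /=; lia.
split => //.
- apply: ratvec_add; first exact: ratvec_cst.
  apply: ratvec_sum => i; apply: ratvec_add.
    apply: (ratvec_lin (f := fun u => 2^-1 *: op 0 (lH i) u)).
      by move=> s u v; rewrite op_linear scalerDr !scalerA mulrC.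
    exact: ((hH i).2 _ _ hp (gH i)).1.
  by apply: (ratvec_lin (f := op 0 (lE i)) (op_linear D 0 _)); exact: ((hE i).2 _ _ hp (gE i)).1.
(* psi takes the value 1 on the first term of X and kills the others. *)
- have [psi [q1 q2 q3 q4]] := functional_EH b.
  have q0 : psi 0 = 0 by have := q1 (-1) 0 0; rewrite scaler0 addr0 mulN1r addNr.
  have : psi (X p) = 1.
    have -> : X p = 1 *: op 0 (gf, - b%:Z) (vac D) +
        \sum_(i < b) (2^-1 *: op 0 (lH i) (xH i p) + op 0 (lE i) (xE i p)) by rewrite scale1r.
    rewrite q1 q4 mulr1; elim: (index_enum _) => [|i r IH].
      by rewrite big_nil q0 addr0.
    rewrite big_cons -addrA q1 (q3 i _ _ ((hH i).1 p)) mulr0 add0r.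
    by rewrite -[op 0 (lE i) _]scale1r q1 (q2 i _ _ ((hE i).1 p)) mulr0 add0r.
  by move=> e; apply: contra_eq_neq e => ->; rewrite q0 eq_sym oner_neq0.
have functional0 : phi 0 = 0 by have := h1 (-1) 0 0; rewrite scaler0 addr0 mulN1r addNr.
have phiD u v : phi (u + v) = phi u + phi v by have := h1 1 u v; rewrite scale1r mul1r.
have phiZ s u : phi (s *: u) = s * phi u by have := h1 s u 0; rewrite functional0 !addr0.
suff main : forall z, wspace gb z -> form p (X p) z = (p.1 + b%:R * (p.2 + 2)) * phi z.
  move=> z; elim/in_span_rect: (in_span_all D z) => [|s u u' hu hu'|w nw].
  - by rewrite form_sym form0l functional0 mulr0.
  - by rewrite form_linear_r hu hu' h1; ring.
  have [e|ne] := eqVneq (wweight w) gb; first by apply: main; rewrite -e; exact: wspace_wvec.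
  by rewrite (h2 _ _ (wspace_wvec D nw) ne) mulr0 (form_orth p (wX p) (wspace_wvec D nw)) // eq_sym.
move=> z hz.
have phiF (j : nat) : phi (op p (gf, - j%:Z) (op p (ge, j%:Z) z)) =
    (j == b)%:R * form p (op 0 (gf, - b%:Z) (vac D)) z.
  have nj : lowering (gf, - j%:Z) by rewrite /lowering /=; lia.
  have nb : lowering (gf, - b%:Z) by rewrite /lowering /=; lia.
  have hjz := op_wspace p (ge, j%:Z) hz.
  rewrite (op_indep D p) //; case: eqP => [ej|/eqP jb]; last by rewrite (h3 _ _ _ hjz) ?mul0r.
  rewrite ej in hjz *; rewrite mul1r -(op_indep D p (vac D)) // form_adj // /transpose /= opprK.
  have : wspace 0 (op p (ge, b%:Z) z).
    by move: hjz; congr wspace; rewrite /gb; apply/eqP; rewrite xpair_eqE /=; lia.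
  case/wspace0 => s ->; rewrite opZ phiZ h4 mulr1 form_sym formZl.
  by rewrite form_vac mulr1.
have hc := casimirE p (N := b) hz (lexx _).
have : phi (casimir D p b z) = 2 * ((p.1 + b%:R * (p.2 + 2)) * phi z).
  rewrite hc phiZ mulrA; congr (_ * _); rewrite /casimir_value /gb /=.
  have -> : b.+1%:Z - b%:Z = 1 by lia.
  by rewrite -[(b%:Z)%:~R]/(b%:R); ring.
have phi_sum n (f : 'I_n -> V) : phi (\sum_i f i) = \sum_i phi (f i).
  exact: (big_morph phi phiD functional0).
rewrite /casimir phiD phi_sum phiZ (phiF 0).
set c := form p (op 0 _ _) z.
have -> : \sum_(i < b) phi (2 *: op p (gf, - i.+1%:Z) (op p (ge, i.+1%:Z) z) +
     2 *: op p (ge, - i.+1%:Z) (op p (gf, i.+1%:Z) z) +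
     op p (gh, - i.+1%:Z) (op p (gh, i.+1%:Z) z)) =
   2 * (\sum_(i < b) (i.+1 == b)%:R * c +
        \sum_(i < b) form p (2^-1 *: op 0 (lH i) (xH i p) + op 0 (lE i) (xE i p)) z).
  rewrite -big_split mulr_sumr; apply: eq_bigr => i _ /=.
  rewrite !phiD !phiZ phiF form_linear.
  have nH : lowering (lH i) by [].
  have nE : lowering (lE i) by [].
  have zH : wspace (gb - lweight (lH i)) (op p (gh, i.+1%:Z) z).
    by have := op_wspace p (gh, i.+1%:Z) hz; congr wspace; congr (_ + _); rewrite -lweight_transpose /transpose /= opprK.
  have zE : wspace (gb - lweight (lE i)) (op p (gf, i.+1%:Z) z).
    by have := op_wspace p (gf, i.+1%:Z) hz; congr wspace; congr (_ + _); rewrite -lweight_transpose /transpose /= opprK.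
  rewrite -(op_indep D p (xH i p) nH) -(op_indep D p (xE i p) nE) !form_adj // /transpose /= !opprK.
  rewrite ((hH i).2 _ _ hp (gH i)).2 // ((hE i).2 _ _ hp (gE i)).2 //.
  by rewrite (op_indep D p _ nH) (op_indep D p _ nE) -/c; field.
have -> : form p (X p) z = c +
   \sum_(i < b) form p (2^-1 *: op 0 (lH i) (xH i p) + op 0 (lE i) (xE i p)) z.
  rewrite /X formDl; congr (_ + _); elim: (index_enum _) => [|i r IH].
    by rewrite !big_nil form0l.
  by rewrite !big_cons formDl IH.
set s := \sum_(i < b) form p _ z.
have -> : \sum_(i < b) (i.+1 == b)%:R * c = (if b is 0%N then 0 else c).
  case: (b) => [|n]; first by rewrite big_ord0.
  rewrite big_ord_recr /= eqxx mul1r big1 ?add0r // => i _.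
  by rewrite eqSS ltn_eqF // mul0r.
move=> e; apply: (@mulfI _ 2); rewrite ?pnatr_eq0 // -e mulrDr mulrDr -addrA [_ * s + _]addrC addrA.
congr (_ + _); case: (b) => [|n] /=; by rewrite ?mul1r ?mul0r mulr0 ?addr0 ?add0r.
Qed.
End MainVector.

(** * The operators of an affine module *)

Section GeneratorMatrices.
Variable K : fieldType.

Definition gen_matrix (a : gen) : 'M[K]_2 :=
  match a with ge => sl2_e K | gf => sl2_f K | gh => sl2_h K end.

Lemma tr_gen_matrix a : \tr (gen_matrix a) = 0.
Proof.
by case: a => [[]|]; rewrite /mxtrace !big_ord_recl big_ord0 !mxE /=; ring.
Qed.

Lemma ord2P (P : 'I_2 -> Prop) : P ord0 -> P (lift ord0 ord0) -> forall i, P i.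
Proof.
move=> h0 h1 [[|[|//]] hi].
  by rewrite (_ : Ordinal hi = ord0) //; apply: val_inj.
by rewrite (_ : Ordinal hi = lift ord0 ord0) //; apply: val_inj.
Qed.

Lemma gen_matrix_bracket a b :
  gen_matrix a *m gen_matrix b - gen_matrix b *m gen_matrix a = (br_coef a b)%:~R *: gen_matrix (br_gen a b).
Proof.
apply/matrixP; apply: ord2P; apply: ord2P;
 by case: a b => [[]|] [[]|]; rewrite !mxE !big_ord_recl !big_ord0 !mxE /=; ring.
Qed.

Lemma tr_gen_matrix_mul a b : \tr (gen_matrix a *m gen_matrix b) = (trace_form a b)%:~R.
Proof.
by case: a b => [[]|] [[]|];
  rewrite /mxtrace !big_ord_recl big_ord0 !mxE !big_ord_recl !big_ord0 !mxE /=; ring.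
Qed.

(** The summand 0 gives the right-hand side the shape to which the linearity of
    the action applies. *)
Lemma gen_matrix_decomp (a : 'M[K]_2) : \tr a = 0 ->
  a = a 0 1 *: gen_matrix ge + (a 1 0 *: gen_matrix gf + (a 0 0 *: gen_matrix gh + 0)).
Proof.
rewrite /mxtrace !big_ord_recl big_ord0 addr0 => h.
have e1 : a (lift ord0 ord0) (lift ord0 ord0) = - a 0 0.
  by apply/eqP; rewrite -addr_eq0 addrC; apply/eqP.
have i1 : lift ord0 ord0 = 1 :> 'I_2 by apply: val_inj.
by apply/matrixP; apply: ord2P; apply: ord2P; rewrite !mxE /= ?e1 ?i1; ring.
Qed.
End GeneratorMatrices.

Section FromAffineModule.
Variables (K : numClosedFieldType) (V : lmodType K) (v : V).
Variables (A : K * K -> affine_module V) (hA : verma_family A v).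
Variables (S : K * K -> V -> V -> K).
Hypothesis hS : forall p, is_shapovalov (A p) v (S p).

Definition affine_op (p : K * K) (a : gen) (n : int) : V -> V := act (A p) (gen_matrix K a) n.

Lemma weight_of_vac p : highest_weight (A p) p.1 p.2 v. Proof. by case: (hA.1 p). Qed.

Lemma affine_op_lin p a n s x y : affine_op p a n (s *: x + y) = s *: affine_op p a n x + affine_op p a n y.
Proof. by rewrite /affine_op linearP. Qed.

Lemma affine_op0 p a n : affine_op p a n 0 = 0. Proof. by rewrite /affine_op linear0. Qed.

Lemma act0 p n x : act (A p) 0 n x = 0.
Proof.
have := act_linear (A p) (-1) n x (mxtrace0 K 2) (mxtrace0 K 2).
by rewrite scaler0 addr0 scaleN1r addNr.
Qed.

Lemma actZ p s (a : 'M[K]_2) n x : \tr a = 0 -> act (A p) (s *: a) n x = s *: act (A p) a n x.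
Proof.
by move=> h; have := act_linear (A p) s n x h (mxtrace0 K 2); rewrite !addr0 act0 addr0.
Qed.

Lemma affine_op_comm p a b m n x : affine_op p a m (affine_op p b n x) = affine_op p b n (affine_op p a m x) +
  (br_coef a b)%:~R *: affine_op p (br_gen a b) (m + n) x +
  (if m + n == 0 then m%:~R * (trace_form a b)%:~R * p.2 else 0) *: x.
Proof.
have := act_bracket (A p) m n x (tr_gen_matrix K a) (tr_gen_matrix K b).
rewrite gen_matrix_bracket actZ ?tr_gen_matrix // tr_gen_matrix_mul.
have [_ _ _ _ hc] := weight_of_vac p; rewrite hc => /(canRL (subrK _)) e.
rewrite /affine_op e addrC -addrA; congr (_ + (_ + _)).
by case: ifP => _; rewrite ?scalerA ?scale0r.
Qed.

Lemma dual_bracket (a b : gen) :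
  br_gen (dual_gen a) (dual_gen b) = dual_gen (br_gen a b) /\ br_coef (dual_gen a) (dual_gen b) = - br_coef a b.
Proof. by case: a b => [[]|] [[]|]. Qed.

Lemma dual_bracketC (a b : gen) :
  br_gen (dual_gen b) (dual_gen a) = dual_gen (br_gen a b) /\ br_coef (dual_gen b) (dual_gen a) = br_coef a b.
Proof. by case: a b => [[]|] [[]|]. Qed.

(** e_1 and e_2 generate the raising operators. *)
Lemma affine_op_pos p a n : lowering (transpose (a, n)) -> affine_op p a n v = 0.
Proof.
have [he1 he2 _ _ _] := weight_of_vac p.
suff h y : lowering y -> affine_op p (transpose y).1 (transpose y).2 v = 0.
  by move/h; rewrite transposeK.
move: y; apply: lowering_ind; [exact: he1|exact: he2|move=> x y nx ny nb hx hy].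
have := affine_op_comm p (transpose x).1 (transpose y).1 (transpose x).2 (transpose y).2 v.
rewrite hx hy !affine_op0 add0r /transpose /=; have [-> ->] := dual_bracket x.1 y.1.
have -> : (if - x.2 - y.2 == 0 then (- x.2)%:~R * (trace_form (dual_gen x.1) (dual_gen y.1))%:~R * p.2
   else 0) = 0 :> K.
  case: eqP => [h|//]; have hxy : x.2 + y.2 = 0 by lia.
  by have [-> ->] := lowering_central nx ny hxy; rewrite /= mulr0z mulr0 mul0r.
rewrite scale0r addr0 -opprD => /esym/eqP; rewrite scaler_eq0 intr_eq0 oppr_eq0.
by rewrite (negPf nb) => /eqP.
Qed.

Lemma affine_op_lowering_comm p x y u : lowering x -> lowering y ->
  (br_coef x.1 y.1)%:~R *: affine_op p (br_gen x.1 y.1) (x.2 + y.2) u =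
  affine_op p x.1 x.2 (affine_op p y.1 y.2 u) - affine_op p y.1 y.2 (affine_op p x.1 x.2 u).
Proof.
move=> nx ny; rewrite affine_op_comm.
have -> : (if x.2 + y.2 == 0 then x.2%:~R * (trace_form x.1 y.1)%:~R * p.2 else 0) = 0 :> K.
  case: eqP => [h|//].
  by have [-> ->] := lowering_central nx ny h; rewrite /= mulr0z mulr0 mul0r.
by rewrite scale0r addr0 addrAC subrr add0r.
Qed.

Lemma affine_op_indep p q a n x : lowering (a, n) -> affine_op p a n x = affine_op q a n x.
Proof.
suff h y : lowering y -> forall p q x, affine_op p y.1 y.2 x = affine_op q y.1 y.2 x by move/h; exact.
move: y; apply: lowering_ind => [p' q' u|p' q' u|{x} x y nx ny nb hx hy p' q' u].
- by have [_ /(_ p' q' u) []] := hA.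
- by have [_ /(_ p' q' u) []] := hA.
apply: (scalerI (_ : (br_coef x.1 y.1)%:~R != 0 :> K)); first by rewrite intr_eq0.
by rewrite !affine_op_lowering_comm // (hx p' q') (hy p' q') (hx p' q') (hy p' q').
Qed.

Lemma affine_op_gen (P : V -> Prop) :
  (forall s x y, P x -> P y -> P (s *: x + y)) ->
  (forall a n x, P x -> P (affine_op 0 a n x)) -> P v -> forall x, P x.
Proof.
move=> hl ha hv; have P0 : P 0.
  by have := hl (-1) _ _ hv hv; rewrite scaleN1r addNr.
have [_ hg _] := hA.1 0; apply: hg => // [a n x h0 hx|x hx].
  have t1 : \tr (a 0 0 *: gen_matrix K gh + 0) = 0.
    by rewrite mxtraceD mxtraceZ tr_gen_matrix mxtrace0 mulr0 addr0.
  have t2 : \tr (a 1 0 *: gen_matrix K gf + (a 0 0 *: gen_matrix K gh + 0)) = 0.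
    by rewrite mxtraceD t1 mxtraceZ tr_gen_matrix mulr0 addr0.
  rewrite (gen_matrix_decomp h0) act_linear ?tr_gen_matrix // act_linear ?tr_gen_matrix //.
  rewrite act_linear ?tr_gen_matrix ?mxtrace0 //.
  by rewrite act0; do 3 (apply: (hl); first exact: (ha)).
have [_ _ _ _ hc] := weight_of_vac 0; rewrite hc -[_ *: x]addr0; exact: hl.
Qed.

Lemma shap_sym p x y : S p x y = S p y x. Proof. by case: (hS p). Qed.
Lemma shap_lin p s x y z : S p (s *: x + y) z = s * S p x z + S p y z.
Proof. by case: (hS p). Qed.
Lemma shap_vac p : S p v v = 1. Proof. by case: (hS p). Qed.

Lemma shap_linr p s x y z : S p z (s *: x + y) = s * S p z x + S p z y.
Proof. by rewrite shap_sym shap_lin !(shap_sym p z). Qed.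
Lemma shap0 p z : S p 0 z = 0.
Proof. by have := shap_lin p (-1) 0 0 z; rewrite scaler0 addr0 mulN1r addNr. Qed.
Lemma shapB p x y z : S p (x - y) z = S p x z - S p y z.
Proof. by rewrite addrC -scaleN1r shap_lin mulN1r addrC. Qed.
Lemma shapZ p s x z : S p (s *: x) z = s * S p x z.
Proof. by have := shap_lin p s x 0 z; rewrite shap0 !addr0. Qed.

Lemma shap_adj p a n x y : lowering (a, n) ->
  S p (affine_op p a n x) y = S p x (affine_op p (dual_gen a) (- n) y).
Proof.
suff h z : lowering z -> forall x y,
    S p (affine_op p z.1 z.2 x) y = S p x (affine_op p (transpose z).1 (transpose z).2 y) by move/h; exact.
have [_ _ _ hf1 hf2] := hS p.
move: z; apply: lowering_ind; [exact: hf1|exact: hf2|move=> {x y} x y nx ny nb hx hy u z].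
have nbK : (br_coef x.1 y.1)%:~R != 0 :> K by rewrite intr_eq0.
apply: (mulfI nbK); rewrite -shapZ affine_op_lowering_comm // shapB (hx _ z) (hy u) (hy _ z) (hx u).
have := affine_op_comm p (transpose y).1 (transpose x).1 (transpose y).2 (transpose x).2 z.
rewrite /transpose /=; have [-> ->] := dual_bracketC x.1 y.1.
have -> : (if - y.2 - x.2 == 0 then (- y.2)%:~R * (trace_form (dual_gen y.1) (dual_gen x.1))%:~R * p.2
   else 0) = 0 :> K.
  case: eqP => [h|//]; have hxy : y.2 + x.2 = 0 by lia.
  by have [-> ->] := lowering_central ny nx hxy; rewrite /= mulr0z mulr0 mul0r.
move=> ->; rewrite scale0r addr0 [X in S p u X]addrC shap_linr addrK.
by rewrite opprD [- y.2 + _]addrC.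
Qed.

Definition verma_of_affine : verma_data V :=
  VermaData affine_op_lin affine_op_comm affine_op_pos (fun p => let: And5 _ _ h _ _ := weight_of_vac p in h)
    affine_op_indep affine_op_gen shap_sym shap_lin shap_vac shap_adj.
End FromAffineModule.

(** * The diagram automorphism *)

Section DiagramAutomorphism.
Variables (K : numClosedFieldType) (V : lmodType K) (D : verma_data V).

(** The highest weight with respect to the exchanged simple roots. *)
Definition swap_weight (p : K * K) : K * K := (p.2 - p.1, p.2).

(** The action composed with the diagram automorphism. *)
Definition swapped_op (p : K * K) (a : gen) (n : int) (x : V) : V :=
  match a with
  | ge => vop D (swap_weight p) gf (n + 1) x
  | gf => vop D (swap_weight p) ge (n - 1) x
  | gh => (if n == 0 then p.2 else 0) *: x - vop D (swap_weight p) gh n x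
  end.

Definition swapped_form p := vform D (swap_weight p).

Lemma swapped_op_lin p a n s x y : swapped_op p a n (s *: x + y) = s *: swapped_op p a n x + swapped_op p a n y.
Proof.
by case: a => [[]|] /=; rewrite vop_lin //; lin_solve K V.
Qed.

Lemma swapped_op_comm p a b m n x : swapped_op p a m (swapped_op p b n x) = swapped_op p b n (swapped_op p a m x) +
  (br_coef a b)%:~R *: swapped_op p (br_gen a b) (m + n) x +
  (if m + n == 0 then m%:~R * (trace_form a b)%:~R * p.2 else 0) *: x.
Proof.
have l0 q a' n' : vop D q a' n' 0 = 0.
  by have := vop_lin D q a' n' (-1) 0 0; rewrite scaler0 addr0 scaleN1r addNr.
have lB q a' n' s y z : vop D q a' n' (s *: y - z) = s *: vop D q a' n' y - vop D q a' n' z.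
  rewrite vop_lin; congr (_ + _).
  by have := vop_lin D q a' n' (-1) z 0; rewrite addr0 scaleN1r l0 addr0 scaleN1r.
have c := vop_comm D (swap_weight p).
have e1 : m + 1 + (n - 1) = m + n by lia.
have e2 : m - 1 + (n + 1) = m + n by lia.
have e3 : m + 1 + n = m + n + 1 by lia.
have e4 : m - 1 + n = m + n - 1 by lia.
have e5 : m + (n + 1) = m + n + 1 by lia.
have e6 : m + (n - 1) = m + n - 1 by lia.
case: a b => [[]|] [[]|]; rewrite /swapped_op.
- by rewrite (c gf gf) /= !mulr0z !mulr0 !mul0r !if_same !scale0r.
- rewrite (c gf ge) e1 /= mulr1; case: eqP => [h|_]; last by lin_solve K V.
  by rewrite rmorphD /=; lin_solve K V.
- by rewrite lB (c gf gh) e3 /=; rewrite !(mulr0z, mulr0, mul0r) !if_same; set d := (if _ then _ else _); lin_solve K V.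
- rewrite (c ge gf) e2 /= mulr1; case: eqP => [h|_]; last by lin_solve K V.
  by rewrite rmorphB /=; lin_solve K V.
- by rewrite (c ge ge) /= !mulr0z !mulr0 !mul0r !if_same !scale0r.
- by rewrite lB (c ge gh) e4 /=; rewrite !(mulr0z, mulr0, mul0r) !if_same; set d := (if _ then _ else _); lin_solve K V.
- by rewrite lB (c gh gf) e5 /=; rewrite !(mulr0z, mulr0, mul0r) !if_same; set d := (if _ then _ else _); lin_solve K V.
- by rewrite lB (c gh ge) e6 /=; rewrite !(mulr0z, mulr0, mul0r) !if_same; set d := (if _ then _ else _); lin_solve K V.
rewrite !lB (c gh gh) /=; set d1 := (if m == 0 then _ else _); set d2 := (if n == 0 then _ else _).
by set d3 := (if m + n == 0 then _ else _); lin_solve K V.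
Qed.

Lemma swapped_op_pos p a n : lowering (transpose (a, n)) -> swapped_op p a n (vac D) = 0.
Proof.
rewrite /lowering /transpose; case: a => [[]|] /= h.
- by apply: vop_pos; rewrite /lowering /transpose /=; lia.
- by apply: vop_pos; rewrite /lowering /transpose /=; lia.
rewrite vop_pos; last by rewrite /lowering /transpose /=; lia.
by case: eqP => [e|_]; [lia | rewrite scale0r subr0].
Qed.

Lemma swapped_op_h0 p : swapped_op p gh 0 (vac D) = p.1 *: vac D.
Proof. by rewrite /swapped_op vop_h0 /=; lin_solve K V. Qed.

Lemma swapped_op_indep p q a n x : lowering (a, n) -> swapped_op p a n x = swapped_op q a n x.
Proof.
rewrite /lowering; case: a => [[]|] /= h.
- by apply: vop_indep; rewrite /lowering /=; lia.
- by apply: vop_indep; rewrite /lowering /=; lia.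
rewrite (@vop_indep _ _ D _ (swap_weight q)); last by rewrite /lowering /=; lia.
by case: eqP => // e; lia.
Qed.

Lemma swapped_op_gen (P : V -> Prop) :
  (forall s x y, P x -> P y -> P (s *: x + y)) ->
  (forall a n x, P x -> P (swapped_op 0 a n x)) -> P (vac D) -> forall x, P x.
Proof.
move=> hl ha hv; have P0 : P 0.
  by have := hl (-1) _ _ hv hv; rewrite scaleN1r addNr.
have s0 : swap_weight 0 = 0 by rewrite /swap_weight /= subr0.
apply: (vop_gen (v := D)) => // -[[]|] n x hx.
- by have := ha gf (n + 1) x hx; rewrite /swapped_op s0 addrK.
- by have := ha ge (n - 1) x hx; rewrite /swapped_op s0 subrK.
have := hl (-1) _ _ (ha gh n x hx) P0.
by rewrite /swapped_op s0 /= if_same scale0r add0r addr0 scaleN1r opprK.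
Qed.

Lemma swapped_form_adj p a n x y : lowering (a, n) ->
  swapped_form p (swapped_op p a n x) y = swapped_form p x (swapped_op p (dual_gen a) (- n) y).
Proof.
rewrite /lowering /swapped_form; case: a => [[]|] /= h.
- by rewrite vform_adj ?opprD //; rewrite /lowering /=; lia.
- by rewrite vform_adj ?opprB 1?addrC //; rewrite /lowering /=; lia.
rewrite !ifN ?scale0r ?sub0r; [|lia|lia].
have hN u z : vform D (swap_weight p) (- u) z = - vform D (swap_weight p) u z.
  by rewrite -[- u]scaleN1r -[RHS]mulN1r; exact: formZl.
by rewrite hN vform_adj ?/lowering /= ?h // !(vform_sym _ _ x) hN.
Qed.

Definition swapped : verma_data V :=
  VermaData swapped_op_lin swapped_op_comm swapped_op_pos swapped_op_h0 swapped_op_indep swapped_op_gen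
    (fun p => vform_sym D (swap_weight p)) (fun p => vform_lin D (swap_weight p))
    (fun p => vform_vac D (swap_weight p)) swapped_form_adj.
End DiagramAutomorphism.

Local Open Scope classical_set_scope.
Local Open Scope ring_scope.
Local Open Scope complex_scope.

(** * Holomorphy of rational families *)

Section Holomorphy.
Variables (R : realType).
Notation C := R[i].
Notation C2 := (C^o * C^o)%type.

Lemma differentiable_fst (p : C2) : differentiable (fst : C2 -> C^o) p.
Proof.
pose f : {linear C2 -> C^o} := fst.
by apply: (linear_differentiable (f := f)) => x; exact: cvg_fst.
Qed.

Lemma differentiable_snd (p : C2) : differentiable (snd : C2 -> C^o) p.
Proof.
pose f : {linear C2 -> C^o} := snd.
by apply: (linear_differentiable (f := f)) => x; exact: cvg_snd.
Qed.

Lemma differentiable_horner (q : {poly C}) (f : C2 -> C^o) (p : C2) :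
  differentiable f p -> differentiable (fun x => q.[f x] : C^o) p.
Proof.
move=> hf; elim/poly_ind: q => [|q c IH].
  rewrite (_ : (fun x => _) = cst (0 : C^o)); last by apply/funext => x; rewrite horner0.
  exact: differentiable_cst.
rewrite (_ : (fun x => _) = (fun x => q.[f x] : C^o) * f + cst (c : C^o)); last first.
  by apply/funext => x; rewrite hornerMXaddC.
apply: differentiableD; last exact: differentiable_cst.
exact: differentiableM.
Qed.

Lemma differentiable_horner2 (q : {poly {poly C}}) (f g : C2 -> C^o) (p : C2) :
  differentiable f p -> differentiable g p ->
  differentiable (fun x => q.[f x, g x] : C^o) p.
Proof.
move=> hf hg; elim/poly_ind: q => [|q c IH].
  rewrite (_ : (fun x => _) = cst (0 : C^o)); last by apply/funext => x; rewrite !horner0.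
  exact: differentiable_cst.
rewrite (_ : (fun x => _) =
    (fun x => q.[f x, g x] : C^o) * f + (fun x => c.[g x] : C^o)); last first.
  by apply/funext => x; rewrite hornerMXaddC hornerD hornerM hornerC.
apply: differentiableD; last exact: differentiable_horner.
exact: differentiableM.
Qed.

(** The weight enters through differentiable functions [f], [g], so as to cover
    the weights (M, k) and (k - M, k). *)
Lemma holomorphic_ratvec (V : lmodType C) (X : C * C -> V) (f g : C2 -> C^o) (p0 : C2) :
  (forall p, differentiable f p) -> (forall p, differentiable g p) ->
  ratvec (f p0, g p0) X -> holomorphic_near (fun p => X (f p, g p)) p0.
Proof.
move=> hf hg [n [u [N [Q [hQ hX]]]]].
pose num i : C2 -> C^o := fun p => (N i).[f p, g p].
pose den i : C2 -> C^o := fun p => (Q i).[f p, g p].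
have dnum i p : differentiable (num i) p by exact: differentiable_horner2.
have dden i p : differentiable (den i) p by exact: differentiable_horner2.
exists n, u, (fun i => num i * (fun p => (den i p)^-1)).
have near0 : \forall p \near p0, forall i, den i p != 0.
  apply: (@filter_forall C2 'I_n (fun i p => den i p != 0) (nbhs p0) _) => i; apply: cvgr_neq0 (hQ i).
  exact: differentiable_continuous (dden i p0).
near=> p; split; last by rewrite hX.
have hp : forall i, den i p != 0 by near: p; exact: near0.
by move=> i; apply: differentiableM => //; exact: differentiableV.
Unshelve. all: by end_near.
Qed.
End Holomorphy.

(** * Components and ordered words *)

Section Components.
Variables (K : numClosedFieldType) (V : lmodType K) (D : verma_data V).
Notation op := (op D).
Notation wvec := (wvec D).
Notation form := (form D).
Notation in_span := (in_span D).
Notation wspace := (wspace D).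

Lemma kernel_positive (B : int) p g u y : nonres_below B p -> g.1 + g.2 <= B ->
  wspace g u -> (forall u', form p u u' = 0) -> lowering (transpose y) -> op p y u = 0.
Proof.
move=> hp hg hu ku ny; apply: (kernel_low hp _ (op_wspace p y hu)); last first.
  by move=> u'; rewrite form_adjV.
have -> : (g + lweight y).1 + (g + lweight y).2 = (g.1 + g.2) + ((lweight y).1 + (lweight y).2).
  by rewrite addrACA.
have : (lweight y).1 + (lweight y).2 < 0.
  by case: (y) ny => [[[]|] k]; rewrite /lowering /=; lia.
lia.
Qed.

(** A word in f_1 and f_2; under the diagram automorphism the two letters are
    exchanged, whence the parameter [s], the index of f. *)
Definition letter12 (s i : bool) : letter := if i == s then (gf, 0) else (ge, -1).

Lemma wweight_letter12 s w : wweight (map (letter12 s) w) =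
  ((count_mem s w)%:Z, (count_mem (~~ s) w)%:Z).
Proof.
elim: w => [|i w IH]; first by rewrite /wweight big_nil.
rewrite /= wweight_cons IH /letter12; apply/eqP; rewrite xpair_eqE /=.
by clear IH; case: i s => [] [] /=; lia.
Qed.

Lemma lowering_letter12 s w : all lowering (map (letter12 s) w).
Proof. by rewrite all_map; apply/allP => i _ /=; rewrite /letter12; case: ifP. Qed.

Definition wt12 (s : bool) (g : nat * nat) : int * int :=
  if s then (g.1%:Z, g.2%:Z) else (g.2%:Z, g.1%:Z).

Lemma count_wt12 s g w : (count_mem true w = g.1 /\ count_mem false w = g.2) <->
  wweight (map (letter12 s) w) = wt12 s g.
Proof.
rewrite wweight_letter12 /wt12; case: s => /=; split => [[-> ->] //|[h1 h2]]; split; lia.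
Qed.

Section Comp.
Variables (A : affine_module V) (s : bool).
Hypothesis fwordE : forall w, fword A (vac D) w = wvec (map (letter12 s) w).

Lemma component_wspace g x : component A (vac D) g x <-> wspace (wt12 s g) x.
Proof.
split.
  case=> n [c [w [hw ->]]]; elim: (index_enum _) => [|i r IH].
    by rewrite big_nil; exact: in_span0.
  rewrite big_cons; apply: in_span_lin => //; rewrite fwordE; apply: in_span_wvec; split.
    exact: lowering_letter12.
  by apply/count_wt12.
move/wspace_simple; elim=> [|c w u [gw dw] _ [n [cs [ws [hws ->]]]]].
  exists 0%N, (fun=> 0), (fun=> [::]); split; first by case.
  by rewrite big_ord0.
pose bw : seq bool := [seq (x == (gf, 0)) == s | x <- w].
have ebw : map (letter12 s) bw = w.
  rewrite /bw -map_comp -[RHS]map_id; apply/eq_in_map => y /(allP gw) /=.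
  by rewrite /letter12 => /orP[] /eqP -> /=; case: (s).
exists n.+1, (fun i => oapp cs c (unlift ord0 i)), (fun i => oapp ws bw (unlift ord0 i)).
split; last first.
  rewrite big_ord_recl unlift_none /= fwordE ebw; congr (_ + _).
  by apply: eq_bigr => i _; rewrite liftK.
move=> i; case: unliftP => [j|] _ /=; first exact: hws.
by apply/(count_wt12 s); rewrite ebw.
Qed.
End Comp.

Lemma wweight1_ge0 w : all lowering w -> 0 <= (wweight w).1.
Proof.
elim: w => [|y w IH]; first by rewrite /wweight big_nil.
move=> /= /andP[ny /IH h]; rewrite wweight_cons.
rewrite -[(lweight y + wweight w).1]/((lweight y).1 + (wweight w).1).
by case: (y) ny => [[[]|] n]; rewrite /lowering /=; lia.
Qed.

(** With shifted exponents of h and e every triple of lists of naturals is a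
    word of lowering letters. *)
Definition FHE (a h e : seq nat) : word := [seq (gf, - i%:Z) | i <- a] ++
  [seq (gh, - j.+1%:Z) | j <- h] ++ [seq (ge, - l.+1%:Z) | l <- e].

Lemma sumn_map_S s : sumn (map S s) = (sumn s + size s)%N.
Proof. by elim: s => //= x s ->; lia. Qed.

Lemma wweight_FHE a h e : wweight (FHE a h e) =
  ((sumn a + size a + sumn (map S h) + sumn e)%:Z,
   (sumn a + sumn (map S h) + sumn (map S e))%:Z).
Proof.
have d1 (x : letter) w : (wweight (x :: w)).1 = - x.2 - hweight x.1 + (wweight w).1 by rewrite wweight_cons.
have d2 (x : letter) w : (wweight (x :: w)).2 = - x.2 + (wweight w).2 by rewrite wweight_cons.
rewrite [LHS]surjective_pairing /FHE; apply/eqP; rewrite xpair_eqE !sumn_map_S; apply/andP.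
elim: a => [|i a IH]; last first.
  by move: IH; rewrite /= d1 d2 /= => -[/eqP -> /eqP ->]; split; lia.
elim: h => [|i h IH]; last first.
  by move: IH; rewrite /= d1 d2 /= => -[/eqP -> /eqP ->]; split; lia.
elim: e => [|i e IH]; last first.
  by move: IH; rewrite /= d1 d2 /= => -[/eqP -> /eqP ->]; split; lia.
by rewrite /wweight big_nil.
Qed.

Lemma sort_gen_indices a w (k : int) (f : nat -> int) :
  (forall i, f i = k - i%:Z) -> (forall x : letter, x \in w -> x.1 = a -> x.2 <= k) ->
  exists s : seq nat, sorted geq s /\ sort_gen a w = [seq (a, f i) | i <- s].
Proof.
move=> hf hk.
have : all (fun n : int => n <= k) (sort <=%O [seq x.2 | x <- w & x.1 == a]).
  rewrite all_sort; apply/allP => n /mapP[x]; rewrite mem_filter => /andP[/eqP xa xw] ->.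
  exact: hk.
rewrite /sort_gen; have := sort_sorted (@le_total _ int) [seq x.2 | x <- w & x.1 == a].
move: (sort _ _) => l hl hlk; exists [seq absz (k - n) | n <- l]; split.
  elim: l hl hlk => //= n l IH hp /andP[hn hlk].
  move: hp IH; case: l hlk => //= m l /andP[hm hlk] /andP[nm hp] /(_ hp).
  rewrite hm hlk => /(_ isT) ->; rewrite andbT /geq /=; lia.
rewrite -map_comp; apply/eq_in_map => n hn /=; rewrite hf; congr (_, _).
by have := allP hlk n hn; lia.
Qed.

Lemma sorted_word_FHE w : all lowering w -> exists a h e, [/\ sorted geq a, sorted geq h, sorted geq e &
  sorted_word gf gh ge w = FHE a h e].
Proof.
move=> nw.
have [|x hx xa|a [sa ea]] := @sort_gen_indices gf w 0 (fun i => - i%:Z).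
- by move=> i; lia.
- by have := allP nw x hx; rewrite /lowering => /orP[|/andP[_ /eqP ->]]; lia.
have [|x hx xa|h [sh eh]] := @sort_gen_indices gh w (-1) (fun i => - i.+1%:Z).
- by move=> i; lia.
- by have := allP nw x hx; rewrite /lowering xa /=; lia.
have [|x hx xa|e [se ee]] := @sort_gen_indices ge w (-1) (fun i => - i.+1%:Z).
- by move=> i; lia.
- by have := allP nw x hx; rewrite /lowering xa /=; lia.
by exists a, h, e; split => //; rewrite /sorted_word ea eh ee.
Qed.

(** Ordered words span, so a functional is determined by them. *)
Lemma functional_ext g (phi psi : V -> K) :
  (forall s u v, phi (s *: u + v) = s * phi u + phi v) ->
  (forall s u v, psi (s *: u + v) = s * psi u + psi v) ->
  (forall w, all lowering w -> wweight w != g -> phi (wvec w) = psi (wvec w)) ->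
  (forall a h e, sorted geq a -> sorted geq h -> sorted geq e -> wweight (FHE a h e) = g ->
     phi (wvec (FHE a h e)) = psi (wvec (FHE a h e))) ->
  phi = psi.
Proof.
move=> h1 h2 hg hr; apply/funext => u.
have p0 : phi 0 = 0 by have := h1 (-1) 0 0; rewrite scaler0 addr0 mulN1r addNr.
have q0 : psi 0 = 0 by have := h2 (-1) 0 0; rewrite scaler0 addr0 mulN1r addNr.
elim/in_span_rect: (in_span_all D u) => [|s x y hx hy|w nw].
- by rewrite p0 q0.
- by rewrite h1 h2 hx hy.
have [dw|dw] := eqVneq (wweight w) g; last exact: hg.
elim/in_span_rect: (wspace_reps FHE_rep (wspace_wvec D nw)) => [|s x y hx hy|_ [w' [nw' dw' ->]]].
- by rewrite p0 q0.
- by rewrite h1 h2 hx hy.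
have [a [h [e [sa sh se er]]]] := sorted_word_FHE nw'; rewrite er; apply: hr => //.
by rewrite -er (wweight_perm (FHE_rep.1 w')) dw' dw.
Qed.
End Components.

(** * The dual basis vectors *)

(* Simplification is kept from unfolding the operators of a concrete family. *)
Arguments op : simpl never.
Arguments vop : simpl never.
Arguments vac : simpl never.

Section DualVectors.
Variables (K : numClosedFieldType) (V : lmodType K).
Variables (A : K * K -> affine_module V) (D : verma_data V).
Hypothesis actD : forall p a n x, act (A p) (gen_matrix K a) n x = op D p (a, n) x.

Notation v := (vac D).
Notation D' := (swapped D).

Lemma modED p n x : modE (A p) n x = op D p (ge, n) x. Proof. exact: (actD p ge). Qed.
Lemma modFD p n x : modF (A p) n x = op D p (gf, n) x. Proof. exact: (actD p gf). Qed.
Lemma modHD p n x : modH (A p) n x = op D p (gh, n) x. Proof. exact: (actD p gh). Qed.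

Lemma divFD p s x : divF (A p) s x = foldr (fun i => op D p (gf, - i%:Z)) x s.
Proof. by elim: s => //= i s ->; exact: modFD. Qed.
Lemma divHD p s x : divH (A p) s x = foldr (fun i => op D p (gh, - i%:Z)) x s.
Proof. by elim: s => //= i s ->; exact: modHD. Qed.
Lemma divED p s x : divE (A p) s x = foldr (fun i => op D p (ge, - i%:Z)) x s.
Proof. by elim: s => //= i s ->; exact: modED. Qed.

Lemma swapF p (i : nat) u : op D' 0 (gf, - i%:Z) u = op D p (ge, - i.+1%:Z) u.
Proof.
rewrite -[LHS]/(op D (swap_weight 0) (ge, - i%:Z - 1) u).
have -> : - i%:Z - 1 = - i.+1%:Z by lia.
exact: vop_indep.
Qed.
Lemma swapE p (i : nat) u : op D' 0 (ge, - i.+1%:Z) u = op D p (gf, - i%:Z) u.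
Proof.
rewrite -[LHS]/(op D (swap_weight 0) (gf, - i.+1%:Z + 1) u).
have -> : - i.+1%:Z + 1 = - i%:Z by lia.
by apply: vop_indep; rewrite /lowering /=; lia.
Qed.
Lemma swapH p (i : nat) u : op D' 0 (gh, - i.+1%:Z) u = - op D p (gh, - i.+1%:Z) u.
Proof.
rewrite -[LHS]/(0 *: u - op D (swap_weight 0) (gh, - i.+1%:Z) u) scale0r sub0r.
by congr (- _); apply: vop_indep.
Qed.

Lemma fword_D p w : fword (A p) v w = wvec D (map (letter12 true) w).
Proof.
elim: w => //= i w ->; case: i => /=.
  by rewrite /f1 modFD op_indep.
by rewrite /f2 modED op_indep.
Qed.

Lemma fword_D' p w : fword (A p) v w = wvec D' (map (letter12 false) w).
Proof.
elim: w => //= i w ->; case: i => /=.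
  by rewrite /f1 modFD -(swapE p 0).
by rewrite /f2 modED -(swapF p 0).
Qed.

Lemma wspace_D' g u : wspace D g u -> wspace D' (g.2, g.1) u.
Proof.
move/wspace_simple; elim/in_span_rect => [|s x y|w [gw <-]]; [exact: in_span0|exact: in_span_lin|].
pose bw : seq bool := [seq x == (gf, 0) | x <- w].
have ebw : map (letter12 true) bw = w.
  rewrite /bw -map_comp -[RHS]map_id; apply/eq_in_map => y /(allP gw) /=.
  by rewrite /letter12 => /orP[] /eqP ->.
rewrite -ebw -(fword_D 0) (fword_D' 0); apply: in_span_wvec; split; first exact: lowering_letter12.
by rewrite !wweight_letter12.
Qed.

Lemma foldr_indep p (f : nat -> letter) s u : all (fun i => lowering (f i)) s ->
  foldr (fun i => op D p (f i)) u s = foldr (fun i => op D 0 (f i)) u s.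
Proof. by elim: s => //= i s IH /andP[ni /IH ->]; rewrite op_indep. Qed.

Lemma foldr_homog p (f : nat -> letter) s u : (exists g, wspace D g u) ->
  exists g, wspace D g (foldr (fun i => op D p (f i)) u s).
Proof.
move=> hu; elim: s => //= i s [g hg]; exists (g + lweight (f i)); exact: op_wspace.
Qed.

Lemma vac_homog : exists g, wspace D g v.
Proof. by exists 0; exact: (wspace_vac D). Qed.

Lemma wvec_FHE (D0 : verma_data V) a h e : wvec D0 (FHE a h e) =
  foldr (fun i => op D0 0 (gf, - i%:Z)) (foldr (fun i => op D0 0 (gh, - i.+1%:Z))
    (foldr (fun i => op D0 0 (ge, - i.+1%:Z)) (vac D0) e) h) a.
Proof. by rewrite /FHE /wvec !foldr_cat !foldr_map. Qed.

Lemma pbw_vec_X p b a h e :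
  pbw_vec (A p) v (b.+1, b) (a, map succn h, map succn e) = wvec D (FHE a h e).
Proof.
rewrite /pbw_vec /= ltnSn /= wvec_FHE divFD divHD divED !foldr_map.
rewrite (@foldr_indep p (fun i => (gf, - i%:Z))); last by apply/allP => i _; rewrite /lowering /=; lia.
rewrite (@foldr_indep p (fun i => (gh, - i.+1%:Z))); last by apply/allP.
by rewrite (@foldr_indep p (fun i => (ge, - i.+1%:Z))); last by apply/allP.
Qed.

(** In the order e, h, f the basis is, up to sign, the basis in the order f, h, e
    for the exchanged operators. *)
Lemma pbw_vec_Y p b a h e : exists s : K, wvec D' (FHE a h e) =
  s *: pbw_vec (A p) v (b, b.+1) (e, map succn h, map succn a).
Proof.
rewrite /pbw_vec /= ltnNge leqnSn /= wvec_FHE divFD divHD divED !foldr_map.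
have -> : (fun i : nat => op D' 0 (gf, - i%:Z)) = (fun i u => op D p (ge, - i.+1%:Z) u).
  by apply/funext => i; apply/funext => u; exact: swapF.
have -> : (fun i : nat => op D' 0 (ge, - i.+1%:Z)) = (fun i u => op D p (gf, - i%:Z) u).
  by apply/funext => i; apply/funext => u; exact: swapE.
exists ((-1) ^+ size h).
have sH u : foldr (fun i => op D' 0 (gh, - i.+1%:Z)) u h =
    (-1) ^+ size h *: foldr (fun i => op D p (gh, - i.+1%:Z)) u h.
  elim: (h) => [|i r IH] /=; first by rewrite scale1r.
  by rewrite (swapH p) IH opZ exprS mulN1r scaleNr.
rewrite sH; elim: (a) => //= i r ->; exact: opZ.
Qed.

Lemma sumn_eq0 s : sumn (map succn s) = 0%N -> s = [::].
Proof. by case: s. Qed.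

Lemma map_S s : all (leq 1) s -> exists r, s = map succn r.
Proof.
elim: s => [_|[|n] s IH] //=; first by exists [::].
by move/IH => [r ->]; exists (n :: r).
Qed.

Lemma sorted_map_S s : sorted geq (map succn s) = sorted geq s.
Proof. by rewrite sorted_map. Qed.

Lemma component_nat s p w : all lowering w ->
  (forall w', fword (A p) v w' = wvec (if s then D else D') (map (letter12 s) w')) ->
  component (A p) v (if s then (absz (wweight w).1, absz (wweight w).2)
                     else (absz (wweight w).2, absz (wweight w).1))
     (wvec (if s then D else D') w).
Proof.
move=> nw hf; have h := wspace_wvec (if s then D else D') nw.
have [h2 _ _] := wweight_bounds nw; have h1 := wweight1_ge0 nw.
case: s hf h => hf h.
  apply/(component_wspace (D := D) (s := true) hf); rewrite /wt12 /=.
  by rewrite !gez0_abs -?surjective_pairing.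
apply/(component_wspace (D := D') (s := false) hf); rewrite /wt12 /=.
by rewrite !gez0_abs -?surjective_pairing.
Qed.

(** A word of degree (b+1, b) has one factor f more than factors e, hence starts
    with some f/T^i; for i = b nothing is left for the other factors. *)
Lemma is_dual_X p b (phi : V -> K) :
  (forall s u w, phi (s *: u + w) = s * phi u + phi w) ->
  (forall g u, wspace D g u -> g != (b.+1%:Z, b%:Z) -> phi u = 0) ->
  (forall (j : nat) g u, wspace D g u -> j != b -> phi (op D 0 (gf, - j%:Z) u) = 0) ->
  phi (op D 0 (gf, - b%:Z) v) = 1 ->
  is_dual_vec (A p) v (b.+1, b) ([:: b], [::], [::]) phi.
Proof.
move=> h1 h2 h3 h4; split => // [[[sF sH] sE]|g' x gg' /(component_wspace (D := D) (fword_D p)) hx].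
  case/and5P => _ /andP[_ aH] /andP[_ aE] /= /eqP e1 /eqP e2.
  have [rH eH] := map_S aH; have [rE eE] := map_S aE; subst sH sE.
  case: sF e1 e2 => [|i s] /= e1 e2; first by exfalso; lia.
  rewrite ltnSn /= divFD divHD divED modFD.
  have ni : lowering (gf, - i%:Z) by rewrite /lowering /=; lia.
  rewrite (op_indep D p _ ni).
  have [ib|ib] := eqVneq i b.
    have [r0 s0 sE0] : [/\ sumn (map succn rH) = 0, sumn s = 0 & sumn (map succn rE) = 0]%N.
      by split; lia.
    rewrite (sumn_eq0 r0) (sumn_eq0 sE0) /= in e1 *.
    have -> : s = [::] by case: (s) e1 s0 e2 r0 sE0 => //= x s'; lia.
    by rewrite ib eqxx h4.
  have [g hg] := foldr_homog p (fun i => (gf, - i%:Z)) s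
    (foldr_homog p (fun i => (gh, - i%:Z)) (map succn rH)
    (foldr_homog p (fun i => (ge, - i%:Z)) (map succn rE) vac_homog)).
  by rewrite (h3 _ _ _ hg ib) !xpair_eqE eqseq_cons (negPf ib).
apply: (h2 _ _ hx); apply: contra_neq gg' => -[e1 e2].
by rewrite [LHS]surjective_pairing e1 e2.
Qed.

Lemma is_dual_Y p b (phi : V -> K) :
  (forall s u w, phi (s *: u + w) = s * phi u + phi w) ->
  (forall g u, wspace D' g u -> g != (b.+1%:Z, b%:Z) -> phi u = 0) ->
  (forall (j : nat) g u, wspace D' g u -> j != b -> phi (op D' 0 (gf, - j%:Z) u) = 0) ->
  phi (op D' 0 (gf, - b%:Z) v) = 1 ->
  is_dual_vec (A p) v (b, b.+1) ([::], [::], [:: b.+1]) phi.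
Proof.
move=> h1 h2 h3 h4; split => // [[[sF sH] sE]|g' x gg' /(component_wspace (D := D') (fword_D' p)) hx].
  case/and5P => _ /andP[_ aH] /andP[_ aE] /= /eqP e1 /eqP e2.
  have [rH eH] := map_S aH; have [rE eE] := map_S aE; subst sH sE.
  case: rE aE e1 e2 => [|i s] /= aE e1 e2; first by exfalso; lia.
  rewrite ltnNge leqnSn /=.
  rewrite divFD divHD divED modED -(swapF p).
  have [ib|ib] := eqVneq i b.
    have [r0 s0 sE0] : [/\ sumn (map succn rH) = 0, sumn sF = 0 & sumn (map succn s) = 0]%N.
      by split; lia.
    rewrite (sumn_eq0 r0) (sumn_eq0 sE0) /= in e1 *.
    have -> : sF = [::] by case: (sF) e1 s0 e2 r0 sE0 => //= x s'; lia.
    by rewrite ib eqxx h4.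
  have [g hg] := foldr_homog p (fun i => (ge, - i%:Z)) (map succn s)
    (foldr_homog p (fun i => (gh, - i%:Z)) (map succn rH)
    (foldr_homog p (fun i => (gf, - i%:Z)) sF vac_homog)).
  by rewrite (h3 _ _ _ (wspace_D' hg) ib) !xpair_eqE eqseq_cons eqSS (negPf ib) !andbF.
apply: (h2 _ _ hx); apply: contra_neq gg' => -[e1 e2].
by rewrite [LHS]surjective_pairing e1 e2.
Qed.

Lemma dual_vec_X_unique p b phi psi :
  is_dual_vec (A p) v (b.+1, b) ([:: b], [::], [::]) phi ->
  is_dual_vec (A p) v (b.+1, b) ([:: b], [::], [::]) psi -> phi = psi.
Proof.
move=> [h1 h2 h3] [k1 k2 k3].
apply: (functional_ext (D := D) (g := (b.+1%:Z, b%:Z)) h1 k1) => [w nw dw|a h e sa sh se].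
  have hc := component_nat (s := true) nw (fword_D p).
  have ne : (absz (wweight w).1, absz (wweight w).2) != (b.+1, b).
    apply: contraNneq dw => -[e1 e2]; have [d2 _ _] := wweight_bounds nw.
    have d1 := wweight1_ge0 nw; apply/eqP.
    by rewrite [LHS]surjective_pairing -(gez0_abs d1) -(gez0_abs d2) e1 e2.
  by rewrite (h3 _ _ ne hc) (k3 _ _ ne hc).
rewrite wweight_FHE => -[e1 e2]; rewrite -(pbw_vec_X p b).
have hi : pbw_index (b.+1, b) (a, map succn h, map succn e).
  rewrite /pbw_index /= !sorted_map_S sa sh se !all_map /= size_map.
  rewrite !(eq_all (_ : _ =1 predT)) ?all_predT //=.
  by have := sumn_map_S e => ee; apply/andP; split; lia.
by rewrite h2 // k2.
Qed.

Lemma dual_vec_Y_unique p b phi psi :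
  is_dual_vec (A p) v (b, b.+1) ([::], [::], [:: b.+1]) phi ->
  is_dual_vec (A p) v (b, b.+1) ([::], [::], [:: b.+1]) psi -> phi = psi.
Proof.
move=> [h1 h2 h3] [k1 k2 k3].
apply: (functional_ext (D := D') (g := (b.+1%:Z, b%:Z)) h1 k1) => [w nw dw|a h e sa sh se].
  have hc := component_nat (s := false) nw (fword_D' p).
  have ne : (absz (wweight w).2, absz (wweight w).1) != (b, b.+1).
    apply: contraNneq dw => -[e1 e2]; have [d2 _ _] := wweight_bounds nw.
    have d1 := wweight1_ge0 nw; apply/eqP.
    by rewrite [LHS]surjective_pairing -(gez0_abs d1) -(gez0_abs d2) e1 e2.
  by rewrite (h3 _ _ ne hc) (k3 _ _ ne hc).
rewrite wweight_FHE => -[e1 e2].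
have hi : pbw_index (b, b.+1) (e, map succn h, map succn a).
  rewrite /pbw_index /= !sorted_map_S sa sh se !all_map /= size_map.
  rewrite !(eq_all (_ : _ =1 predT)) ?all_predT //=.
  by have := sumn_map_S a => ea; have := sumn_map_S e => ee; apply/andP; split; lia.
have [s ->] := pbw_vec_Y p b a h e.
rewrite -[_ *: _]addr0 h1 k1 h2 // k2 //; congr (_ + _).
have -> : phi 0 = 0 by have := h1 (-1) 0 0; rewrite scaler0 addr0 mulN1r addNr.
by have -> : psi 0 = 0 by have := k1 (-1) 0 0; rewrite scaler0 addr0 mulN1r addNr.
Qed.
End DualVectors.

(** * Resonance lines *)

Section ResonanceLines.
Variable K : numClosedFieldType.
Implicit Types (p : K * K) (n z : int).

(** The equation of [degenerate_resonant] for n > 0 and n < 0 is that of the two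
    families of resonance lines; z = 0 is excluded for n < 0 because the degree
    would be negative. *)
Lemma casimir_line p n z : n != 0 -> 0 <= - n * z -> 0 <= n - 2 * n * z ->
  p.1 + 1 = n%:~R + z%:~R * (p.2 + 2) ->
  (exists l a : nat, [/\ (0 < l)%N, n = l%:Z, z = - a%:Z & lineF l a.+1 p]) \/
  (exists l a : nat, [/\ (0 < l)%N, (0 < a)%N, n = - l%:Z, z = a%:Z & lineE l a p]).
Proof.
move=> n0 h1 h2 e; have [hn|hn] := ltP 0 n.
  have hz : z <= 0 by nia.
  left; exists (absz n), (absz z); split; [lia|lia|lia|].
  rewrite /lineF /= -natr1 addrK; have -> : p.1 = n%:~R - 1 + z%:~R * (p.2 + 2).
    by rewrite addrAC -e addrK.
  have -> : n%:~R = (absz n)%:R :> K by rewrite -[in LHS](gtz0_abs hn).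
  have -> : z%:~R = - (absz z)%:R :> K.
    have ez : z = - (absz z)%:Z by lia.
    by rewrite [in LHS]ez rmorphN.
  by ring.
have hz : 0 < z by nia.
right; exists (absz n), (absz z); split; [lia|lia|lia|lia|].
rewrite /lineE /=; have -> : p.1 = n%:~R - 1 + z%:~R * (p.2 + 2).
  by rewrite addrAC -e addrK.
have -> : z%:~R = (absz z)%:R :> K by rewrite -[in LHS](gtz0_abs hz).
have -> : n%:~R = - (absz n)%:R :> K.
  have en : n = - (absz n)%:Z by lia.
  by rewrite [in LHS]en rmorphN.
by ring.
Qed.

Lemma res_lineF l a : (0 < l)%N -> (0 < a)%N -> resonance_lines (lineF (K := K) l a).
Proof. by move=> hl ha; left; exists l, a; split => //; left. Qed.
Lemma res_lineE l a : (0 < l)%N -> (0 < a)%N -> resonance_lines (lineE (K := K) l a).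
Proof. by move=> hl ha; left; exists l, a; split => //; right. Qed.
Lemma res_critical : resonance_lines (@critical_line K). Proof. by right. Qed.

Lemma lineF_swap l a p : lineF l a (swap_weight p) -> lineE l a p.
Proof. 
rewrite /lineF /lineE /swap_weight /= => e.
have -> : p.1 = p.2 - (p.2 - p.1) by ring.
by rewrite e; ring.
Qed.

Lemma lineE_swap l a p : lineE l a (swap_weight p) -> lineF l a p.
Proof. 
rewrite /lineF /lineE /swap_weight /= => e.
have -> : p.1 = p.2 - (p.2 - p.1) by ring.
by rewrite e; ring.
Qed.

Lemma nonresonantE p : nonresonant p -> forall B, nonres_below B p.
Proof.
move=> hp B; split; first by apply/eqP => e; exact: (hp _ res_critical).
move=> n z n0 h1 /andP[h2 _]; apply/eqP => /(casimir_line n0 h1 h2)[].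
  by case=> l [a [hl _ _ h]]; apply: (hp _ (res_lineF hl (ltn0Sn a))).
by case=> l [a [hl ha _ _ h]]; apply: (hp _ (res_lineE hl ha)).
Qed.

(** The two families of resonance lines are exchanged by [swap_weight]. *)
Lemma nonresonant_swap p : nonresonant p -> forall B, nonres_below B (swap_weight p).
Proof.
move=> hp B; split; first by apply/eqP => e; exact: (hp _ res_critical).
move=> n z n0 h1 /andP[h2 _]; apply/eqP => /(casimir_line n0 h1 h2)[].
  by case=> l [a [hl _ _ h]]; apply: (hp _ (res_lineE hl (ltn0Sn a))); exact: lineF_swap.
by case=> l [a [hl ha _ _ h]]; apply: (hp _ (res_lineF hl ha)); exact: lineE_swap.
Qed.

(** Two points determine a line; the ones with k = -2 and k = -1 make the
    parameters readable. *)
Lemma line_points (m r : K) (L : set (K * K)) :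
  [set p : K * K | p.1 = m + r * (p.2 + 2)] = L -> L (m, -2) /\ L (m + r, -1).
Proof.
by move=> <-; split => /=; [rewrite addNr mulr0 addr0|
  rewrite (_ : -1 + 2 = 1 :> K) ?mulr1 //; ring].
Qed.

(** The only resonance line through p comes from the degree (b+1, b), of height
    2 b + 1. *)
Lemma on_line_nonres_X b p : on_line_only [set p : K * K | p.1 = - b%:R * (p.2 + 2)] p ->
  nonres_below (2 * b%:Z + 1) p.
Proof.
have -> : [set p : K * K | p.1 = - b%:R * (p.2 + 2)] =
          [set p : K * K | p.1 = 0 + (- b%:R) * (p.2 + 2)].
  by apply/funext => q /=; rewrite add0r.
move=> [hL hp]; split.
  apply/eqP => e; have [_] := line_points (esym (hp _ res_critical e)).
  rewrite /critical_line /= => /eqP; rewrite (_ : -1 + 2 = 1 :> K) ?oner_eq0 //; ring.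
move=> n z n0 h1 /andP[h2 h3]; apply/eqP => /(casimir_line n0 h1 h2)[].
  case=> l [a [hl en ez h]]; have [] := line_points (esym (hp _ (res_lineF hl (ltn0Sn a)) h)).
  rewrite /lineF /= addNr mulr0 subr0 -natr1 addrK => e1.
  rewrite (_ : -1 + 2 = 1 :> K) ?mulr1 ?add0r; last by ring.
  rewrite -e1 add0r => /oppr_inj/eqP; rewrite eqr_nat => /eqP eba.
  have /eqP : l%:R = 1%:R :> K by rewrite -[LHS](subrK 1) -e1 add0r.
  by rewrite eqr_nat => /eqP el; move: h3; rewrite en ez el eba; lia.
case=> l [a [hl ha en ez h]]; have [+ _] := line_points (esym (hp _ (res_lineE hl ha) h)).
rewrite /lineE /= addNr mulr0 addr0 => /esym/eqP.
by rewrite -opprD oppr_eq0 natr1 pnatr_eq0.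
Qed.

Lemma on_line_nonres_Y b p : on_line_only [set p : K * K | p.1 = - 2 + b.+1%:R * (p.2 + 2)] p ->
  nonres_below (2 * b%:Z + 1) (swap_weight p).
Proof.
move=> [hL hp]; split.
  apply/eqP => e; have [_] := line_points (esym (hp _ res_critical e)).
  rewrite /critical_line /= => /eqP; rewrite (_ : -1 + 2 = 1 :> K) ?oner_eq0 //; ring.
move=> n z n0 h1 /andP[h2 h3]; apply/eqP => /(casimir_line n0 h1 h2)[].
  case=> l [a [hl en ez /lineF_swap h]].
  have [] := line_points (esym (hp _ (res_lineE hl (ltn0Sn a)) h)).
  rewrite /lineE /= addNr mulr0 addr0 => e1.
  rewrite (_ : -1 + 2 = 1 :> K) ?mulr1 ?add0r -?e1; last by ring.
  move/addrI/eqP; rewrite eqr_nat => /eqP[eba].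
  have /eqP : l%:R = 1%:R :> K.
    have -> : l%:R = - (- l%:R - 1) - 1 :> K by ring.
    by rewrite -e1; ring.
  by rewrite eqr_nat => /eqP el; move: h3; rewrite en ez el eba; lia.
case=> l [a [hl ha en ez /lineE_swap h]].
have [+ _] := line_points (esym (hp _ (res_lineF hl ha) h)).
rewrite /lineF /= addNr mulr0 subr0 => /esym/eqP.
by rewrite -subr_eq0 opprK -addrA (_ : -1 + 2 = 1) ?natr1 ?pnatr_eq0 //; ring.
Qed.
End ResonanceLines.

(** * Continuation and singularity *)

Section SingularFamily.
Variables (R : realType) (V : lmodType R[i]) (D : verma_data V).
Notation C := R[i].
Variables (A : C * C -> affine_module V) (S : C * C -> V -> V -> C).
Variables (f g : (C^o * C^o)%type -> C^o) (b : nat) (gX : nat * nat).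
Variables (phi : V -> C) (X : C * C -> V) (y1 y2 : letter).
Hypothesis S_form : forall p x y, S p x y = form D (f p, g p) x y.
Hypothesis df : forall p, differentiable f p.
Hypothesis dg' : forall p, differentiable g p.
Hypothesis nonres : forall p, nonresonant p -> forall B, nonres_below B (f p, g p).
Hypothesis hX : forall p, nonres_below (2 * b%:Z + 1) p ->
  [/\ ratvec p X, wspace D (b.+1%:Z, b%:Z) (X p), X p != 0 &
      forall z, form D p (X p) z = (p.1 + b%:R * (p.2 + 2)) * phi z].
Hypothesis compX : forall p x, wspace D (b.+1%:Z, b%:Z) x -> component (A p) (vac D) gX x.
Hypothesis e1E : forall p x, e1 (A p) x = op D (f p, g p) y1 x.
Hypothesis e2E : forall p x, e2 (A p) x = op D (f p, g p) y2 x.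
Hypothesis pos1 : lowering (transpose y1).
Hypothesis pos2 : lowering (transpose y2).

(** Both parts of the theorem: the weights are (f p, g p), and [phi], [X] are
    those of [X_family]. *)
Lemma singular_family (F : C * C -> V) (p0 : C * C) :
  (forall p, F p = form_inv (S p) (fun y => (f p + b%:R * (g p + 2)) * phi y)) ->
  nonres_below (2 * b%:Z + 1) (f p0, g p0) -> f p0 + b%:R * (g p0 + 2) = 0 ->
  exists Y : C * C -> V, [/\ continuation_at (@nonresonant C) F Y p0,
    Y p0 <> 0 & singular (A p0) (vac D) (Y p0)].
Proof.
move=> hF h0 hL; have [rX wX nX kX] := hX h0.
exists (fun p => X (f p, g p)); split; last 1 first.
- have ker u : form D (f p0, g p0) (X (f p0, g p0)) u = 0 by rewrite kX /= hL mul0r.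
  have hs y : lowering (transpose y) -> op D (f p0, g p0) y (X (f p0, g p0)) = 0.
    by apply: (kernel_positive h0 _ wX ker) => /=; lia.
  split.
  + by exists gX; exact: compX.
  + case=> s es; have := ker (vac D).
    rewrite es formZl form_vac mulr1 => s0.
    by move/eqP: nX; apply; rewrite es s0 scale0r.
  + by rewrite e1E hs.
  + by rewrite e2E hs.
- split; first exact: holomorphic_ratvec.
  near=> p => hp; rewrite hF /form_inv.
  have [_ _ _ kp] := hX (nonres hp (2 * b%:Z + 1)).
  have ex : [set x | forall y, S p x y = (f p + b%:R * (g p + 2)) * phi y] (X (f p, g p)).
    by move=> y; rewrite S_form kp.
  have := xgetPex 0 (ex_intro _ _ ex); set x := xget _ _ => hx.
  apply/eqP; rewrite -subr_eq0; apply/eqP.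
  apply: (nondegenerate (D := D) (nonres hp)) => y.
  by rewrite addrC -scaleN1r form_linear kp /= -S_form hx mulN1r addNr.
- exact/eqP.
Unshelve. all: by end_near.
Qed.
End SingularFamily.

Unset Implicit Arguments.

Theorem theorem6p2 (R : realType) (V : lmodType R[i]) (v : V)
    (A : R[i] * R[i] -> affine_module V) (hA : verma_family A v)
    (S : R[i] * R[i] -> V -> V -> R[i])
    (hS : forall p : R[i] * R[i], is_shapovalov (A p) v (S p)) :
  (forall (b : nat) (M0 k0 : R[i]),
     on_line_only [set p : R[i] * R[i] | p.1 = - b%:R * (p.2 + 2)] (M0, k0) ->
     exists X : R[i] * R[i] -> V,
       [/\ continuation_at (@nonresonant R[i]) (Xvec A v S b) X (M0, k0),
           X (M0, k0) <> 0 & singular (A (M0, k0)) v (X (M0, k0))]) /\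
  (forall (b : nat) (M0 k0 : R[i]), (0 < b)%N ->
     on_line_only [set p : R[i] * R[i] | p.1 = - 2 + b%:R * (p.2 + 2)] (M0, k0) ->
     exists Y : R[i] * R[i] -> V,
       [/\ continuation_at (@nonresonant R[i]) (Yvec A v S b) Y (M0, k0),
           Y (M0, k0) <> 0 & singular (A (M0, k0)) v (Y (M0, k0))]).
Proof.
pose D := verma_of_affine hA hS.
have actD p a n x : act (A p) (gen_matrix R[i] a) n x = op D p (a, n) x by [].
have formD p x y : S p x y = form D p x y by [].
have dfst : forall p, differentiable (fst : (R[i]^o * R[i]^o)%type -> R[i]^o) p.
  by move=> p; exact: differentiable_fst.
have dsnd : forall p, differentiable (snd : (R[i]^o * R[i]^o)%type -> R[i]^o) p.
  by move=> p; exact: differentiable_snd.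
rewrite -[v]/(vac D); clearbody D.
split=> [b M0 k0 hp|[//|b] M0 k0 _ hp].
  have [phi [X [h1 h2 h3 h4 hX]]] := X_family D b.
  apply: (@singular_family R V D A S fst snd b (b.+1, b) phi X (ge, 0) (gf, 1)) => //.
  - by case.
  - by move=> [M k] hMk B; exact: nonresonantE.
  - by move=> p x; case: p => M k hx; apply/(component_wspace (s := true) (fword_D actD _)).
  - by move=> [M k] x; exact: (actD (M, k) ge).
  - by move=> [M k] x; exact: (actD (M, k) gf).
  - move=> p; rewrite /Xvec; congr form_inv; apply/funext => y; congr (_ * _ y).
    have hd := is_dual_X actD p h1 h2 h3 h4.
    exact: (dual_vec_X_unique actD (xgetPex (fun=> 0) (ex_intro _ _ hd)) hd).
  - exact: on_line_nonres_X.
  - by case: hp => /= -> _; rewrite mulNr addNr.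
have [phi [X [h1 h2 h3 h4 hX]]] := X_family (swapped D) b.
apply: (@singular_family R V (swapped D) A S (snd \- fst) snd b (b, b.+1) phi X
   (gf, 1) (ge, 0)) => //.
- move=> [M k] x y; rewrite formD.
  by rewrite -[RHS]/(form D (k - (k - M), k) x y) opprB addrC subrK.
- by move=> p; apply: differentiableB.
- by move=> [M k] hMk B; exact: (nonresonant_swap hMk).
- by move=> p x hx; apply/(component_wspace (D := swapped D) (s := false) (fword_D' actD p)).
- move=> [M k] x; rewrite -[RHS]/(op D (k - (k - M), k) (ge, 1 - 1) x) subrr.
  by rewrite opprB addrC subrK; exact: (actD (M, k) ge).
- move=> [M k] x; rewrite -[RHS]/(op D (k - (k - M), k) (gf, 0 + 1) x) add0r.
  by rewrite opprB addrC subrK; exact: (actD (M, k) gf).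
- move=> p; rewrite /Yvec; congr form_inv; apply/funext => y; congr (_ * _ y).
    by rewrite -natr1 addrK.
  have hd := is_dual_Y actD p h1 h2 h3 h4.
  exact: (dual_vec_Y_unique actD (xgetPex (fun=> 0) (ex_intro _ _ hd)) hd).
- exact: on_line_nonres_Y.
- by case: hp => /= -> _; rewrite -natr1; ring.
Qed.
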